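(* For each $n$, let $A_n$ be the $n\times n$ circulant matrix $C_n$, or for each $n$ let $A_n$ be the $n\times n$ symmetric circulant matrix $SC_n$, built from a Gaussian input sequence $\{X_j : j\ge 0\}$. Suppose $\{p_n\}$ is a sequence of positive integers such that $p_n=o(\log n/\log\log n)$. Then, as $n\to\infty$, $$\frac{\mathrm{Tr}(A_n^{p_n})-\mathbf{E}[\mathrm{Tr}(A_n^{p_n})]}{\sqrt{\mathrm{Var}(\mathrm{Tr}(A_n^{p_n}))}}$$ converges in total variation norm to $N(0,1)$.
   Context: A Gaussian input sequence $\{X_j: j\ge 0\}$ is a sequence of i.i.d. standard normal random variables. For $1\le i,j\le n$, the circulant matrix $C_n$ has $(i,j)$-th entry $X_{(j-i)\bmod n}$ (residues taken in $\{0,\dots,n-1\}$). The symmetric circulant matrix $SC_n$ has $(i,j)$-th entry $X_{\frac n2-\left|\frac n2-|i-j|\right|}$, i.e. $X_{\min(|i-j|,\,n-|i-j|)}$. Convergence in total variation norm means that the total variation distance between the laws tends to $0$. *)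

(* Defs.v *)
From HB Require Import structures.
From mathcomp Require Import all_boot all_order all_algebra.
From mathcomp Require Import all_classical all_reals all_analysis.
From mathcomp Require Import measurable_realfun.

Set Implicit Arguments.
Unset Strict Implicit.
Unset Printing Implicit Defensive.

Import Order.TTheory GRing.Theory Num.Theory.
Import numFieldNormedType.Exports.

Local Open Scope classical_set_scope.
Local Open Scope ring_scope.

(* No truncation occurs in [n + j - i], since [i < n]. *)
Definition circulant (V : Type) (x : nat -> V) (n : nat) : 'M[V]_n :=
  \matrix_(i < n, j < n) x ((n + j - i) %% n)%N.

(* The index is n/2 - |n/2 - |i - j||. *)
Definition sym_circulant (V : Type) (x : nat -> V) (n : nat) : 'M[V]_n :=
  \matrix_(i < n, j < n) x (minn `|i - j| (n - `|i - j|))%N.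

Definition mutually_independent d (T : measurableType d) (R : realType)
    (P : probability T R) (X : nat -> {RV P >-> R}) : Prop :=
  forall (s : seq nat) (B : nat -> set R), uniq s ->
    (forall j, measurable (B j)) ->
    P (\bigcap_(j in [set` s]) X j @^-1` B j) =
    (\prod_(j <- s) P (X j @^-1` B j))%E.

Arguments mutually_independent {d T R} P X.

Definition gaussian_input d (T : measurableType d) (R : realType)
    (P : probability T R) (X : nat -> {RV P >-> R}) : Prop :=
  mutually_independent P X /\
  forall (j : nat) (B : set R), measurable B ->
    distribution P (X j) B = normal_prob 0 1 B.

Arguments gaussian_input {d T R} P X.

(* [mu] and [nu] are bare set functions because [normal_prob] and laws of
   {RV P >-> R} carry their measure structures over two convertible but
   syntactically distinct Borel [measurableType]s on [R]. *)
Definition total_variation_distance d (T : measurableType d) (R : realType)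
    (mu nu : set T -> \bar R) : \bar R :=
  ereal_sup [set `|mu B - nu B|%E | B in measurable].

Definition trace_power d (T : measurableType d) (R : realType)
    (P : probability T R) (n : nat) (A : 'M[{RV P >-> R}]_n) (k : nat)
    : T -> R :=
  fun w => \tr (map_mx (fun Y : {RV P >-> R} => Y w) A ^+ k).

Arguments trace_power {d T R} P {n} A k.

Lemma measurable_trace_power d (T : measurableType d) (R : realType)
    (P : probability T R) (n : nat) (A : 'M[{RV P >-> R}]_n) (k : nat) :
  measurable_fun setT (trace_power P A k).
Proof.
have mentry i j : measurable_fun setT
    (fun w => (map_mx (fun Y : {RV P >-> R} => Y w) A ^+ k) i j).
  elim: k i j => [|k IH] i j.
    by under eq_fun do rewrite expr0 mxE; exact: measurable_cst.
  under eq_fun do rewrite exprS mxE.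
  apply: measurable_sum => l; apply: measurable_funM => //.
  by under eq_fun do rewrite mxE; exact: measurable_funPT.
by rewrite /trace_power; apply: measurable_sum => i; exact: mentry.
Qed.

Arguments measurable_trace_power {d T R} P {n} A k.

HB.instance Definition _ d (T : measurableType d) (R : realType)
    (P : probability T R) (n : nat) (A : 'M[{RV P >-> R}]_n) (k : nat) :=
  isMeasurableFun.Build _ _ _ _ (trace_power P A k)
    (measurable_trace_power P A k).

(* Both moments are finite for polynomials in Gaussian variables, so that [fine]
   is harmless below. *)
Definition standardized d (T : measurableType d) (R : realType)
    (P : probability T R) (Y : {RV P >-> R}) : T -> R :=
  fun w => (Y w - fine 'E_P[Y]%E) / Num.sqrt (fine 'V_P[Y]%E).

Arguments standardized {d T R} P Y.

Lemma measurable_standardized d (T : measurableType d) (R : realType)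
    (P : probability T R) (Y : {RV P >-> R}) :
  measurable_fun setT (standardized P Y).
Proof.
apply: measurable_funM; last exact: measurable_cst.
by apply: measurable_funB => //; exact: measurable_cst.
Qed.

Arguments measurable_standardized {d T R} P Y.

HB.instance Definition _ d (T : measurableType d) (R : realType)
    (P : probability T R) (Y : {RV P >-> R}) :=
  isMeasurableFun.Build _ _ _ _ (standardized P Y)
    (measurable_standardized P Y).

(* Main.v *)
(* With lambda_k the eigenvalues of A_n, Tr (A_n^p) = sum_k lambda_k^p, and the
   lambda_k are complex linear forms in the Gaussian input. The one-variable
   equation y v - c v' = y^p - const has a polynomial solution v; combining the
   v (lambda_k) gives a polynomial vector field V with W - E W = sum_j (X_j V_j - d_j V_j)
   for the normalised trace W. Hence K = sum_j V_j d_j W is a Stein kernel: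
   E [(W - E W) f W] = E [K f' W] and E K = Var W, and Stein's equation bounds the
   total variation distance by E |1 - K / Var W| up to a factor. The Gaussian
   Poincare inequality controls Var K by E |grad K|^2, which is at most n (C p)^(C p)
   because the lambda_k are almost uncorrelated, while Var W >= n / (2 * 4^p). The
   resulting bound, the square root of (C p)^(C p) / n, tends to 0 because
   p log p = o(log n). *)

Require Import Defs.
From HB Require Import structures.
From mathcomp Require Import all_boot all_order all_algebra.
From mathcomp Require Import all_classical all_reals all_analysis.
From mathcomp Require Import measurable_realfun.
From mathcomp Require Import zify ring lra.
From mathcomp Require Import -(notations) cyclic separable cyclotomic complex mpoly.

Set Implicit Arguments.
Unset Strict Implicit.
Unset Printing Implicit Defensive.

Import Order.TTheory GRing.Theory Num.Theory.
Import numFieldNormedType.Exports.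

Local Open Scope classical_set_scope.
Local Open Scope ring_scope.

(** * Integration by parts on the line and the Stein equation *)

Section gaussian_line.
Context {R : realType}.
Notation mu := (@lebesgue_measure R).
Notation gpdf := (@normal_pdf R 0 1).

(** All functionals of the input are kept polynomial: derivatives, integrations by parts and the
    Poincare inequality become algebra in [mpoly], and analysis is confined to one-variable
    integrals, one Fubini step per coordinate and the Stein equation. The eigenvalues are complex
    whereas the trace is real, so the vector field is built over the complex numbers and its real
    part is taken coefficientwise; this respects the divergence identity because the variables and
    the trace have real coefficients. Two matrices govern the estimates: the bilinear covariances of
    the eigenvalues, entering the kernel, and their Hermitian Gram matrix, entering its gradient. In
    both models the rows of either have absolute sum at most 4, which makes E |grad K|^2 linear in
    n. The lower bound on E K = Var W is model-dependent: for circulants K is bounded below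
    pointwise, for symmetric circulants W is tested against an explicit polynomial. Instead of a
    square root, a free parameter e is carried, through 2 |z| <= e + z^2 / e; in the limit e =
    n^(-1/4) suffices. *)

Lemma gpdfE t : gpdf t = normal_peak 1 * expR (- (t ^+ 2 / 2)).
Proof.
by rewrite normal_pdfE ?oner_eq0// /normal_fun subr0 expr1n mulNr.
Qed.

Lemma gpdf_gt0 t : 0 < gpdf t.
Proof. by rewrite gpdfE mulr_gt0 ?expR_gt0// normal_peak_gt0 ?oner_eq0. Qed.

Lemma is_derive_gpdf (t : R) : is_derive t (1 : R) gpdf (- t * gpdf t).
Proof.
have -> : gpdf = fun t => normal_peak 1 * expR (- (t ^+ 2 / 2)).
  by apply/funext => s; rewrite gpdfE.
apply: is_derive_eq.
rewrite /GRing.scale/=; set e := expR _; set k := normal_peak _.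
by rewrite mulr0 mulr0 add0r !mulr1; field.
Qed.

Lemma continuous_gpdf : continuous gpdf.
Proof. exact/continuous_normal_pdf/oner_neq0. Qed.

Lemma exprn_le_expR (n : nat) (s : R) : 0 <= s -> s ^+ n <= n`!%:R * expR s.
Proof.
move=> s0; case: n => [|n].
  by rewrite expr0 fact0 mul1r -expR0 ler_expR.
rewrite mulrC -ler_pdivrMr ?ltr0n ?fact_gt0//.
by apply: le_trans (expR_ge1Dxn n s0); rewrite lerDr.
Qed.

(** With u = (1 + t^2) / 4, u^K <= K! e^u, and the factor e^u weakens the exponent -t^2 / 2 to 1/4 -
    t^2 / 4, still below 1/4 - t^2 / 8. Comparison with the normal density of standard deviation 2
    makes integrability immediate. *)
Lemma growth_gpdf (K : nat) : exists2 C : R, 0 <= C &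
  forall t, (1 + t ^+ 2) ^+ K * gpdf t <= C * normal_pdf 0 2 t.
Proof.
have p2 : (0 : R) < normal_peak 2 by rewrite normal_peak_gt0// pnatr_eq0.
exists (4 ^+ K * K`!%:R * expR (4^-1) * normal_peak 1 / normal_peak 2) => [|t].
  by rewrite !mulr_ge0 ?invr_ge0 ?expR_ge0 ?normal_peak_ge0 ?exprn_ge0.
rewrite gpdfE normal_pdfE ?pnatr_eq0// /normal_fun subr0.
rewrite mulrA (mulrA _ (normal_peak 2)) divfK ?gt_eqF//.
rewrite -!(mulrA (_ ^+ K)) -(mulrA _ (normal_peak 1)) mulrCA.
rewrite [leRHS](_ : _ = normal_peak 1 *
   (4 ^+ K * (K`!%:R * expR (4^-1) * expR (- t ^+ 2 / (2 ^+ 2 *+ 2))))); last ring.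
rewrite ler_pM2l ?normal_peak_gt0 ?oner_eq0//.
have -> : 1 + t ^+ 2 = 4 * (4^-1 * (1 + t ^+ 2)) by field.
rewrite exprMn -mulrA ler_pM2l ?exprn_gt0//.
have h0 : 0 <= 4^-1 * (1 + t ^+ 2) by rewrite mulr_ge0// addr_ge0// sqr_ge0.
apply: le_trans (ler_wpM2r (expR_ge0 _) (exprn_le_expR K h0)) _.
rewrite -!mulrA ler_wpM2l// -!expRD ler_expR.
have := sqr_ge0 t; set s := t ^+ 2 => s0.
have -> : 2 ^+ 2 *+ 2 = 8 :> R by ring.
rewrite mulrA -expr2 -/s.
lra.
Qed.

Definition growing (F : R -> R) := exists (C : R) (K : nat), forall t, `|F t| <= C * (1 + t ^+ 2) ^+ K.

Lemma integrable_growing (F : R -> R) : measurable_fun setT F -> growing F ->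
  mu.-integrable setT (fun t => (F t * gpdf t)%:E).
Proof.
move=> mF [C [K FC]]; have [D D0 HD] := growth_gpdf K.
have C0 : 0 <= C.
  have := FC 0; rewrite expr0n addr0 expr1n mulr1.
  exact: le_trans (normr_ge0 _).
apply: (@le_integrable _ _ _ mu _ measurableT _
   (fun t => (C * D)%:E * (normal_pdf 0 2 t)%:E)%E).
- apply/measurable_EFinP/measurable_funM => //; exact: measurable_normal_pdf.
- move=> t _ /=; rewrite lee_fin normrM (ger0_norm (ltW (gpdf_gt0 t))).
  rewrite (le_trans _ (ler_norm _))// -mulrA.
  apply: le_trans (ler_wpM2l C0 (HD t)).
  by rewrite mulrA ler_wpM2r// ltW// gpdf_gt0.
- by apply: integrableZl => //; exact: integrable_normal_pdf.
Qed.

Lemma growing_le (F G : R -> R) : growing G -> (forall t, `|F t| <= `|G t|) ->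
  growing F.
Proof. by move=> [C [K GC]] FG; exists C, K => t; exact: le_trans (FG t) _. Qed.

Lemma growingM (F G : R -> R) : growing F -> growing G ->
  growing (fun t => F t * G t).
Proof.
move=> [C [K FC]] [D [L GD]]; exists (C * D), (K + L)%N => t.
by rewrite normrM exprD mulrACA ler_pM.
Qed.

Lemma growing_id : growing id.
Proof.
exists 1, 1%N => t; rewrite expr1 mul1r.
have <- : `|t| ^+ 2 = t ^+ 2 by rewrite real_normK ?num_real.
nra.
Qed.

(** These limits kill the boundary terms of the integration by parts. One more power of 1 + t^2 than
    the growth of F requires is spent on the decay rate; the limit at -oo is reflected so that both
    are taken at +oo. *)
Lemma growing_cvg0 (F : R -> R) : growing F ->
  ((F t * gpdf t) @[t --> +oo] --> 0) /\ ((F (- t) * gpdf (- t)) @[t --> +oo] --> 0).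
Proof.
move=> [C [K FC]]; have [D D0 HD] := growth_gpdf K.+1.
have C0 : 0 <= C.
  have := FC 0; rewrite expr0n addr0 expr1n mulr1.
  exact: le_trans (normr_ge0 _).
set E := C * (D * normal_peak 2).
have E0 : 0 <= E by rewrite !mulr_ge0// normal_peak_ge0.
have key t : `|F t * gpdf t| <= E * (1 + t ^+ 2)^-1.
  have t0 : 0 < 1 + t ^+ 2 by rewrite ltr_pwDl// sqr_ge0.
  rewrite ler_pdivlMr// normrM (ger0_norm (ltW (gpdf_gt0 t))).
  apply: (@le_trans _ _ (C * ((1 + t ^+ 2) ^+ K.+1 * gpdf t))).
    rewrite (exprSr _ K) [leRHS](_ : _ = C * (1 + t ^+ 2) ^+ K * (gpdf t * (1 + t ^+ 2))); last ring.
    by rewrite -[leLHS]mulrA ler_wpM2r// mulr_ge0// ltW// gpdf_gt0.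
  rewrite ler_wpM2l//; apply: le_trans (HD t) _.
  by rewrite ler_wpM2l// normal_pdf_ub// pnatr_eq0.
have key2 t : 1 <= t -> E * (1 + t ^+ 2)^-1 <= E * t^-1.
  move=> t1; rewrite ler_wpM2l// lef_pV2 ?posrE; [|nra|lra].
  by nra.
have lim0 : (E * t^-1) @[t --> +oo] --> 0.
  rewrite -(mulr0 E); apply: cvgMr.
  apply/gtr0_cvgV0; last exact: cvg_id.
  exact: nbhs_pinfty_gt.
suff S (G : R -> R) : (forall t, 1 <= t -> `|G t| <= E * t^-1) ->
    G t @[t --> +oo] --> 0.
  split; apply: S => t t1; first exact: le_trans (key t) (key2 t t1).
  by apply: le_trans (key (- t)) _; rewrite sqrrN key2.
move=> HG; apply/cvgr0Pnorm_le => e e0.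
move/cvgr0Pnorm_le : lim0 => /(_ e e0); apply: filter_app.
near=> t => h; apply: le_trans h.
by rewrite (le_trans _ (ler_norm _))// HG//.
Unshelve. all: by end_near. Qed.

End gaussian_line.

Section gaussian_ibp_line.
Context {R : realType}.
Notation mu := (@lebesgue_measure R).
Notation gpdf := (@normal_pdf R 0 1).

Lemma is_derive_continuous (F F' : R -> R) :
  (forall t : R, is_derive t (1 : R) F (F' t)) -> continuous F.
Proof.
move=> dF t; apply: differentiable_continuous; apply/derivable1_diffP.
exact: ex_derive.
Qed.

Lemma is_derive_FTC2 (F F' : R -> R) (a b : R) : a < b ->
  (forall t : R, is_derive t (1 : R) F (F' t)) -> continuous F' ->
  (\int[mu]_(x in `[a, b]) (F' x)%:E = (F b)%:E - (F a)%:E)%E.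
Proof.
move=> ab dF cF'; have cF := is_derive_continuous dF.
apply: continuous_FTC2 => //; first exact: continuous_subspaceT.
  split=> [x _||].
  - exact: ex_derive.
  - exact/cvg_at_right_filter/cF.
  - exact/cvg_at_left_filter/cF.
by move=> x _; rewrite derive1E; exact: derive_val.
Qed.

(** For the density g, (F g)' = F' g - t F g; its integral over [-n, n] is a boundary term tending
    to 0, and dominated convergence passes to the whole line. *)
Lemma gaussian_ibp_line (F F' : R -> R) :
  (forall t : R, is_derive t (1 : R) F (F' t)) -> continuous F' ->
  growing F -> growing F' ->
  (\int[mu]_t (t * F t * gpdf t)%:E = \int[mu]_t (F' t * gpdf t)%:E)%E.
Proof.
move=> dF cF' gF gF'; have cF := is_derive_continuous dF.
have mF : measurable_fun setT F by exact: continuous_measurable_fun.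
have mF' : measurable_fun setT F' by exact: continuous_measurable_fun.
pose H t := F t * gpdf t; pose H' t := F' t * gpdf t - t * F t * gpdf t.
have dH (t : R) : is_derive t (1 : R) H (H' t).
  have h1 := dF t; have h2 := is_derive_gpdf t.
  apply: is_derive_eq; rewrite /H' /GRing.scale/=; ring.
have cH' : continuous H'.
  move=> t; apply: cvgB; apply: cvgM.
  - exact: cF'.
  - exact: continuous_gpdf.
  - by apply: cvgM; [exact: cvg_id|exact: cF].
  - exact: continuous_gpdf.
have i1 : mu.-integrable setT (fun t => (F' t * gpdf t)%:E).
  exact: integrable_growing.
have i2 : mu.-integrable setT (fun t => (t * F t * gpdf t)%:E).
  apply: integrable_growing; first exact: measurable_funM.
  by apply: growingM => //; exact: growing_id.
have iH : mu.-integrable setT (fun t => (H' t)%:E).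
  rewrite (_ : (fun _ => _) = (fun t => (F' t * gpdf t)%:E - (t * F t * gpdf t)%:E)%E)//.
  exact: integrableB.
suff H0 : (\int[mu]_t (H' t)%:E = 0)%E.
  have := integralB measurableT i1 i2.
  rewrite (_ : (fun _ => _ - _)%E = (fun t => (H' t)%:E)) ?H0//.
  move=> /esym/eqP; rewrite sube_eq ?add0e.
  + by move=> /eqP.
  + exact: integrable_fin_num.
  + by rewrite fin_num_adde_defl// integrable_fin_num.
pose f_ n := (fun t => (H' t)%:E) \_ `[- n%:R, (n%:R : R)].
have mH' : measurable_fun setT (fun t => (H' t)%:E) by exact: measurable_int iH.
have mf_ n : measurable_fun setT (f_ n).
  apply/(measurable_restrictT (fun t => (H' t)%:E)) => //.
  exact: measurable_funS mH'.
have [|||_ _] := @dominated_convergence _ _ _ mu _ measurableT f_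
   (fun t => (H' t)%:E) (fun t => `|(H' t)%:E|%E) mf_ mH'.
- apply/aeW => t _; apply: cvg_near_cst; near=> n.
  rewrite /f_ patchE mem_set//= in_itv/=.
  rewrite -ler_norml; near: n; exact: nbhs_infty_ger.
- exact: integrable_abse.
- apply/aeW => t n _; rewrite /f_ patchE; case: ifP => // _.
  by rewrite abse0.
move=> cvg1.
have cvg2 : (\int[mu]_t f_ n t)%E @[n --> \oo] --> 0%E.
  have [l1 l2] := growing_cvg0 gF.
  have l3 : (H n%:R - H (- n%:R))%:E @[n --> \oo] --> 0%:E.
    apply/cvg_EFin; first exact: nearW.
    rewrite -(subr0 0); apply: cvgB.
      exact: (cvg_comp _ _ (@cvgr_idn R) l1).
    exact: (cvg_comp _ _ (@cvgr_idn R) l2).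
  apply: cvg_trans l3; apply: near_eq_cvg; near=> n.
  rewrite /f_ -integral_mkcond (is_derive_FTC2 _ dH)//.
  rewrite gtrN// ltr0n; near: n; exact: nbhs_infty_gt.
have := cvg_unique _ cvg1 cvg2; exact.
Unshelve. all: by end_near. Qed.

End gaussian_ibp_line.

Section stein_equation.
Context {R : realType}.
Notation mu := (@lebesgue_measure R).
Notation gpdf := (@normal_pdf R 0 1).

Lemma integrable_gpdf (D : set (measurableTypeR R)) : measurable D ->
  mu.-integrable D (fun t => (gpdf t)%:E).
Proof.
by move=> mD; apply: integrableS (integrable_normal_pdf 0 1).
Qed.

(** On [x, +oo[ one has x g(t) <= t g(t) for the density g, and t g(t) has primitive -g(t). This
    Mills ratio bound later controls x f(x) for the Stein solution f. *)
Lemma mills_right (x : R) : 0 < x ->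
  x * \int[mu]_(t in `[x, +oo[) gpdf t <= gpdf x.
Proof.
move=> x0.
have mI : measurable (`[x, +oo[ : set (measurableTypeR R)) by [].
have E : (\int[mu]_(t in `[x, +oo[) (t * gpdf t)%:E = 0%:E - (- gpdf x)%:E)%E.
  apply: (@ge0_continuous_FTC2y _ _ (fun t => - gpdf t)).
  - by move=> t xt; rewrite mulr_ge0// ?(ltW (gpdf_gt0 _))// (le_trans (ltW x0)).
  - apply: continuous_subspaceT => t; apply: cvgM; first exact: cvg_id.
    exact: continuous_gpdf.
  - rewrite -[X in _ --> X]oppr0; apply: cvgN.
    have g1 : growing (fun _ : R => 1) by exists 1, 0%N => t; rewrite normr1 expr0 mulr1.
    have [+ _] := growing_cvg0 g1.
    by under eq_fun do rewrite mul1r.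
  - by move=> t _; have := is_derive_gpdf t => h; apply: ex_derive.
  - apply: cvg_at_right_filter; apply: cvgN; exact: continuous_gpdf.
  - move=> t _; have h := is_derive_gpdf t.
    rewrite derive1E derive_val; ring.
rewrite -lee_fin EFinM /Rintegral fineK; last first.
  exact/integrable_fin_num/integrable_gpdf.
rewrite -ge0_integralZl//; last 3 first.
- apply/measurable_EFinP; apply: measurable_funTS; exact: measurable_normal_pdf.
- by move=> t _; rewrite lee_fin ltW// gpdf_gt0.
- by rewrite lee_fin ltW.
have -> : (gpdf x)%:E = (0%:E - (- gpdf x)%:E)%E by rewrite -EFinB sub0r opprK.
rewrite -E; apply: ge0_le_integral => //.
- by move=> t _; rewrite -EFinM lee_fin mulr_ge0// ltW// gpdf_gt0.
- apply/measurable_EFinP; apply: measurable_funTS.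
  by apply: measurable_funM => //; exact: measurable_normal_pdf.
- apply/measurable_EFinP; apply: measurable_funTS.
  by apply: measurable_funM => //; exact: measurable_normal_pdf.
- move=> t; rewrite /= in_itv/= andbT => xt.
  by rewrite -EFinM lee_fin ler_wpM2r// ltW// gpdf_gt0.
Qed.

Lemma gpdfN (t : R) : gpdf (- t) = gpdf t.
Proof. by rewrite !gpdfE sqrrN. Qed.

Lemma mills_left (x : R) : x < 0 ->
  - x * \int[mu]_(t in `]-oo, x]) gpdf t <= gpdf x.
Proof.
move=> x0; rewrite -(gpdfN x); have x0' : 0 < - x by rewrite oppr_gt0.
apply: le_trans (mills_right x0'); rewrite ler_pM2l// le_eqVlt; apply/orP; left.
apply/eqP; congr fine.
have := @ge0_integration_by_substitutionNy R gpdf (- x); rewrite opprK => ->.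
- by apply: eq_integral => t _; rewrite /= gpdfN.
- by apply: continuous_subspaceT; exact: continuous_gpdf.
- by move=> t _; rewrite ltW// gpdf_gt0.
Qed.

(** The solution f(x) is the integral of (h - m) g up to x, divided by g(x), with g the density and
    m the Gaussian mean of h. The Mills bounds give |x f(x)| <= 1, hence |f'| <= 1 + 1 from the
    equation itself. The bound 2 is uniform in h, whereas C may depend on h: it serves
    integrability. *)
Lemma stein_solution (h : R -> R) : continuous h -> (forall x, 0 <= h x <= 1) ->
  exists f f' : R -> R,
  [/\ forall x : R, is_derive x (1 : R) f (f' x), continuous f',
      exists C : R, forall x, `|f x| <= C, forall x, `|f' x| <= 2 &
      forall x, f' x - x * f x = h x - \int[mu]_t (h t * gpdf t)].
Proof.
move=> ch h01; set m := \int[mu]_t _.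
have ig1 := @integrable_gpdf setT measurableT.
have mh : measurable_fun setT h by exact: continuous_measurable_fun.
have ihg : mu.-integrable setT (fun t => (h t * gpdf t)%:E).
  apply: integrable_growing => //; exists 1, 0%N => t.
  by rewrite expr0 mulr1; have /andP[? ?] := h01 t; rewrite ger0_norm.
have gpdf1 : \int[mu]_t gpdf t = 1.
  by rewrite /Rintegral integral_normal_pdf.
have m01 : 0 <= m <= 1.
  apply/andP; split.
    apply: Rintegral_ge0 => t _; apply: mulr_ge0; first by case/andP: (h01 t).
    by rewrite ltW// gpdf_gt0.
  rewrite -gpdf1; apply: le_Rintegral => // t _.
  by rewrite ler_piMl ?(ltW (gpdf_gt0 _))//; case/andP: (h01 t).
pose q (t : R) := (h t - m) * gpdf t.
have q_le t : `|q t| <= gpdf t.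
  rewrite normrM (ger0_norm (ltW (gpdf_gt0 t))) ler_piMl ?(ltW (gpdf_gt0 _))//.
  have /andP[? ?] := h01 t; have /andP[? ?] := m01.
  by rewrite ler_norml; lra.
have cq : continuous q.
  move=> t; apply: cvgM; last exact: continuous_gpdf.
  by apply: cvgB; [exact: ch|exact: cvg_cst].
have mq : measurable_fun setT q by exact: continuous_measurable_fun.
have iqT : mu.-integrable setT (EFin \o q).
  apply: le_integrable ig1 => //; first exact/measurable_EFinP.
  by move=> t _ /=; rewrite lee_fin (ger0_norm (ltW (gpdf_gt0 t))).
have iq (D : set (measurableTypeR R)) : measurable D -> mu.-integrable D (EFin \o q).
  by move=> mD; apply: integrableS iqT.
pose I (x : R) := \int[mu]_(t in `]-oo, x]) q t.
have dI (x : R) : is_derive x (1 : R) I (q x).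
  have x1 : x < x + 1 by rewrite ltrDl.
  have [] := @continuous_FTC1 _ q -oo%O x (x + 1) x1 (iq _ _).
  - by [].
  - by rewrite ltNyr.
  - exact: cq.
  move=> dx <-; rewrite derive1E; exact: DeriveDef.
have I0 : \int[mu]_t q t = 0.
  rewrite (_ : q = fun t => h t * gpdf t - m * gpdf t); last first.
    by apply/funext => t; rewrite /q mulrBl.
  rewrite RintegralB//=; last first.
    by rewrite (_ : EFin \o _ = (fun t => m%:E * (gpdf t)%:E)%E)//; exact: integrableZl.
  rewrite RintegralZl//; first by rewrite gpdf1 mulr1 subrr.
(* As (h - m) g has total mass 0, the left integral is minus the right one, so the Mills bound on
   the side of x applies. *)
have I2 x : I x = - \int[mu]_(t in `[x, +oo[) q t.
  apply/eqP; rewrite -addr_eq0 -Rintegral_itv_obnd_cbnd; last exact: iq.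
  rewrite -(@Rintegral_itvB _ q -oo%O +oo%O x)//; last first.
    by rewrite set_itvE; exact: iq.
  rewrite set_itvE I0 sub0r; apply/eqP; rewrite -/(I x); ring.
have absI (D : set (measurableTypeR R)) : measurable D ->
    `|\int[mu]_(t in D) q t| <= \int[mu]_(t in D) gpdf t.
  move=> mD; apply: le_trans (le_normr_Rintegral _ _) _ => //; first exact: iq.
  apply: le_Rintegral => //.
  - by move/integrable_abse : (iq D mD).
  - exact: integrable_gpdf.
have xI (x : R) : `|x * I x| <= gpdf x.
  have [x0|x0|->] := ltgtP x 0.
  - apply: le_trans (mills_left x0); rewrite normrM ltr0_norm//.
    by rewrite ler_wpM2l ?oppr_ge0 ?(ltW x0)//; exact: absI.
  - apply: le_trans (mills_right x0); rewrite normrM gtr0_norm//.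
    by rewrite I2 normrN ler_wpM2l ?(ltW x0)//; exact: absI.
  - by rewrite mul0r normr0 ltW// gpdf_gt0.
pose f (x : R) := I x / gpdf x.
pose f' (x : R) := x * f x + (h x - m).
have xf (x : R) : `|x * f x| <= 1.
  rewrite /f mulrA normrM normfV (ger0_norm (ltW (gpdf_gt0 x))).
  by rewrite ler_pdivrMr ?gpdf_gt0// mul1r.
have df (x : R) : is_derive x (1 : R) f (f' x).
  have g0 : gpdf x != 0 by rewrite gt_eqF// gpdf_gt0.
  have h1 := dI x; have h2 := is_derive_gpdf x.
  have h3 : is_derive x (1 : R) (fun y => (gpdf y)^-1) (- (gpdf x) ^- 2 *: (- x * gpdf x)).
    exact: is_deriveV.
  rewrite /f; apply: is_derive_eq; rewrite /f' /f /q /GRing.scale/=; field.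
  exact: g0.
have cf : continuous f by exact: is_derive_continuous df.
exists f, f'; split => //.
- move=> x; apply: cvgD; first by apply: cvgM; [exact: cvg_id|exact: cf].
  by apply: cvgB; [exact: ch|exact: cvg_cst].
(* On [-1, 1] compactness bounds f; for |x| > 1, |f(x)| <= |x f(x)| <= 1. *)
- have [C HC] : exists C, forall x, x \in `[-1, 1]%R -> `|f x| <= C.
    have [||c _ hc] := @EVT_max _ (fun x => `|f x|) (-1) 1.
    - lra.
    - by apply: continuous_subspaceT => x; apply: cvg_norm; exact: cf.
    - by exists `|f c|.
  exists (`|C| + 1) => x; have [x1|x1] := leP `|x| 1.
    apply: (@le_trans _ _ C); last by rewrite (le_trans (ler_norm _))// lerDl.
    by apply: HC; rewrite in_itv/= -ler_norml.
  apply: (@le_trans _ _ 1); last by rewrite lerDr.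
  by apply: le_trans (xf x); rewrite [leRHS]normrM ler_peMl// (ltW x1).
- move=> x; rewrite /f'; apply: le_trans (ler_normD _ _) _.
  have := xf x; have : `|h x - m| <= 1.
    have /andP[? ?] := h01 x; have /andP[? ?] := m01.
    by rewrite ler_norml; lra.
  lra.
- move=> x; rewrite /f'; ring.
Qed.

End stein_equation.

(** * Total variation distance to the normal law through continuous test functions *)

Section unit_valued.
Context {R : realType}.

Definition unit_fun (f : R -> R) :=
  measurable_fun setT f /\ forall x, 0 <= f x <= 1.

Lemma unit_indic (B : set R) : measurable B -> unit_fun \1_B.
Proof.
move=> mB; split; first exact: measurable_indic.
by move=> x; rewrite indicE; case: (_ \in _); rewrite /= ?lexx ler01.
Qed.

Lemma unit_continuous (h : R -> R) : continuous h -> (forall x, 0 <= h x <= 1) ->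
  unit_fun h.
Proof. by move=> ch h01; split => //; exact: continuous_measurable_fun. Qed.

Lemma unitC (f : R -> R) : unit_fun f -> unit_fun (fun x => 1 - f x).
Proof.
move=> [mf f01]; split; first exact: measurable_funB.
by move=> x; have /andP[? ?] := f01 x; apply/andP; split; lra.
Qed.

Lemma unitM (f g : R -> R) : unit_fun f -> unit_fun g ->
  unit_fun (fun x => f x * g x).
Proof.
move=> [mf f01] [mg g01]; split; first exact: measurable_funM.
move=> x; have /andP[? ?] := f01 x; have /andP[? ?] := g01 x.
by rewrite mulr_ge0//= mulr_ile1.
Qed.

Lemma unit_dist (f g : R -> R) x : unit_fun f -> unit_fun g ->
  `|f x - g x| <= 1.
Proof.
move=> [_ f01] [_ g01]; have /andP[? ?] := f01 x; have /andP[? ?] := g01 x.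
by rewrite ler_norml; apply/andP; split; lra.
Qed.

Section distance.
Context d (S : measurableType d) (m : {finite_measure set S -> \bar R}).
Context (Y : S -> R) (mY : measurable_fun setT Y).

Definition l1dist (f g : R -> R) := \int[m]_s `|f (Y s) - g (Y s)|.

Let fin : (m setT < +oo)%E.
Proof. by rewrite -ge0_fin_numE// fin_num_measure. Qed.

Lemma unit_integrable (f : R -> R) : unit_fun f ->
  m.-integrable setT (EFin \o (f \o Y)).
Proof.
move=> [mf f01]; apply: measurable_bounded_integrable => //.
  exact: measurableT_comp.
exists 1; split => // x x1 s _ /=; have /andP[f0 f1] := f01 (Y s).
by rewrite ger0_norm// (le_trans f1)// ltW.
Qed.

Lemma l1dist_integrable (f g : R -> R) : unit_fun f -> unit_fun g ->
  m.-integrable setT (EFin \o (fun s => `|f (Y s) - g (Y s)|)).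
Proof.
move=> uf ug; have := integrableB measurableT (unit_integrable uf) (unit_integrable ug).
by move/integrable_abse.
Qed.

Lemma l1dist_trans (g f h : R -> R) : unit_fun f -> unit_fun g -> unit_fun h ->
  l1dist f h <= l1dist f g + l1dist g h.
Proof.
move=> uf ug uh; rewrite /l1dist -RintegralD//; try exact: l1dist_integrable.
apply: le_Rintegral => //; first exact: l1dist_integrable.
  rewrite (_ : _ \o _ = (fun s => `|f (Y s) - g (Y s)|%:E + `|g (Y s) - h (Y s)|%:E)%E)//.
  by apply: integrableD => //; exact: l1dist_integrable.
by move=> s _; exact: ler_distD.
Qed.

Lemma l1dist_refl (f : R -> R) : l1dist f f = 0.
Proof.
rewrite /l1dist; under eq_Rintegral do rewrite subrr normr0.
by rewrite Rintegral_cst// mul0r.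
Qed.

Lemma l1distC (f g : R -> R) : l1dist (fun x => 1 - f x) (fun x => 1 - g x) = l1dist f g.
Proof.
apply: eq_Rintegral => s _; rewrite -normrN; congr (`|_|); ring.
Qed.

Lemma l1distM (f g h k : R -> R) :
  unit_fun f -> unit_fun g -> unit_fun h -> unit_fun k ->
  l1dist (fun x => f x * g x) (fun x => h x * k x) <= l1dist f h + l1dist g k.
Proof.
move=> uf ug uh uk; rewrite /l1dist -RintegralD//; try exact: l1dist_integrable.
apply: le_Rintegral => //.
  exact: (l1dist_integrable (unitM uf ug) (unitM uh uk)).
  rewrite (_ : _ \o _ = (fun s => `|f (Y s) - h (Y s)|%:E + `|g (Y s) - k (Y s)|%:E)%E)//.
  by apply: integrableD => //; exact: l1dist_integrable.
move=> s _; move: uf ug uh uk => [_ uf] [_ ug] [_ uh] [_ uk].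
have /andP[? ?] := ug (Y s); have /andP[? ?] := uh (Y s).
rewrite (_ : _ - _ = (f (Y s) - h (Y s)) * g (Y s) + h (Y s) * (g (Y s) - k (Y s))); last ring.
apply: le_trans (ler_normD _ _) _; rewrite !normrM lerD//.
  by rewrite ler_piMr// ger0_norm.
by rewrite ler_piMl// ger0_norm.
Qed.

Lemma l1dist_cvg (f : R -> R) (g : nat -> R -> R) :
  unit_fun f -> (forall n, unit_fun (g n)) ->
  (forall x, \forall n \near \oo, g n x = f x) -> l1dist f (g n) @[n --> \oo] --> 0.
Proof.
move=> uf ug gf; rewrite /l1dist /Rintegral; apply: fine_cvg.
have i1 : m.-integrable setT (cst 1%:E).
  by apply/finite_measure_integrable_cst.
have [|||||_ _] := @dominated_convergence _ _ _ m _ measurableT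
   (fun n s => `|f (Y s) - g n (Y s)|%:E) (cst 0%:E) (cst 1%:E).
- by move=> n; have /integrableP[] := l1dist_integrable uf (ug n).
- exact: measurable_cst.
- apply/aeW => s _; apply: cvg_near_cst; have := gf (Y s); apply: filterS.
  by move=> n /= ->; rewrite subrr normr0.
- exact: i1.
- by apply/aeW => s n _ /=; rewrite lee_fin normr_id unit_dist.
by rewrite integral0.
Qed.

Lemma l1dist_lip (f g : R -> R) : unit_fun f -> unit_fun g ->
  `|\int[m]_s f (Y s) - \int[m]_s g (Y s)| <= l1dist f g.
Proof.
move=> uf ug; rewrite -RintegralB//; try exact: unit_integrable.
apply: le_normr_Rintegral => //.
exact: (integrableB measurableT (unit_integrable uf) (unit_integrable ug)).
Qed.

Lemma measure_preimageE (B : set R) : measurable B ->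
  m (Y @^-1` B) = (\int[m]_s \1_B (Y s))%:E.
Proof.
move=> mB; rewrite /Rintegral fineK; last first.
  exact/integrable_fin_num/(unit_integrable (unit_indic mB)).
rewrite -[RHS]/(\int[m]_s (\1_(Y @^-1` B) s)%:E)%E integral_indic// ?setIT//.
by rewrite -[_ @^-1` _]setTI; exact: mY.
Qed.

End distance.

Section approximation.
Context d (S : measurableType d) (m : {finite_measure set S -> \bar R}).
Context (Y : S -> R) (mY : measurable_fun setT Y).
Context d' (S' : measurableType d') (m' : {finite_measure set S' -> \bar R}).
Context (Y' : S' -> R) (mY' : measurable_fun setT Y').

(* Total variation compares the two laws on Borel sets, whereas the Stein solution
   needs a continuous test function, so one [h] has to be close to an indicator
   under both laws. *)
Definition approximable (f : R -> R) := unit_fun f /\ forall e : R, 0 < e ->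
  exists h : R -> R, [/\ continuous h, forall x, 0 <= h x <= 1,
    l1dist m Y f h <= e & l1dist m' Y' f h <= e].

Lemma approximableC (f : R -> R) : approximable f -> approximable (fun x => 1 - f x).
Proof.
move=> [uf af]; split; first exact: unitC.
move=> e /af[h [ch h01 h1 h2]]; exists (fun x => 1 - h x).
split; [|by move=> x; have /andP[? ?] := h01 x; apply/andP; split; lra| |].
- by move=> x; apply: cvgB; [exact: cvg_cst|exact: ch].
- by rewrite l1distC.
- by rewrite l1distC.
Qed.

Lemma approximableM (f g : R -> R) : approximable f -> approximable g ->
  approximable (fun x => f x * g x).
Proof.
move=> [uf af] [ug ag]; split; first exact: unitM.
move=> e e0; have e2 : 0 < e / 2 by rewrite divr_gt0.
have [h [ch h01 h1 h2]] := af _ e2; have [k [ck k01 k1 k2]] := ag _ e2.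
have uh := unit_continuous ch h01; have uk := unit_continuous ck k01.
exists (fun x => h x * k x); split.
- by move=> x; apply: cvgM; [exact: ch|exact: ck].
- by have [] := unitM uh uk.
- by apply: le_trans (l1distM _ _ _ _ _ _) _ => //; lra.
- by apply: le_trans (l1distM _ _ _ _ _ _) _ => //; lra.
Qed.

Lemma approximable_lim (f : R -> R) (g : nat -> R -> R) :
  unit_fun f -> (forall n, approximable (g n)) ->
  (forall x, \forall n \near \oo, g n x = f x) -> approximable f.
Proof.
move=> uf ag gf; split=> // e e0; have e2 : 0 < e / 2 by rewrite divr_gt0.
have ug n : unit_fun (g n) by case: (ag n).
have /cvgrPdist_le/(_ _ e2) c1 := l1dist_cvg m mY uf ug gf.
have /cvgrPdist_le/(_ _ e2) c2 := l1dist_cvg m' mY' uf ug gf.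
have [n [n1 n2]] : exists n, `|0 - l1dist m Y f (g n)| <= e / 2 /\
    `|0 - l1dist m' Y' f (g n)| <= e / 2.
  by apply: (@filter_ex _ \oo); near=> n; split; near: n.
rewrite !sub0r !normrN in n1 n2.
have {}n1 := le_trans (ler_norm _) n1; have {}n2 := le_trans (ler_norm _) n2.
have [_ /(_ _ e2)[h [ch h01 h1 h2]]] := ag n; have uh := unit_continuous ch h01.
exists h; split => //.
- by apply: le_trans (l1dist_trans _ mY uf (ug n) uh) _; lra.
- by apply: le_trans (l1dist_trans _ mY' uf (ug n) uh) _; lra.
Unshelve. all: by end_near. Qed.

(** The indicator of an open ray is the pointwise limit of continuous ramps of slope n starting at
    a. *)
Lemma approximable_ray (a : R) : approximable \1_(`]a, +oo[%classic).
Proof.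
pose h (n : nat) (x : R) := Num.min 1 (Num.max 0 (n%:R * (x - a))).
have ch n : continuous (h n).
  move=> x; apply: (@continuous_min R R (fun=> 1) (fun x => Num.max 0 (n%:R * (x - a)))).
    exact: cvg_cst.
  apply: (@continuous_max R R (fun=> 0) (fun x => n%:R * (x - a))); first exact: cvg_cst.
  apply: cvgM; first exact: cvg_cst.
  by apply: cvgB; [exact: cvg_id|exact: cvg_cst].
have h01 n x : 0 <= h n x <= 1.
  by rewrite /h le_min ler01 le_max lexx/= ge_min lexx.
apply: (@approximable_lim _ h); first exact: unit_indic.
  move=> n; split; first exact: unit_continuous.
  move=> e e0; exists (h n); split => //.
  - by rewrite l1dist_refl ltW.
  - by rewrite l1dist_refl ltW.
move=> x; rewrite indicE; have [xa|ax] := leP x a.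
  apply: nearW => n; rewrite memNset/=; last by rewrite in_itv/= andbT; apply/negP; rewrite -leNgt.
  rewrite /h max_l ?min_r//; apply: mulr_ge0_le0 => //; lra.
near=> n; rewrite mem_set/=; last by rewrite in_itv/= andbT.
have : (x - a)^-1 <= n%:R by near: n; exact: nbhs_infty_ger.
rewrite -[(x - a)^-1]mul1r ler_pdivrMr ?subr_gt0// => nx.
rewrite /h max_r ?min_l//; exact: le_trans nx.
Unshelve. all: by end_near. Qed.

(** The sets with approximable indicator form a sigma-algebra containing the open rays: complements
    use 1 - f, finite unions 1 - (1 - f) (1 - g), countable unions dominated convergence. *)
Lemma approximable_measurable (B : set R) : measurable B -> approximable \1_B.
Proof.
pose K : set (set R) := [set B : set R | measurable B /\ approximable \1_B].
suff KB : (@measurable _ R) `<=` K by move=> /KB[].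
rewrite (RGenOInfty.measurableE R : (@measurable _ R) = _); apply: smallest_sub; last first.
  by move=> _ [a ->]; split=> //; exact: approximable_ray.
have K0 : approximable \1_(set0 : set R).
  have := approximableM (approximable_ray 0) (approximableC (approximable_ray 0)).
  congr approximable; apply/funext => x; rewrite !indicE in_set0.
  by case: (_ \in _); rewrite /= ?subrr ?mulr0 ?mul0r.
split.
- by split.
- move=> A [mA aA]; split; first by rewrite setTD; exact: measurableC.
  have := approximableC aA; congr approximable; apply/funext => x.
  by rewrite !indicE setTD in_setC; case: (_ \in _); rewrite /= ?subrr ?subr0.
move=> A KA; have mA n : measurable (A n) by case: (KA n).
split; first exact: bigcupT_measurable.
pose U n := \big[setU/set0]_(i < n) A i.
have aU n : approximable \1_(U n).
  elim: n => [|n IH]; first by rewrite /U big_ord0.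
  have [_ aA] := KA n.
  have := approximableC (approximableM (approximableC IH) (approximableC aA)).
  congr approximable; apply/funext => x; rewrite /U big_ord_recr/= !indicE in_setU.
  by case: (_ \in _); case: (_ \in _);
    rewrite /= ?subrr ?subr0 ?mulr0 ?mul0r ?mulr1 ?subrr ?subr0.
apply: (@approximable_lim _ (fun n => \1_(U n))) => //.
  by apply: unit_indic; exact: bigcupT_measurable.
move=> x; rewrite indicE; have [[i _ Aix]|nA] := pselect ((\bigcup_k A k) x).
  near=> n; rewrite indicE !mem_set//; first by exists i.
  rewrite /U -bigcup_mkord; exists i => //=.
  by near: n; exact: nbhs_infty_gt.
apply: nearW => n; rewrite indicE !memNset// => Ux; apply: nA.
by move: Ux; rewrite /U -bigcup_mkord => -[i _ Aix]; exists i.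
Unshelve. all: by end_near. Qed.

End approximation.
End unit_valued.

Section normal_law.
Context {R : realType}.
Notation mu := (@lebesgue_measure R).
Notation gpdf := (@normal_pdf R 0 1).

(** The Radon-Nikodym derivative of [normal_prob] and the normal density have the same integral over
    every measurable set, so they agree almost everywhere. *)
Lemma ge0_integral_normal_prob (f : R -> \bar R) : measurable_fun setT f ->
  (forall x, 0 <= f x)%E ->
  (\int[normal_prob 0 1]_t f t = \int[mu]_t (f t * (gpdf t)%:E))%E.
Proof.
move=> mf f0; have dom := normal_prob_dominates (0 : R) 1.
rewrite -(Radon_Nikodym_SigmaFinite.change_of_variables dom)//.
apply: ae_eq_integral => //.
- apply: emeasurable_funM => //.
  exact: measurable_int (Radon_Nikodym_SigmaFinite.f_integrable dom).
- apply: emeasurable_funM => //; apply/measurable_EFinP.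
  exact: measurable_normal_pdf.
- apply: ae_eqe_mul2l; apply: integral_ae_eq => //.
  + exact: Radon_Nikodym_SigmaFinite.f_integrable.
  + by apply/measurable_EFinP; exact: measurable_normal_pdf.
  + by move=> E E01 mE; rewrite -Radon_Nikodym_SigmaFinite.f_integral.
Qed.

(** Positive and negative parts extend the density formula to signed functions. The source space is
    arbitrary because the formula serves both [normal_prob] itself and the law of an input
    variable. *)
Lemma integral_normal_density d (S : measurableType d) (m : {measure set S -> \bar R})
    (Y : S -> R) : measurable_fun setT Y ->
  (forall f : R -> \bar R, measurable_fun setT f -> (forall x, 0 <= f x)%E ->
     \int[m]_s f (Y s) = \int[mu]_t (f t * (gpdf t)%:E))%E ->
  forall f : R -> R, measurable_fun setT f ->
    (\int[m]_s (f (Y s))%:E = \int[mu]_t (f t * gpdf t)%:E)%E.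
Proof.
move=> mY mE f mf; have mEf : measurable_fun setT (EFin \o f) by exact/measurable_EFinP.
rewrite [LHS]integralE [RHS]integralE; congr (_ - _)%E.
  transitivity (\int[m]_s ((EFin \o f)^\+ (Y s)))%E.
    by apply: eq_integral => s _; rewrite !funeposE.
  rewrite mE//; last exact: measurable_funepos.
  apply: eq_integral => t _; rewrite !funeposE -!EFin_max -EFinM; congr EFin.
  rewrite maxr_pMl ?mul0r//; exact/ltW/gpdf_gt0.
transitivity (\int[m]_s ((EFin \o f)^\- (Y s)))%E.
  by apply: eq_integral => s _; rewrite !funenegE.
rewrite mE//; last exact: measurable_funeneg.
apply: eq_integral => t _; rewrite !funenegE -!EFin_max -EFinM; congr EFin.
rewrite maxr_pMl ?mul0r ?mulNr//; exact/ltW/gpdf_gt0.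
Qed.

Lemma integral_normal_prob (f : R -> R) : measurable_fun setT f ->
  (\int[normal_prob 0 1]_t (f t)%:E = \int[mu]_t (f t * gpdf t)%:E)%E.
Proof.
move: f; apply: (@integral_normal_density _ _ (normal_prob 0 1) id) => // f mf f0.
exact: ge0_integral_normal_prob.
Qed.

Lemma total_variation_distance_le d (T : measurableType d) (P : probability T R)
    (Y : {RV P >-> R}) (b : R) :
  (forall h : R -> R, continuous h -> (forall x, 0 <= h x <= 1) ->
     `|\int[P]_w h (Y w) - \int[mu]_t (h t * gpdf t)| <= b) ->
  (total_variation_distance (distribution P Y) (normal_prob 0 1) <= b%:E)%E.
Proof.
move=> Hh; apply: ge_ereal_sup => _ [B mB <-].
have mY : measurable_fun setT Y by exact: measurable_funPT.
have mid : measurable_fun setT (@id R) by exact: measurable_id.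
have [ub aB] := approximable_measurable P mY (normal_prob (0:R) 1) mid mB.
have E1 : (distribution P Y B = (\int[P]_w \1_B (Y w))%:E)%E.
  exact: (measure_preimageE P mY mB).
have E2 : (normal_prob 0 1 B = (\int[normal_prob 0 1]_w \1_B w)%:E)%E.
  exact: (measure_preimageE (normal_prob (0:R) 1) mid mB).
rewrite E1 E2 -EFinB/= lee_fin; apply/ler_addgt0Pl => e e0.
have e2 : 0 < e / 2 by rewrite divr_gt0.
have [h [ch h01 h1 h2]] := aB _ e2; have uh := unit_continuous ch h01.
have l1 := l1dist_lip P mY ub uh.
have l2 := l1dist_lip (normal_prob (0:R) 1) mid ub uh.
have := Hh h ch h01; have -> : \int[mu]_t (h t * gpdf t) = \int[normal_prob 0 1]_w h w.
  by rewrite /Rintegral integral_normal_prob//; case: uh.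
move: l1 l2 h1 h2; set x1 := Rintegral _ _ _; set x2 := Rintegral _ _ _.
set x3 := Rintegral _ _ _; set x4 := Rintegral _ _ _ => l1 l2 h1 h2 h3.
move: (l1dist _ _ _ _) (l1dist _ _ _ _) l1 l2 h1 h2 h3.
clearbody x1 x2 x3 x4; clear => y z l1 l2 h1 h2 h3.
rewrite (_ : x1 - x3 = (x1 - x2) + (x2 - x4) - (x3 - x4)); last ring.
apply: le_trans (ler_normB _ _) _.
have := ler_normD (x1 - x2) (x2 - x4); lra.
Qed.

End normal_law.

(** * Polynomials in independent Gaussian variables *)

Section independence.
Context (R : realType) d (T : measurableType d) (P : probability T R)
  (X : nat -> {RV P >-> R}).
Hypothesis indepX : mutually_independent P X.

(** A pi-system of events that ignore coordinate j, with finitely many factors as in the definition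
    of independence. *)
Definition cylinder_except (j : nat) : set (set T) :=
  [set A | exists (N : nat) (B : nat -> set R), (forall i, measurable (B i)) /\
    A = \bigcap_(i in [set i | (i < N)%N && (i != j)]) X i @^-1` B i].

Lemma measurable_preimageX i (B : set R) : measurable B -> measurable (X i @^-1` B).
Proof. by move=> mB; rewrite -[_ @^-1` _]setTI; exact: measurable_funPT. Qed.

Lemma measurable_cylinder_except j : cylinder_except j `<=` measurable.
Proof.
move=> _ [N [B [mB ->]]]; apply: bigcap_measurableType.
by move=> i _; exact: measurable_preimageX.
Qed.

Lemma cylinder_exceptI j : setI_closed (cylinder_except j).
Proof.
move=> _ _ [N [B [mB ->]]] [M [C [mC ->]]].
pose trunc n (D : nat -> set R) i := if (i < n)%N then D i else setT.
exists (maxn N M), (fun i => trunc N B i `&` trunc M C i); split.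
  by move=> i; apply: measurableI; rewrite /trunc; case: ifP.
apply/seteqP; split=> w /=.
  move=> [wB wC] i /= /andP[iNM ij]; split; rewrite /trunc.
    by case: ifP => // iN; apply: (wB i); rewrite /= iN.
  by case: ifP => // iM; apply: (wC i); rewrite /= iM.
move=> wBC; split=> i /= /andP[iN ij].
  have [] := wBC i; first by rewrite /= leq_max iN ij.
  by rewrite /trunc iN.
have [] := wBC i; first by rewrite /= leq_max iN orbT ij.
by rewrite /trunc iN.
Qed.

Lemma cylinder_exceptT j : cylinder_except j setT.
Proof.
exists 0%N, (fun=> setT); split; first by move=> ?; exact: measurableT.
by rewrite (_ : mkset _ = set0) ?bigcap_set0//; apply/seteqP; split.
Qed.

Lemma indep_cylinder j (B : set R) (A : set T) : measurable B -> cylinder_except j A ->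
  (P (X j @^-1` B `&` A) = P (X j @^-1` B) * P A)%E.
Proof.
move=> mB [N [C [mC ->]]].
pose s := [seq i <- iota 0 N | i != j].
have us : uniq s by rewrite filter_uniq// iota_uniq.
have js : j \notin s by rewrite mem_filter eqxx.
have sE : [set i | (i < N)%N && (i != j)] = [set` s].
  by apply/seteqP; split=> i /=; rewrite mem_filter mem_iota add0n andbC.
pose D i := if i == j then B else C i.
have mD i : measurable (D i) by rewrite /D; case: ifP.
have uj : uniq (j :: s) by rewrite /= js.
have DE (F : nat -> set T) : \bigcap_(i in [set` j :: s]) F i = F j `&` \bigcap_(i in [set` s]) F i.
  apply/seteqP; split=> w /=.
    move=> h; split; first by apply: h; rewrite /= mem_head.
    by move=> i /= si; apply: h; rewrite /= inE si orbT.
  by move=> [h1 h2] i /=; rewrite inE => /orP[/eqP->//|]; exact: h2.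
have CD i : i \in s -> C i = D i.
  by rewrite mem_filter /D => /andP[/negbTE ->].
rewrite sE (_ : \bigcap_(i in [set` s]) _ = \bigcap_(i in [set` s]) X i @^-1` D i); last first.
  by apply: eq_bigcapr => i /= si; rewrite (CD i si).
rewrite (_ : X j @^-1` B = X j @^-1` D j); last by rewrite /D eqxx.
by rewrite -(DE (fun i => X i @^-1` D i)) !indepX// big_cons.
Qed.

(** For fixed B, both sides are finite measures in A that agree on the pi-system of cylinders, hence
    on the sigma-algebra it generates. *)
Lemma indep_sigma j (B : set R) (A : set T) : measurable B ->
  <<s cylinder_except j >> A -> (P (X j @^-1` B `&` A) = P (X j @^-1` B) * P A)%E.
Proof.
move=> mB sA; have mXB := measurable_preimageX j mB.
have r0 : 0 <= fine (P (X j @^-1` B)) by rewrite fine_ge0.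
pose m1 := mrestr P mXB.
pose m2 := mscale (NngNum r0) P.
have PE : (P (X j @^-1` B) = (fine (P (X j @^-1` B)))%:E)%E.
  by rewrite fineK// fin_num_measure.
rewrite [in RHS]PE setIC.
rewrite -[LHS]/(m1 A) -[RHS]/(m2 A).
apply: (g_sigma_algebra_measure_unique (cylinder_except j) _ (fun=> setT)) => //.
- exact: measurable_cylinder_except.
- by move=> _; exact: cylinder_exceptT.
- by rewrite bigcup_const.
- exact: cylinder_exceptI.
- move=> C cC; rewrite -[LHS]/(P (C `&` X j @^-1` B)) setIC (indep_cylinder mB cC).
  by rewrite [in LHS]PE.
- move=> _; rewrite -[X in (X < _)%E]/(P (setT `&` X j @^-1` B)).
  by rewrite setTI -ge0_fin_numE// fin_num_measure.
Qed.

Definition upd (x : nat -> R) (j : nat) (t : R) : nat -> R :=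
  fun i => if i == j then t else x i.

Lemma upd_id x j : upd x j (x j) = x.
Proof. by apply/funext => i; rewrite /upd; case: eqP => // ->. Qed.

(* [T] with the coarser sigma-algebra generated by the [X i], [i != j]. *)
Definition cyl_type j := g_sigma_algebraType (cylinder_except j).

Lemma sub_sigma_cylinder j : <<s cylinder_except j >> `<=` @measurable _ T.
Proof.
apply: smallest_sub; last exact: measurable_cylinder_except.
exact: sigma_algebra_measurable.
Qed.

Lemma measurable_forget j : measurable_fun setT (id : T -> cyl_type j).
Proof. by move=> _ A mA; rewrite setTI; exact: (@sub_sigma_cylinder j). Qed.

Lemma measurable_cylX j i : i != j ->
  measurable_fun (setT : set (cyl_type j)) (X i : cyl_type j -> R).
Proof.
move=> ij _ B mB; rewrite setTI; apply: sub_sigma_algebra.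
exists i.+1, (fun k => if k == i then B else setT); split.
  by move=> k; case: ifP.
apply/seteqP; split=> w /=.
  by move=> wB k _ /=; case: eqP => // ->.
by move=> h; have := h i; rewrite /= ltnSn ij eqxx; exact.
Qed.

Definition forget j : {mfun T >-> cyl_type j} :=
  HB.pack_for {mfun T >-> cyl_type j} (id : T -> cyl_type j)
    (isMeasurableFun.Build _ _ _ _ (id : T -> cyl_type j) (@measurable_forget j)).

(** By independence, the pair formed by [X j] and the identity into the coarser space has a product
    law, so Fubini applies. Keeping T with a smaller sigma-algebra spares an infinite product space:
    w still carries every other coordinate. *)
Lemma integral_resample j (F : R * cyl_type j -> \bar R) : measurable_fun setT F ->
  P.-integrable setT (fun w => F (X j w, w)) ->
  (\int[P]_w F (X j w, w) =
   \int[distribution P (forget j)]_w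
     \int[distribution P (X j)]_t F (t, w))%E.
Proof.
set I := forget j; move=> mF iF.
pose Z0 := (fun w => (X j w, w)) : T -> R * cyl_type j.
have mZ0 : measurable_fun setT Z0.
  by apply: measurable_fun_pair => //; exact: measurable_forget.
pose Z : {mfun T >-> (R * cyl_type j)%type} := HB.pack Z0 (isMeasurableFun.Build _ _ _ _ Z0 mZ0).
have E A : measurable A -> (distribution P (X j) \x distribution P I)%E A = distribution P Z A.
  apply: product_measure_unique => B C mB mC.
  exact: indep_sigma.
have iF' : (distribution P (X j) \x distribution P I)%E.-integrable setT F.
  apply/integrableP; split => //.
  rewrite (eq_measure_integral (distribution P Z)); last by move=> A mA _; exact: E.
  rewrite ge0_integral_distribution//; last exact: measurableT_comp.
  by have /integrableP[] := iF.
rewrite -[RHS]/(\int[distribution P I]_w fubini_G (distribution P (X j)) F w)%E.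
rewrite integral21_prod_meas1// (eq_measure_integral (distribution P Z)); last first.
  by move=> A mA _; exact: E.
by rewrite integral_distribution.
Qed.

End independence.

(** * Functions of polynomial growth of the input sequence *)

Section tame.
Context {R : realType}.

Definition sqnorm (N : nat) (x : nat -> R) : R := 1 + \sum_(i < N) x i ^+ 2.

Lemma sqnorm_ge1 N x : 1 <= sqnorm N x.
Proof. by rewrite lerDl sumr_ge0// => i _; rewrite sqr_ge0. Qed.

Lemma sqnorm_ge0 N x : 0 <= sqnorm N x.
Proof. exact: le_trans (sqnorm_ge1 _ _). Qed.

Lemma sqnormS N x : sqnorm N.+1 x = sqnorm N x + x N ^+ 2.
Proof. by rewrite /sqnorm big_ord_recr/= addrA. Qed.

Lemma sqnorm_le N M K L x : (N <= M)%N -> (K <= L)%N ->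
  sqnorm N x ^+ K <= sqnorm M x ^+ L.
Proof.
move=> NM KL; have NM' : sqnorm N x <= sqnorm M x.
  elim: M NM => [|M IH]; first by rewrite leqn0 => /eqP ->.
  rewrite leq_eqVlt => /predU1P[->//|]; rewrite ltnS => /IH h.
  by apply: le_trans h _; rewrite sqnormS lerDl sqr_ge0.
have p N' : 0 <= sqnorm N' x by exact: le_trans (sqnorm_ge1 N' x).
apply: (@le_trans _ _ (sqnorm N x ^+ L)); first exact: ler_weXn2l (sqnorm_ge1 _ _) _ _ KL.
by rewrite lerXn2r// nnegrE.
Qed.

(** Testing against every family of measurable functions, on every space, avoids a sigma-algebra on
    sequences. The spaces needed are T, the product [R * cyl_type X j], and R for a single resampled
    coordinate. *)
Definition measurable_coord (F : (nat -> R) -> R) :=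
  forall d (S : measurableType d) (Y : nat -> S -> R),
    (forall i, measurable_fun setT (Y i)) ->
    measurable_fun setT (fun s => F (fun i => Y i s)).

Definition poly_growth (F : (nat -> R) -> R) :=
  exists (C : R) (N K : nat), forall x, `|F x| <= C * sqnorm N x ^+ K.

Definition tame F := measurable_coord F /\ poly_growth F.

Lemma tame_cst c : tame (fun=> c).
Proof.
split; first by move=> d S Y _; exact: measurable_cst.
by exists `|c|, 0%N, 0%N => x; rewrite expr0 mulr1.
Qed.

Lemma tame_coord i : tame (fun x => x i).
Proof.
split; first by move=> d S Y mY; exact: mY.
exists 1, i.+1, 1%N => x; rewrite mul1r expr1 sqnormS.
apply: (@le_trans _ _ (1 + x i ^+ 2)); last by rewrite lerD2r sqnorm_ge1.
have <- : `|x i| ^+ 2 = x i ^+ 2 by rewrite real_normK ?num_real.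
set a := `|_|; nra.
Qed.

Lemma growth_const (F : (nat -> R) -> R) C N K :
  (forall x, `|F x| <= C * sqnorm N x ^+ K) -> 0 <= C.
Proof.
move=> /(_ (fun=> 0)); rewrite /sqnorm big1 ?addr0 ?expr1n ?mulr1.
  exact: le_trans.
by move=> i _; rewrite expr0n.
Qed.

Lemma tameD F G : tame F -> tame G -> tame (fun x => F x + G x).
Proof.
move=> [mF [C [N [K FC]]]] [mG [D [M [L GD]]]]; split.
  by move=> d S Y mY; apply: measurable_funD; [exact: mF|exact: mG].
have C0 := growth_const FC; have D0 := growth_const GD.
exists (C + D), (maxn N M), (maxn K L) => x.
apply: le_trans (ler_normD _ _) _; rewrite mulrDl lerD//.
  apply: le_trans (FC x) _; apply: ler_wpM2l => //.
  exact: sqnorm_le (leq_maxl _ _) (leq_maxl _ _).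
apply: le_trans (GD x) _; apply: ler_wpM2l => //.
exact: sqnorm_le (leq_maxr _ _) (leq_maxr _ _).
Qed.

Lemma tameM F G : tame F -> tame G -> tame (fun x => F x * G x).
Proof.
move=> [mF [C [N [K FC]]]] [mG [D [M [L GD]]]]; split.
  by move=> d S Y mY; apply: measurable_funM; [exact: mF|exact: mG].
have C0 := growth_const FC; have D0 := growth_const GD.
exists (C * D), (maxn N M), (K + L)%N => x.
rewrite normrM exprD mulrACA ler_pM//.
  apply: le_trans (FC x) _; apply: ler_wpM2l => //.
  exact: sqnorm_le (leq_maxl _ _) (leqnn _).
apply: le_trans (GD x) _; apply: ler_wpM2l => //.
exact: sqnorm_le (leq_maxr _ _) (leqnn _).
Qed.

Lemma tame_norm F : tame F -> tame (fun x => `|F x|).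
Proof.
move=> [mF [C [N [K FC]]]]; split; last by exists C, N, K => x; rewrite normr_id.
by move=> d S Y mY; apply: measurableT_comp => //; exact: mF.
Qed.

Lemma tame_comp (f : R -> R) F C : measurable_fun setT f ->
  (forall t, `|f t| <= C) -> tame F -> tame (fun x => f (F x)).
Proof.
move=> mf fC [mF _]; split.
  by move=> d S Y mY; apply: measurableT_comp => //; exact: mF.
by exists C, 0%N, 0%N => x; rewrite expr0 mulr1.
Qed.

Lemma tame_sum (I : Type) (r : seq I) (Q : pred I) (F : I -> (nat -> R) -> R) :
  (forall i, tame (F i)) -> tame (fun x => \sum_(i <- r | Q i) F i x).
Proof.
move=> tF; elim: r => [|i r IH].
  by under eq_fun do rewrite big_nil; exact: tame_cst.
under eq_fun do rewrite big_cons.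
by case: (Q i) => //; exact: tameD.
Qed.

Lemma tameX F n : tame F -> tame (fun x => F x ^+ n).
Proof.
move=> tF; elim: n => [|n IH].
  by under eq_fun do rewrite expr0; exact: tame_cst.
by under eq_fun do rewrite exprS; exact: tameM.
Qed.

(** Replacing coordinate j raises the squared norm s by at most t^2, and s + t^2 <= s (1 + t^2)
    since s >= 1. *)
Lemma growing_upd (F : (nat -> R) -> R) x j : poly_growth F ->
  growing (fun t => F (upd x j t)).
Proof.
move=> [C [N [K FC]]]; have C0 := growth_const FC.
exists (C * (sqnorm N x) ^+ K), K => t; apply: le_trans (FC _) _.
rewrite -mulrA; apply: ler_wpM2l => //; rewrite -exprMn lerXn2r ?nnegrE//.
- exact: sqnorm_ge0.
- by apply: mulr_ge0; rewrite ?sqnorm_ge0// addr_ge0// sqr_ge0.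
have h : sqnorm N (upd x j t) <= sqnorm N x + t ^+ 2.
  rewrite /sqnorm -addrA lerD2l; elim: N {FC} => [|N IH].
    by rewrite !big_ord0 add0r sqr_ge0.
  have [jN|jN] := leqP N.+1 j.
    rewrite (eq_bigr (fun i : 'I_N.+1 => x i ^+ 2)) ?lerDl ?sqr_ge0// => i _.
    by rewrite /upd ltn_eqF// (leq_trans (ltn_ord i)).
  rewrite !big_ord_recr/=; move: jN; rewrite ltnS leq_eqVlt => /predU1P[->|jN].
    rewrite {2}/upd eqxx lerD2r (eq_bigr (fun i : 'I_N => x i ^+ 2)) ?lerDl ?sqr_ge0// => i _.
    by rewrite /upd ltn_eqF.
  by rewrite {2}/upd gtn_eqF// addrAC lerD2r.
apply: le_trans h _; have := sqnorm_ge1 N x; have := sqr_ge0 t; nra.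
Qed.

End tame.

(** * Expectation and integration by parts for the Gaussian input *)

Section gaussian_vector.
Context (R : realType) d (T : measurableType d) (P : probability T R)
  (X : nat -> {RV P >-> R}).
Hypothesis gaussX : gaussian_input P X.
Notation mu := (@lebesgue_measure R).
Notation gpdf := (@normal_pdf R 0 1).

Let indepX : mutually_independent P X. Proof. by case: gaussX. Qed.

Definition Xs (w : T) : nat -> R := fun i => X i w.

Lemma measurable_tame F : measurable_coord F -> measurable_fun setT (fun w => F (Xs w)).
Proof. by move=> mF; apply: mF => i; exact: measurable_funPT. Qed.

Lemma integral_law j (f : R -> R) : measurable_fun setT f ->
  (\int[distribution P (X j)]_t (f t)%:E = \int[mu]_t (f t * gpdf t)%:E)%E.
Proof.
move: f; apply: (@integral_normal_density _ _ _ (distribution P (X j)) id) => // f mf f0.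
rewrite -ge0_integral_normal_prob//.
have mid : measurable_fun (setT : set (measurableTypeR R)) (id : measurableTypeR R -> R).
  exact: measurable_id.
pose I := HB.pack_for {mfun measurableTypeR R >-> R} (id : measurableTypeR R -> R)
  (isMeasurableFun.Build _ _ _ _ (id : measurableTypeR R -> R) mid).
transitivity (\int[distribution (normal_prob 0 1) I]_t f t)%E.
  apply: eq_measure_integral => A mA _; have [_ E] := gaussX.
  exact: (E j A mA).
by rewrite ge0_integral_distribution.
Qed.

Lemma integrable_coord j (f : R -> R) : measurable_fun setT f -> growing f ->
  P.-integrable setT (fun w => (f (X j w))%:E).
Proof.
move=> mf gf; apply/integrableP; split.
  by apply/measurable_EFinP; apply: measurableT_comp => //; exact: measurable_funPT.
rewrite -(@ge0_integral_distribution _ _ _ _ _ P (X j) (fun t => `|(f t)%:E|%E))//; last first.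
  by apply: measurableT_comp => //; exact/measurable_EFinP.
rewrite (integral_law j (f := fun t => `|f t|)); last exact: measurableT_comp.
have : growing (fun t => `|f t|).
  by apply: growing_le gf _ => t; rewrite normr_id.
move/(integrable_growing (measurableT_comp (@normr_measurable _ _) mf)) => /integrableP[_].
apply: le_lt_trans; rewrite le_eqVlt; apply/orP; left; apply/eqP.
apply: eq_integral => t _ /=; rewrite normrM normr_id (@ger0_norm _ (gpdf t))//.
by rewrite ltW// gpdf_gt0.
Qed.

(** The inequality (a + b)^K <= 2^K (a^K + b^K) peels off one coordinate at a time, so that only the
    marginal laws enter. *)
Lemma integrable_sqnorm N K : P.-integrable setT (fun w => (sqnorm N (Xs w) ^+ K)%:E).
Proof.
have mS N' K' : measurable_fun setT (fun w => sqnorm N' (Xs w) ^+ K').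
  apply: measurable_funX; apply: measurable_funD => //.
  by apply: measurable_sum => i; apply: measurable_funX; exact: measurable_funPT.
elim: N => [|N IH].
  rewrite (_ : (fun _ => _) = cst 1%E); first exact: finite_measure_integrable_cst.
  by apply/funext => w; rewrite /sqnorm big_ord0 addr0 expr1n.
have gK : growing (fun t : R => (t ^+ 2) ^+ K).
  exists 1, K => t; rewrite mul1r; have := sqr_ge0 t; move: (t ^+ 2) => s s0.
  by rewrite ger0_norm ?exprn_ge0// lerXn2r ?nnegrE ?addr_ge0// lerDr.
have mK : measurable_fun setT (fun t : R => (t ^+ 2) ^+ K).
  by apply: measurable_funX; exact: measurable_funX.
apply: (@le_integrable _ _ _ P _ measurableT _
  (fun w => (2 ^+ K)%:E * ((sqnorm N (Xs w) ^+ K)%:E + ((X N w ^+ 2) ^+ K)%:E))%E).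
- exact/measurable_EFinP.
- move=> w _; rewrite -EFinD -EFinM !abse_EFin lee_fin.
  rewrite sqnormS (_ : Xs w N = X N w)//.
  have := sqnorm_ge0 N (Xs w); have := sqr_ge0 (X N w).
  move: (sqnorm _ _) (X N w ^+ 2) => a b b0 a0.
  rewrite !ger0_norm ?exprn_ge0 ?mulr_ge0 ?addr_ge0 ?exprn_ge0//.
  wlog ab : a b a0 b0 / a <= b.
    move=> H; have [/H|/ltW/H] := leP a b; first exact.
    by rewrite (addrC b) (addrC (b ^+ K)); exact.
  apply: (@le_trans _ _ ((2 * b) ^+ K)).
    rewrite lerXn2r ?nnegrE ?addr_ge0 ?mulr_ge0//; lra.
  by rewrite exprMn ler_wpM2l ?exprn_ge0// lerDr exprn_ge0.
- apply: integrableZl => //; apply: integrableD => //.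
  exact: (integrable_coord N mK gK).
Qed.

Lemma integrable_tame F : tame F -> P.-integrable setT (fun w => (F (Xs w))%:E).
Proof.
move=> [mF [C [N [K FC]]]].
apply: (@le_integrable _ _ _ P _ measurableT _
  (fun w => C%:E * (sqnorm N (Xs w) ^+ K)%:E)%E).
- by apply/measurable_EFinP; exact: measurable_tame.
- move=> w _; rewrite -EFinM !abse_EFin lee_fin; apply: le_trans (FC _) _.
  exact: ler_norm.
- by apply: integrableZl => //; exact: integrable_sqnorm.
Qed.

Definition Ex (F : (nat -> R) -> R) : R := \int[P]_w F (Xs w).

Lemma eq_Ex F G : (forall x, F x = G x) -> Ex F = Ex G.
Proof. by move=> FG; apply: eq_Rintegral => w _; exact: FG. Qed.

Lemma Ex_cst c : Ex (fun=> c) = c.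
Proof. rewrite /Ex Rintegral_cst//; rewrite (_ : fine _ = 1) ?mulr1//.
by rewrite -[RHS]/(fine 1%E); congr fine; exact: (probability_setT P). Qed.

Lemma ExD F G : tame F -> tame G -> Ex (fun x => F x + G x) = Ex F + Ex G.
Proof. by move=> tF tG; rewrite /Ex RintegralD//; exact: integrable_tame. Qed.

Lemma ExZ c F : tame F -> Ex (fun x => c * F x) = c * Ex F.
Proof. by move=> tF; rewrite /Ex RintegralZl//; exact: integrable_tame. Qed.

Lemma Ex_sum (I : Type) (r : seq I) (Q : pred I) (F : I -> (nat -> R) -> R) :
  (forall i, tame (F i)) ->
  Ex (fun x => \sum_(i <- r | Q i) F i x) = \sum_(i <- r | Q i) Ex (F i).
Proof.
move=> tF; elim: r => [|i r IH].
  by rewrite big_nil (eq_Ex (G := fun=> 0)) ?Ex_cst// => x; rewrite big_nil.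
rewrite big_cons; case: ifP => Qi.
  rewrite (eq_Ex (G := fun x => F i x + \sum_(i <- r | Q i) F i x)); last first.
    by move=> x; rewrite big_cons Qi.
  by rewrite ExD ?IH//; exact: tame_sum.
by rewrite -IH; apply: eq_Ex => x; rewrite big_cons Qi.
Qed.

Lemma le_Ex F G : tame F -> tame G -> (forall x, F x <= G x) -> Ex F <= Ex G.
Proof.
move=> tF tG FG; apply: le_Rintegral => //; first exact: integrable_tame.
exact: integrable_tame.
Qed.

Lemma le_norm_Ex F : tame F -> `|Ex F| <= Ex (fun x => `|F x|).
Proof. by move=> tF; apply: le_normr_Rintegral => //; exact: integrable_tame. Qed.

(** Conditioning on all coordinates but j, it suffices to compare the integrals along each line
    parallel to the j-th axis. *)
Lemma eq_Ex_slice j F G : tame F -> tame G ->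
  (forall x, \int[mu]_t (F (upd x j t) * gpdf t)%:E =
             \int[mu]_t (G (upd x j t) * gpdf t)%:E)%E ->
  Ex F = Ex G.
Proof.
move=> tF tG FG.
have key H : tame H -> (\int[P]_w (H (Xs w))%:E =
    \int[distribution P (forget X j)]_w \int[mu]_t (H (upd (Xs w) j t) * gpdf t)%:E)%E.
  move=> tH; have [mH _] := tH.
  pose Phi (z : R * cyl_type X j) := (H (upd (Xs z.2) j z.1))%:E.
  have mPhi : measurable_fun setT Phi.
    apply/measurable_EFinP; apply: (mH _ (R * cyl_type X j)%type (fun i z => upd (Xs z.2) j z.1 i)) => i.
    rewrite /upd; have [ij|ij] := eqVneq i j; first exact: measurable_fst.
    have m2 : measurable_fun setT (snd : R * cyl_type X j -> cyl_type X j).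
      exact: measurable_snd.
    have mc := @measurable_cylX _ _ _ P X j i ij.
    exact: (measurableT_comp mc m2).
  have E w : Phi (X j w, w) = (H (Xs w))%:E.
    by rewrite /Phi/= (_ : X j w = Xs w j)// upd_id.
  under eq_integral do rewrite -E.
  rewrite integral_resample//; last first.
    by under eq_fun do rewrite E; exact: integrable_tame.
  apply: eq_integral => w _; rewrite /Phi/=; rewrite (integral_law j)//.
  apply: (mH _ R (fun i t => upd (Xs w) j t i)) => i.
  by rewrite /upd; case: eqP => _.
rewrite /Ex /Rintegral; congr fine; rewrite !key//.
by apply: eq_integral => w _; exact: FG.
Qed.

Lemma gaussian_ibp j F F' : tame F -> tame F' ->
  (forall x (t : R), is_derive t (1 : R) (fun s => F (upd x j s)) (F' (upd x j t))) ->
  (forall x, continuous (fun t => F' (upd x j t))) ->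
  Ex (fun x => x j * F x) = Ex F'.
Proof.
move=> tF tF' dF cF'; apply: (@eq_Ex_slice j) => //.
  by apply: tameM => //; exact: tame_coord.
move=> x; under eq_integral do rewrite {1}/upd eqxx.
apply: gaussian_ibp_line => //.
- by apply: growing_upd; case: tF.
- by apply: growing_upd; case: tF'.
Qed.

End gaussian_vector.

(** * Polynomials of Gaussian variables and the Poincare inequality *)

Section mpoly_generation.
Context (n : nat) (K : comNzRingType).

Definition mvar (j : 'I_n) : mpoly n K := mpolyX K (mnm1 j).

(** Induction along the ring operations suits evaluation and derivation, which are known through
    their rules on sums and products. *)
Lemma mpoly_alg_ind (D : mpoly n K -> Prop) :
  (forall c, D (mpolyC n c)) -> (forall j, D (mvar j)) ->
  (forall p q, D p -> D q -> D (p + q)) -> (forall p q, D p -> D q -> D (p * q)) ->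
  forall p, D p.
Proof.
move=> DC DX DD DM; elim/mpolyind => [|c m p _ _ IH].
  by rewrite -(mpolyC0 n K); exact: DC.
apply: (DD) => //; rewrite -mul_mpolyC; apply: (DM) => //.
rewrite mpolyXE_id; elim/big_ind: _ => [||i _].
- by rewrite -(mpolyC1 n K).
- exact: DM.
elim: (m i) => [|k IHk]; first by rewrite expr0 -(mpolyC1 n K).
by rewrite exprS; apply: (DM) => //; exact: DX.
Qed.

Lemma mderiv_var i j : mderiv i (mvar j) = (j == i)%:R.
Proof.
rewrite /mvar mderivX mnm1E; have [->|_] := eqVneq i j.
  rewrite scale1r (_ : mnm_sub _ _ = mnm0) ?mpolyX0 ?eqxx//.
  by apply/mnmP => k; rewrite mnmBE mnm0E subnn.
by rewrite scale0r.
Qed.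

Lemma mderivX_exp i (p : mpoly n K) k :
  mderiv i (p ^+ k) = k%:R *: (p ^+ k.-1 * mderiv i p).
Proof.
elim: k => [|[|k] IH].
- by rewrite expr0 -(mpolyC1 n K) mderivC scale0r.
- by rewrite expr1 expr0 mul1r scale1r.
- rewrite exprS mderivM IH [k.+1.-1]/= [k.+2.-1]/= -scalerAr mulrCA mulrA.
  by rewrite -exprSr mulrC -{1}[_ * _]scale1r -scalerDl -(natr1 k.+1) addrC.
Qed.

End mpoly_generation.

Section mpoly_eval.
Context {R : realType} (n : nat).
Notation MP := (mpoly n R).

Definition pev (q : MP) (x : nat -> R) : R := meval (fun i : 'I_n => x i) q.

Lemma pevD p q x : pev (p + q) x = pev p x + pev q x. Proof. exact: mevalD. Qed.
Lemma pevM p q x : pev (p * q) x = pev p x * pev q x. Proof. exact: mevalM. Qed.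
Lemma pevC c x : pev (mpolyC n c) x = c. Proof. exact: mevalC. Qed.
Lemma pevX j x : pev (mvar R j) x = x j. Proof. exact: mevalXU. Qed.
Lemma pevZ c p x : pev (c *: p) x = c * pev p x. Proof. exact: mevalZ. Qed.

Lemma pevB p q x : pev (p - q) x = pev p x - pev q x. Proof. exact: mevalB. Qed.

Lemma pev_sum (I : Type) (r : seq I) (Q : pred I) (F : I -> MP) x :
  pev (\sum_(i <- r | Q i) F i) x = \sum_(i <- r | Q i) pev (F i) x.
Proof. exact: raddf_sum. Qed.

Lemma tame_pev q : tame (pev q).
Proof.
elim/mpoly_alg_ind: q => [c|j|p q tp tq|p q tp tq].
- have -> : pev (mpolyC n c) = (fun=> c) by apply/funext => x; rewrite pevC.
  exact: tame_cst.
- have -> : pev (mvar R j) = (fun x => x j) by apply/funext => x; rewrite pevX.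
  exact: tame_coord.
- have -> : pev (p + q) = (fun x => pev p x + pev q x) by apply/funext => x; rewrite pevD.
  exact: tameD.
- have -> : pev (p * q) = (fun x => pev p x * pev q x) by apply/funext => x; rewrite pevM.
  exact: tameM.
Qed.

Lemma is_derive_pev q (j : 'I_n) x (t : R) :
  is_derive t (1 : R) (fun s => pev q (upd x j s)) (pev (mderiv j q) (upd x j t)).
Proof.
elim/mpoly_alg_ind: q => [c|i|p q tp tq|p q tp tq].
- under eq_fun do rewrite pevC; rewrite mderivC /pev meval0.
  exact: is_derive_cst.
- under eq_fun do rewrite pevX; rewrite mderiv_var /upd; have [->|ij] := eqVneq i j.
    by rewrite eqxx -(mpolyC1 n R) pevC; exact: is_derive_id.
  rewrite (_ : (i : nat) == j = false); last by apply/negbTE.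
  by rewrite mulr0n /pev meval0; exact: is_derive_cst.
- under eq_fun do rewrite pevD; rewrite mderivD pevD.
  exact: is_deriveD.
- under eq_fun do rewrite pevM; rewrite mderivM pevD !pevM.
  apply: is_derive_eq; rewrite /GRing.scale/=; ring.
Qed.

Lemma continuous_pev q (j : 'I_n) x : continuous (fun s => pev q (upd x j s)).
Proof. by apply: is_derive_continuous => t; exact: is_derive_pev. Qed.

Context d (T : measurableType d) (P : probability T R) (X : nat -> {RV P >-> R}).
Hypothesis gaussX : gaussian_input P X.
Notation Ex := (Ex X).

Lemma mpoly_ibp (j : 'I_n) (q w : MP) (f f' : R -> R) (C : R) :
  (forall t : R, is_derive t (1 : R) f (f' t)) -> continuous f' ->
  (forall t, `|f t| <= C) -> (forall t, `|f' t| <= C) ->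
  Ex (fun x => pev (mvar R j * q) x * f (pev w x)) =
  Ex (fun x => pev (mderiv j q) x * f (pev w x)) +
  Ex (fun x => pev (q * mderiv j w) x * f' (pev w x)).
Proof.
move=> df cf' fC f'C; have cf := is_derive_continuous df.
have mf : measurable_fun setT f by exact: continuous_measurable_fun.
have mf' : measurable_fun setT f' by exact: continuous_measurable_fun.
have tf : tame (fun x => f (pev w x)) by apply: tame_comp fC (tame_pev w).
have tf' : tame (fun x => f' (pev w x)) by apply: tame_comp f'C (tame_pev w).
rewrite -(ExD gaussX); try by apply: tameM => //; exact: tame_pev.
rewrite (eq_Ex X (G := fun x => x j * (pev q x * f (pev w x)))); last first.
  by move=> x; rewrite pevM pevX mulrA.
apply: (gaussian_ibp gaussX).
- by apply: tameM => //; exact: tame_pev.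
- by apply: tameD; apply: tameM => //; exact: tame_pev.
- move=> x t; have dq := is_derive_pev q j x t; have dw := is_derive_pev w j x t.
  have dfw : is_derive t (1 : R) (fun s => f (pev w (upd x j s)))
      (pev (mderiv j w) (upd x j t) *: f' (pev w (upd x j t))).
    rewrite /GRing.scale/= mulrC.
    exact: (is_derive1_comp (df _) dw).
  apply: is_derive_eq; rewrite /GRing.scale/= pevM; ring.
- move=> x t; apply: cvgD; apply: cvgM; try exact: continuous_pev.
    by apply: continuous_comp; [exact: continuous_pev|exact: cf].
  by apply: continuous_comp; [exact: continuous_pev|exact: cf'].
Qed.

Definition Ep (q : MP) : R := Ex (pev q).

Lemma EpD p q : Ep (p + q) = Ep p + Ep q.
Proof.
rewrite /Ep -(ExD gaussX); [|exact: tame_pev..].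
by apply: eq_Ex => x; exact: pevD.
Qed.

Lemma EpZ c q : Ep (c *: q) = c * Ep q.
Proof.
rewrite /Ep -(ExZ gaussX); last exact: tame_pev.
by apply: eq_Ex => x; exact: pevZ.
Qed.

Lemma EpN q : Ep (- q) = - Ep q.
Proof. by rewrite -scaleN1r EpZ mulN1r. Qed.

Lemma EpB p q : Ep (p - q) = Ep p - Ep q.
Proof. by rewrite EpD EpN. Qed.

Lemma Ep_sum (I : Type) (r : seq I) (Q : pred I) (F : I -> MP) :
  Ep (\sum_(i <- r | Q i) F i) = \sum_(i <- r | Q i) Ep (F i).
Proof.
have Ep0 : Ep 0 = 0 by rewrite -(scale0r 0) EpZ mul0r.
exact: (big_morph Ep EpD Ep0).
Qed.

Lemma EpC c : Ep (mpolyC n c) = c.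
Proof.
rewrite /Ep -[RHS](Ex_cst X).
by apply: eq_Ex => x; exact: pevC.
Qed.

Lemma Ep_sqr_ge0 q : 0 <= Ep (q ^+ 2).
Proof.
rewrite -[leLHS](Ex_cst X); apply: (le_Ex gaussX).
- exact: tame_cst.
- exact: tame_pev.
- by move=> x; rewrite /pev rmorphXn sqr_ge0.
Qed.

Lemma Ep_ibp (j : 'I_n) q : Ep (mvar R j * q) = Ep (mderiv j q).
Proof.
have d1 (t : R) : is_derive t (1 : R) (fun=> 1 : R) 0 by exact: is_derive_cst.
have := @mpoly_ibp j q 0 (fun=> 1) (fun=> 0) 1 d1.
move=> H; have {H} := H.
have c0 : continuous (fun _ : R => 0 : R) by move=> t; exact: cvg_cst.
have n1 (t : R) : `|1 : R| <= 1 by rewrite normr1.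
have n0 (t : R) : `|0 : R| <= 1 by rewrite normr0.
move=> /(_ c0 n1 n0) H; rewrite /Ep.
rewrite (eq_Ex X (G := fun x => pev (mvar R j * q) x * 1)); last by move=> x; rewrite mulr1.
rewrite H (eq_Ex X (F := fun x => _ * 0) (G := fun=> 0)); last by move=> x; rewrite mulr0.
by rewrite Ex_cst addr0; apply: eq_Ex => x; rewrite mulr1.
Qed.

(* Minus the Ornstein-Uhlenbeck generator: solving [q = c + number_op u] turns the
   Poincare inequality for [q] into Cauchy-Schwarz. *)
Definition number_op (u : MP) : MP :=
  \sum_(j < n) (mvar R j * mderiv j u - mderiv j (mderiv j u)).

Lemma number_op_is_linear : linear number_op.
Proof.
move=> c u v; rewrite /number_op scaler_sumr -big_split; apply: eq_bigr => j _ /=.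
rewrite !mderivD !mderivZ mulrDr scalerBr -scalerAr; ring.
Qed.

Lemma number_op0 : number_op 0 = 0.
Proof.
have := number_op_is_linear (-1) 0 0; rewrite scaler0 addr0 scaleN1r => h.
by rewrite {1}h addNr.
Qed.

Definition solvable_poisson (q : MP) := exists u c, q = mpolyC n c + number_op u.

Lemma solvableC c : solvable_poisson (mpolyC n c).
Proof. by exists 0, c; rewrite number_op0 addr0. Qed.

Lemma solvableD p q : solvable_poisson p -> solvable_poisson q -> solvable_poisson (p + q).
Proof.
move=> [u [c ->]] [v [e ->]]; exists (1 *: u + v), (c + e).
by rewrite number_op_is_linear scale1r mpolyCD addrACA.
Qed.

Lemma solvableZ a p : solvable_poisson p -> solvable_poisson (a *: p).
Proof.
move=> [u [c ->]]; exists (a *: u + 0), (a * c).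
by rewrite number_op_is_linear number_op0 addr0 scalerDr mpolyCM mul_mpolyC.
Qed.

Lemma solvable_sum (I : Type) (r : seq I) (Q : pred I) (F : I -> MP) :
  (forall i, Q i -> solvable_poisson (F i)) -> solvable_poisson (\sum_(i <- r | Q i) F i).
Proof.
move=> sF; elim/big_ind: _ => //; last exact: solvableD.
by rewrite -(mpolyC0 n R); exact: solvableC.
Qed.

Lemma euler_monomial (m : multinom n) :
  \sum_(j < n) mvar R j * mderiv j (mpolyX R m) = (mdeg m)%:R *: mpolyX R m.
Proof.
rewrite mdegE natr_sum scaler_suml; apply: eq_bigr => j _.
rewrite mderivX -scalerAr; have [->|mj] := eqVneq (m j) 0%N; first by rewrite !scale0r.
congr (_ *: _); rewrite /mvar -mpolyXD; congr mpolyX.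
apply/mnmP => k; rewrite mnmDE mnmBE mnm1E subnKC//.
by have [<-|//] := eqVneq j k; rewrite lt0n.
Qed.

(** Strong induction on the degree: by Euler's identity, [number_op] sends a monomial to its degree
    times itself minus second derivatives, which have smaller degree. Dividing by the degree is
    possible except for constants, which c absorbs. *)
Lemma solvable_monomial (m : multinom n) : solvable_poisson (mpolyX R m).
Proof.
have [k] := ubnP (mdeg m); elim: k m => // k IH m; rewrite ltnS => mk.
have [m0|m0] := eqVneq (mdeg m) 0%N.
  have /eqP -> : m == mnm0 by rewrite -mdeg_eq0 m0.
  by rewrite mpolyX0 -(mpolyC1 n R); exact: solvableC.
have E : (mdeg m)%:R *: mpolyX R m = number_op (mpolyX R m) +
    \sum_(j < n) mderiv j (mderiv j (mpolyX R m)).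
  by rewrite /number_op sumrB subrK euler_monomial.
have -> : mpolyX R m = (mdeg m)%:R^-1 *: ((mdeg m)%:R *: mpolyX R m).
  by rewrite scalerA mulVf ?scale1r// pnatr_eq0.
apply: solvableZ; rewrite E; apply: solvableD.
  by exists (mpolyX R m), 0; rewrite mpolyC0 add0r.
apply: solvable_sum => j _; rewrite mderivX mderivZ mderivX scalerA.
have [mj|mj] := eqVneq (m j) 0%N.
  by rewrite mj mulr0n mul0r scale0r -(mpolyC0 n R); exact: solvableC.
apply: solvableZ; apply: IH; apply: leq_trans mk.
apply: leq_ltn_trans (mdegB _ _) _.
rewrite -[X in (_ < mdeg X)%N](@submK _ (mnm1 j) m) ?mdegD ?mdeg1 ?addn1//.
by apply/mnm_lepP => i; rewrite mnm1E; have [<-|//] := eqVneq j i; rewrite lt0n.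
Qed.

Lemma solvable_poissonT (q : MP) : solvable_poisson q.
Proof.
rewrite (mpolyE q); apply: solvable_sum => m _.
exact/solvableZ/solvable_monomial.
Qed.

Lemma Ep_number_op u q :
  Ep (number_op u * q) = \sum_(j < n) Ep (mderiv j u * mderiv j q).
Proof.
rewrite mulr_suml Ep_sum; apply: eq_bigr => j _.
by rewrite mulrBl -mulrA EpB Ep_ibp mderivM EpD addrAC subrr add0r.
Qed.

(** The commutation relation between derivation and [number_op]; the extra term [mderiv j u] is the
    spectral gap 1 behind the Poincare inequality. *)
Lemma mderiv_number_op u j :
  mderiv j (number_op u) = number_op (mderiv j u) + mderiv j u.
Proof.
rewrite /number_op raddf_sum/=.
have E i : mderiv j (mvar R i * mderiv i u - mderiv i (mderiv i u)) =
    (mvar R i * mderiv i (mderiv j u) - mderiv i (mderiv i (mderiv j u))) +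
    (i == j)%:R * mderiv i u.
  rewrite mderivB mderivM mderiv_var (mderiv_comm i j u) (mderiv_comm i j (mderiv i u)).
  by rewrite (mderiv_comm i j u) -addrA addrC.
under eq_bigr do rewrite E.
rewrite big_split/=; congr (_ + _).
rewrite (bigD1 j)//= eqxx mul1r big1 ?addr0// => i /negbTE ->.
by rewrite mul0r.
Qed.

(** Write F - E F = L u with L = [number_op]. Then Var F = E <grad u, grad F>, while E |grad u|^2 <=
    Var F by the commutation relation, and 2 <x, y> <= |x|^2 + |y|^2 concludes. *)
Lemma gaussian_poincare (F : MP) :
  Ep ((F - mpolyC n (Ep F)) ^+ 2) <= \sum_(j < n) Ep (mderiv j F ^+ 2).
Proof.
have [u [c Fu]] := solvable_poissonT F.
have EN : Ep (number_op u) = 0.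
  rewrite -[number_op u]mulr1 Ep_number_op big1// => j _.
  by rewrite -(mpolyC1 n R) mderivC mulr0 -(mpolyC0 n R) EpC.
have Ec : Ep F = c by rewrite Fu EpD EpC EN addr0.
set G := F - _; have GE : G = number_op u by rewrite /G Ec Fu addrAC subrr add0r.
have dG j : mderiv j G = mderiv j F by rewrite /G mderivB mderivC subr0.
set A := \sum_(j < n) Ep (mderiv j u ^+ 2).
have E1 : Ep (G ^+ 2) = \sum_(j < n) Ep (mderiv j u * mderiv j F).
  rewrite expr2 {1}GE Ep_number_op; by apply: eq_bigr => j _; rewrite dG.
have E2 : A <= Ep (G ^+ 2).
  rewrite expr2 {1}GE Ep_number_op GE; apply: ler_sum => j _.
  rewrite mderiv_number_op mulrDr EpD expr2 lerDr mulrC Ep_number_op.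
  by apply: sumr_ge0 => i _; rewrite -expr2 Ep_sqr_ge0.
have E3 : 2 * Ep (G ^+ 2) <= A + \sum_(j < n) Ep (mderiv j F ^+ 2).
  rewrite E1 mulr_sumr -big_split/=; apply: ler_sum => j _.
  have := Ep_sqr_ge0 (mderiv j u - mderiv j F).
  rewrite sqrrB EpD EpB (mulr2n (_ * _)) EpD.
  move: (Ep (_ ^+ 2)) (Ep (_ * _)) (Ep (_ ^+ 2)) => y1 y2 y3; lra.
move: E2 E3; set D := \sum_(j < n) Ep (_ ^+ 2).
move: (Ep (G ^+ 2)) A D => B y1 y2; lra.
Qed.

End mpoly_eval.

(** * Stein kernels *)

Section stein_kernel.
Context (R : realType) (n : nat) d (T : measurableType d) (P : probability T R)
  (X : nat -> {RV P >-> R}).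
Hypothesis gaussX : gaussian_input P X.
Notation MP := (mpoly n R).
Notation mu := (@lebesgue_measure R).
Notation gpdf := (@normal_pdf R 0 1).
Notation Ex := (Ex X).
Notation Ep := (@Ep R n _ _ P X).

Variables (W : MP) (m : R) (V : 'I_n -> MP).
Hypothesis WV : W - mpolyC n m = \sum_(j < n) (mvar R j * V j - mderiv j (V j)).
Let K : MP := \sum_(j < n) V j * mderiv j W.

Lemma Ep_divergence : Ep W = m.
Proof.
have : Ep (W - mpolyC n m) = 0.
  rewrite WV (Ep_sum gaussX) big1// => j _.
  by rewrite (EpB gaussX) (Ep_ibp gaussX) subrr.
by rewrite (EpB gaussX) EpC => /eqP; rewrite subr_eq0 => /eqP.
Qed.

Lemma Ep_variance_kernel : Ep ((W - mpolyC n m) ^+ 2) = Ep K.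
Proof.
rewrite expr2 {1}WV mulr_suml /K !(Ep_sum gaussX); apply: eq_bigr => j _.
rewrite mulrBl -mulrA (EpB gaussX) (Ep_ibp gaussX) mderivM (EpD gaussX).
by rewrite mderivB mderivC subr0 addrAC subrr add0r.
Qed.

(** When X_j V_j f(W) is integrated by parts, the term with d_j V_j cancels the divergence
    correction and the chain rule leaves V_j d_j W f'(W). *)
Lemma stein_kernel_ibp (f f' : R -> R) (C : R) :
  (forall t : R, is_derive t (1 : R) f (f' t)) -> continuous f' ->
  (forall t, `|f t| <= C) -> (forall t, `|f' t| <= C) ->
  Ex (fun x => (pev W x - m) * f (pev W x)) = Ex (fun x => pev K x * f' (pev W x)).
Proof.
move=> df cf' fC f'C.
have mf : measurable_fun setT f by apply: continuous_measurable_fun; exact: is_derive_continuous df.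
have mf' : measurable_fun setT f' by exact: continuous_measurable_fun.
have tf : tame (fun x => f (pev W x)) by apply: tame_comp fC (tame_pev W).
have tf' : tame (fun x => f' (pev W x)) by apply: tame_comp f'C (tame_pev W).
have tp q : tame (fun x => pev q x * f (pev W x)) by apply: tameM => //; exact: tame_pev.
have tp' q : tame (fun x => pev q x * f' (pev W x)) by apply: tameM => //; exact: tame_pev.
rewrite (eq_Ex X (G := fun x => \sum_(j < n) (pev (mvar R j * V j) x * f (pev W x) +
    (- 1) * (pev (mderiv j (V j)) x * f (pev W x))))); last first.
  move=> x; have -> : pev W x - m = pev (W - mpolyC n m) x by rewrite pevB pevC.
  rewrite WV pev_sum mulr_suml; apply: eq_bigr => j _.
  by rewrite pevB mulrBl mulN1r.
rewrite (Ex_sum gaussX); last first.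
  by move=> j; apply: tameD => //; apply: tameM => //; exact: tame_cst.
rewrite [RHS](eq_Ex X (G := fun x => \sum_(j < n) pev (V j * mderiv j W) x * f' (pev W x))); last first.
  by move=> x; rewrite /K pev_sum mulr_suml.
rewrite (Ex_sum gaussX)//; apply: eq_bigr => j _.
rewrite (ExD gaussX)//; last by apply: tameM => //; exact: tame_cst.
rewrite (ExZ gaussX)// (mpoly_ibp gaussX j (V j) W df cf' fC f'C).
by rewrite mulN1r addrAC subrr add0r.
Qed.

(** Put Z = 1 - K / s^2 and U = (W - m) / s. For the Stein solution f, the kernel identity turns the
    difference into E [f'(U) Z] with |f'| <= 2. Then 2 |Z| <= e + Z^2 / e, and as s^2 = E K, the
    mean of Z^2 is Var K / s^4, which the Poincare inequality bounds. *)
Lemma stein_bound (s e : R) (h : R -> R) : 0 < s -> Ep K = s ^+ 2 -> 0 < e ->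
  continuous h -> (forall x, 0 <= h x <= 1) ->
  `|Ex (fun x => h ((pev W x - m) / s)) - \int[mu]_t (h t * gpdf t)|
  <= e + (\sum_(j < n) Ep (mderiv j K ^+ 2)) / (e * s ^+ 4).
Proof.
move=> s0 Ks e0 ch h01.
have [f [f' [df cf' [C fC] f'2 fE]]] := stein_solution ch h01.
have C0 : 0 <= C by exact: le_trans (fC 0).
pose g t := f ((t - m) / s); pose g' t := f' ((t - m) / s) / s.
have daff (t : R) : is_derive t (1 : R) (fun u => (u - m) / s) s^-1.
  by apply: is_derive_eq; rewrite /GRing.scale/=; ring.
have dg (t : R) : is_derive t (1 : R) g (g' t).
  exact: (is_derive1_comp (df _) (daff t)).
have caff : continuous (fun u : R => (u - m) / s) by exact: is_derive_continuous daff.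
have cg' : continuous g'.
  move=> t; apply: cvgM; last exact: cvg_cst.
  by apply: continuous_comp; [exact: caff|exact: cf'].
pose D := C + 2 / s.
have gD t : `|g t| <= D by apply: le_trans (fC _) _; rewrite lerDl divr_ge0// ltW.
have g'D t : `|g' t| <= D.
  rewrite normrM normfV (gtr0_norm s0); apply: (@le_trans _ _ (2 / s)); last by rewrite lerDr.
  by rewrite ler_wpM2r// invr_ge0 ltW.
have IBP := stein_kernel_ibp dg cg' gD g'D.
have cf := is_derive_continuous df.
have mf : measurable_fun setT f by exact: continuous_measurable_fun.
have mf' : measurable_fun setT f' by exact: continuous_measurable_fun.
have mh : measurable_fun setT h by exact: continuous_measurable_fun.
pose U x := (pev W x - m) / s.
have tU : tame U.
  apply: tameM; last exact: tame_cst.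
  by apply: tameD; [exact: tame_pev|exact: tame_cst].
have tfU : tame (fun x => f (U x)) by exact: tame_comp fC tU.
have tf'U : tame (fun x => f' (U x)) by exact: tame_comp f'2 tU.
have thU : tame (fun x => h (U x)).
  apply: (@tame_comp _ h U 1) => // t; have /andP[? ?] := h01 t.
  by rewrite ger0_norm.
pose Z x := 1 - pev K x / s ^+ 2.
have tZ : tame Z.
  apply: tameD; first exact: tame_cst.
  have -> : (fun x => - (pev K x / s ^+ 2)) = (fun x => pev K x * - (s ^+ 2)^-1).
    by apply/funext => x; rewrite mulrN.
  by apply: tameM; [exact: tame_pev|exact: tame_cst].
have s1 : s != 0 by rewrite gt_eqF.
have E1 : Ex (fun x => U x * f (U x)) = Ex (fun x => pev K x / s ^+ 2 * f' (U x)).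
  rewrite (eq_Ex X (G := fun x => s^-1 * ((pev W x - m) * g (pev W x)))); last first.
    by move=> x; rewrite /U /g mulrA [s^-1 * _]mulrC.
  rewrite (ExZ gaussX); last first.
    apply: tameM => //; by apply: tameD; [exact: tame_pev|exact: tame_cst].
  rewrite IBP -(ExZ gaussX); last first.
    apply: tameM; first exact: tame_pev.
    by apply: tameM => //; exact: tame_cst.
  by apply: eq_Ex => x; rewrite /g' -/(U x); field.
have E2 : Ex (fun x => h (U x)) - \int[mu]_t (h t * gpdf t) = Ex (fun x => f' (U x) * Z x).
  set c := \int[mu]_t _.
  rewrite (eq_Ex X (F := fun x => f' (U x) * Z x)
    (G := fun x => f' (U x) + (-1) * (pev K x / s ^+ 2 * f' (U x)))); last first.
    by move=> x; rewrite /Z; ring.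
  have tKs : tame (fun x => pev K x / s ^+ 2 * f' (U x)).
    by apply: tameM => //; apply: tameM; [exact: tame_pev|exact: tame_cst].
  rewrite (ExD gaussX)//; last by apply: tameM => //; exact: tame_cst.
  rewrite (ExZ gaussX)// -E1 -(ExZ gaussX)//; last exact: tameM.
  rewrite -(ExD gaussX)//; last by apply: tameM; [exact: tame_cst|exact: tameM].
  rewrite (eq_Ex X (F := fun x => f' (U x) + _) (G := fun x => h (U x) + (- c))); last first.
    by move=> x; rewrite -fE; ring.
  by rewrite (ExD gaussX) ?Ex_cst//; exact: tame_cst.
rewrite E2.
have tfZ : tame (fun x => f' (U x) * Z x) by exact: tameM.
apply: le_trans (le_norm_Ex gaussX tfZ) _.
have tB : tame (fun x => e + e^-1 * Z x ^+ 2).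
  by apply: tameD; [exact: tame_cst|apply: tameM; [exact: tame_cst|exact: tameX]].
apply: (@le_trans _ _ (Ex (fun x => e + e^-1 * Z x ^+ 2))).
  apply: (le_Ex gaussX) => //; first exact: tame_norm.
  move=> x; rewrite normrM; apply: (@le_trans _ _ (2 * `|Z x|)); first by rewrite ler_wpM2r.
  rewrite -(@ler_pM2l _ e)// mulrDr mulrA (mulrA e) divff ?gt_eqF// mul1r.
  have <- : `|Z x| ^+ 2 = Z x ^+ 2 by rewrite real_normK ?num_real.
  have := sqr_ge0 (e - `|Z x|); set z := `|Z x|; nra.
rewrite (ExD gaussX) ?Ex_cst//; [|exact: tame_cst|by apply: tameM; [exact: tame_cst|exact: tameX]].
rewrite lerD2l (ExZ gaussX); last exact: tameX.
rewrite (eq_Ex X (G := fun x => (s ^+ 4)^-1 * pev ((K - mpolyC n (Ep K)) ^+ 2) x)); last first.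
  move=> x; rewrite /Z {2}/pev rmorphXn/= -/(pev _ x) pevB pevC Ks; field.
  exact: s1.
rewrite (ExZ gaussX); last exact: tame_pev.
rewrite mulrA -invfM mulrC ler_wpM2r ?invr_ge0 ?mulr_ge0 ?exprn_ge0 ?(ltW e0) ?(ltW s0)//.
exact: gaussian_poincare.
Qed.

(** Standardising removes the factor a, so the trace may be replaced by its normalisation, whose
    mean and variance are m and E K by [Ep_divergence] and [Ep_variance_kernel]. *)
Theorem stein_total_variation (Y : {RV P >-> R}) (a e : R) :
  0 < a -> (forall w, Y w = a * pev W (Xs X w)) -> 0 < Ep K -> 0 < e ->
  (total_variation_distance (distribution P (standardized P Y)) (normal_prob 0 1) <=
   (e + (\sum_(j < n) Ep (mderiv j K ^+ 2)) / (e * Ep K ^+ 2))%:E)%E.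
Proof.
move=> a0 Ya K0 e0; apply: total_variation_distance_le => h ch h01.
pose s := Num.sqrt (Ep K).
have s0 : 0 < s by rewrite sqrtr_gt0.
have Ks : Ep K = s ^+ 2 by rewrite sqr_sqrtr// ltW.
have s4 : Ep K ^+ 2 = s ^+ 4 by rewrite Ks -exprM.
rewrite s4; apply: le_trans (stein_bound s0 Ks e0 ch h01).
have EY : fine 'E_P[Y]%E = a * m.
  rewrite unlock; rewrite -Ep_divergence -(ExZ gaussX); last exact: tame_pev.
  by apply: eq_Rintegral => w _; rewrite Ya.
have VY : fine 'V_P[Y]%E = a ^+ 2 * Ep K.
  rewrite -Ep_variance_kernel /variance unlock EY unlock -(ExZ gaussX); last exact: tame_pev.
  apply: eq_Rintegral => w _.
  rewrite -[LHS]/((Y w - a * m) * (Y w - a * m)) Ya {3}/pev rmorphXn/= -/(pev _ _) pevB pevC.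
  ring.
have -> : \int[P]_w h (standardized P Y w) = Ex (fun x => h ((pev W x - m) / s)).
  apply: eq_Rintegral => w _; congr h.
  rewrite /standardized EY VY Ya sqrtrM ?sqr_ge0// sqrtr_sqr gtr0_norm// -/s; field.
  by rewrite !gt_eqF.
exact: lexx.
Qed.

End stein_kernel.

(** * Real-valued modulus and real parts of complex polynomials *)

Section complex_modulus.
Context {R : realType}.
Notation C := (complex R).
Notation toC := (@real_complex_def R (Phant R)).

Definition reC (z : C) : R := complex.Re z.

Lemma reC_is_additive : additive reC.
Proof. by case=> a b [c d]. Qed.

HB.instance Definition _ := GRing.isAdditive.Build C R reC reC_is_additive.

Lemma reCD z w : reC (z + w) = reC z + reC w. Proof. exact: raddfD. Qed.

Lemma reCK (r : R) : reC (toC r) = r. Proof. by []. Qed.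

Lemma reC_scale (r : R) (z : C) : reC (toC r * z) = r * reC z.
Proof. by case: z => a b; rewrite /reC/= mul0r subr0. Qed.

Lemma reC_iM (z : C) : complex.Im z = - reC (z * Complex 0 1).
Proof. by case: z => a b; rewrite /reC/= mulr0 mulr1 sub0r opprK. Qed.

(** The norm on [complex R] is itself complex-valued; its real part gives a modulus in R, open to
    real arithmetic tactics. *)
Definition md (z : C) : R := reC `|z|.

Lemma mdE (z : C) : `|z| = toC (md z).
Proof. by rewrite /md normc_def. Qed.

Lemma md_ge0 z : 0 <= md z.
Proof. by have := normr_ge0 z; rewrite mdE lecR. Qed.

Lemma mdM z w : md (z * w) = md z * md w.
Proof. by have := normrM z w; rewrite !mdE -rmorphM => /complexI. Qed.

Lemma mdX z k : md (z ^+ k) = md z ^+ k.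
Proof. by have := normrX k z; rewrite !mdE -rmorphXn => /complexI. Qed.

Lemma mdD z w : md (z + w) <= md z + md w.
Proof. by have := ler_normD z w; rewrite !mdE -rmorphD lecR. Qed.

Lemma md0 : md 0 = 0.
Proof. by rewrite /md normr0. Qed.

Lemma md_sum (I : Type) (r : seq I) (Q : pred I) (F : I -> C) :
  md (\sum_(i <- r | Q i) F i) <= \sum_(i <- r | Q i) md (F i).
Proof.
elim/big_ind2: _ => [|z a w b za wb|//]; first by rewrite md0.
by apply: le_trans (mdD _ _) _; exact: lerD.
Qed.

Lemma md_real (r : R) : md (toC r) = `|r|.
Proof.
have : `|toC r| ^+ 2 = toC (`|r| ^+ 2).
  by rewrite -add_Re2_Im2/= expr0n/= addr0 real_normK ?num_real.
rewrite mdE -rmorphXn => /complexI /eqP; rewrite eqrXn2// ?md_ge0//.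
by move=> /eqP.
Qed.

Lemma md_nat k : md k%:R = k%:R.
Proof. by rewrite -[k%:R in LHS](rmorph_nat toC) md_real ger0_norm. Qed.

Lemma md_sqr (z : C) : md z ^+ 2 = reC z ^+ 2 + complex.Im z ^+ 2.
Proof. by have := add_Re2_Im2 z; rewrite mdE -rmorphXn => /complexI. Qed.

Lemma normr_reC_md (z : C) : `|reC z| <= md z.
Proof.
rewrite -(@ler_sqr _ `|_|) ?nnegrE ?md_ge0// md_sqr real_normK ?num_real//.
by rewrite lerDl sqr_ge0.
Qed.

End complex_modulus.

Section complex_mpoly.
Context {R : realType} (n : nat).
Notation C := (complex R).
Notation toC := (@real_complex_def R (Phant R)).
Notation MP := (mpoly n R).
Notation MC := (mpoly n C).

Definition cev (q : MC) (x : nat -> R) : C := meval (fun i : 'I_n => toC (x i)) q.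
Definition ofR (q : MP) : MC := map_mpoly toC q.
Definition reM (q : MC) : MP := map_mpoly (@reC R) q.

HB.instance Definition _ := GRing.RMorphism.copy ofR (map_mpoly toC).
HB.instance Definition _ := GRing.Additive.copy reM (map_mpoly (@reC R)).

Lemma cevD p q x : cev (p + q) x = cev p x + cev q x. Proof. exact: mevalD. Qed.
Lemma cevM p q x : cev (p * q) x = cev p x * cev q x. Proof. exact: mevalM. Qed.
Lemma cevC c x : cev (mpolyC n c) x = c. Proof. exact: mevalC. Qed.
Lemma cevX j x : cev (mvar C j) x = toC (x j). Proof. exact: mevalXU. Qed.
Lemma cevZ c p x : cev (c *: p) x = c * cev p x. Proof. exact: mevalZ. Qed.
Lemma cevXn p k x : cev (p ^+ k) x = cev p x ^+ k. Proof. exact: rmorphXn. Qed.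
Lemma cev_sum (I : Type) (r : seq I) (Q : pred I) (F : I -> MC) x :
  cev (\sum_(i <- r | Q i) F i) x = \sum_(i <- r | Q i) cev (F i) x.
Proof. exact: raddf_sum. Qed.

Lemma ofR_C c : ofR (mpolyC n c) = mpolyC n (toC c).
Proof. exact: map_mpolyC. Qed.

Lemma ofR_X j : ofR (mvar R j) = mvar C j.
Proof. exact: map_mpolyX. Qed.

Lemma reM_ofR q : reM (ofR q) = q.
Proof. by apply/mpolyP => m; rewrite !mcoeff_map_mpoly. Qed.

Lemma mderiv_reM j q : mderiv j (reM q) = reM (mderiv j q).
Proof.
by apply/mpolyP => m; rewrite !(mcoeff_map_mpoly, mcoeff_deriv)/= raddfMn.
Qed.

Lemma mderiv_ofR j q : mderiv j (ofR q) = ofR (mderiv j q).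
Proof.
by apply/mpolyP => m; rewrite !(mcoeff_map_mpoly, mcoeff_deriv)/= raddfMn.
Qed.

Lemma reMD p q : reM (p + q) = reM p + reM q. Proof. exact: raddfD. Qed.
Lemma ofRD p q : ofR (p + q) = ofR p + ofR q. Proof. exact: rmorphD. Qed.
Lemma ofRM p q : ofR (p * q) = ofR p * ofR q. Proof. exact: rmorphM. Qed.

Lemma reM_monomial (c : C) m : reM (c *: mpolyX C m) = reC c *: mpolyX R m.
Proof.
apply/mpolyP => k; rewrite mcoeff_map_mpoly !mcoeffZ !mcoeffX/=.
by case: eqP => _; rewrite ?mulr1 ?mulr0.
Qed.

Lemma pev_reM q x : pev (reM q) x = reC (cev q x).
Proof.
elim/mpolyind: q => [|c m q _ _ IH].
  by rewrite /reM raddf0 /pev /cev !meval0.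
rewrite reMD pevD IH cevD reCD; congr (_ + _).
rewrite reM_monomial pevZ cevZ /pev /cev !mevalX mulrC [in RHS]mulrC -reC_scale.
by rewrite rmorph_prod; congr (reC (_ * _)); apply: eq_bigr => i _; rewrite rmorphXn.
Qed.

(** Taking real parts is linear over the reals only, so one factor must have real coefficients.
    Applied to the factors X_j and d_j W, this transfers the divergence identity and the kernel from
    complex to real polynomials. *)
Lemma reM_mul q w : reM (q * ofR w) = reM q * w.
Proof.
elim/mpoly_alg_ind: w q => [c|j|w1 w2 IH1 IH2|w1 w2 IH1 IH2] q.
- rewrite ofR_C [LHS](_ : _ = reM (toC c *: q)); last by rewrite mulrC mul_mpolyC.
  rewrite mulrC mul_mpolyC; apply/mpolyP => m.
  by rewrite mcoeff_map_mpoly !mcoeffZ mcoeff_map_mpoly/= reC_scale.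
- rewrite ofR_X; elim/mpolyind: q => [|c m q _ _ IH].
    by rewrite mul0r /reM raddf0 mul0r.
  rewrite mulrDl !reMD mulrDl IH; congr (_ + _).
  by rewrite /mvar -scalerAl -mpolyXD !reM_monomial -scalerAl -mpolyXD.
- have E : q * ofR (w1 + w2) = q * ofR w1 + q * ofR w2 by rewrite ofRD mulrDr.
  have E' : reM q * (w1 + w2) = reM q * w1 + reM q * w2 by rewrite mulrDr.
  by rewrite E E' reMD -(IH1 q) -(IH2 q).
- have E : q * ofR (w1 * w2) = (q * ofR w1) * ofR w2 by rewrite ofRM mulrA.
  have E' : reM q * (w1 * w2) = reM q * w1 * w2 by rewrite mulrA.
  by rewrite E E' -(IH1 q); exact: IH2.
Qed.

End complex_mpoly.

(** * Stein kernel of a sum of powers of complex linear forms *)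

Section poisson_power.
Context {A : comNzRingType}.
Implicit Types (c y : A) (m : nat).

(* [poisson_power c y m] is the solution v of y v - c v' = y^m - gauss_moment c m,
   with v' = [dpoisson_power c y m]; here y stands for a linear form and
   c for its covariance with itself. *)
Fixpoint poisson_power c y m : A :=
  match m with
  | 0 => 0
  | m1.+1 => match m1 with
             | 0 => 1
             | m2.+1 => y ^+ m1 + m1%:R * c * poisson_power c y m2
             end
  end.

Fixpoint dpoisson_power c y m : A :=
  match m with
  | 0 => 0
  | m1.+1 => match m1 with
             | 0 => 0
             | m2.+1 => m1%:R * y ^+ m2 + m1%:R * c * dpoisson_power c y m2
             end
  end.

(** The m-th moment of a centred Gaussian variable of variance c: (m - 1)!! c^(m/2) for even m, and
    0 for odd m. *)
Fixpoint gauss_moment c m : A :=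
  match m with
  | 0 => 1
  | m1.+1 => match m1 with
             | 0 => 0
             | m2.+1 => m1%:R * c * gauss_moment c m2
             end
  end.

Lemma nat_ind2 (Q : nat -> Prop) : Q 0%N -> Q 1%N ->
  (forall m, Q m -> Q m.+2) -> forall m, Q m.
Proof.
move=> Q0 Q1 QS m; suff [] : Q m /\ Q m.+1 by [].
by elim: m => [|m [IH1 IH2]]; split => //; exact: QS.
Qed.

Lemma poisson_powerE c y m :
  y * poisson_power c y m - c * dpoisson_power c y m = y ^+ m - gauss_moment c m.
Proof.
elim/nat_ind2: m => [||m IH].
- by rewrite /= !mulr0 expr0 !subrr.
- by rewrite /= mulr1 mulr0 expr1.
have {}IH : y * poisson_power c y m = c * dpoisson_power c y m + (y ^+ m - gauss_moment c m).
  by rewrite -IH addrCA subrr addr0.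
rewrite /= mulrDr mulrDr -exprS.
have -> : y * (m.+1%:R * c * poisson_power c y m) =
    m.+1%:R * c * (y * poisson_power c y m) by ring.
rewrite IH; ring.
Qed.

End poisson_power.

(** The recurrences use ring operations alone, so the solution computed with polynomials evaluates
    to the one computed with complex numbers, and real arguments give real solutions. *)
Lemma rmorph_poisson_power (A B : comNzRingType) (f : {rmorphism A -> B}) c y m :
  f (poisson_power c y m) = poisson_power (f c) (f y) m.
Proof.
elim/nat_ind2: m => [||m IH]; rewrite /= ?rmorph0 ?rmorph1//.
by rewrite rmorphD !rmorphM rmorphXn rmorph_nat IH.
Qed.

Lemma rmorph_dpoisson_power (A B : comNzRingType) (f : {rmorphism A -> B}) c y m :
  f (dpoisson_power c y m) = dpoisson_power (f c) (f y) m.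
Proof.
elim/nat_ind2: m => [||m IH]; rewrite /= ?rmorph0//.
by rewrite rmorphD !rmorphM rmorphXn rmorph_nat IH.
Qed.

Lemma rmorph_gauss_moment (A B : comNzRingType) (f : {rmorphism A -> B}) c m :
  f (gauss_moment c m) = gauss_moment (f c) m.
Proof.
elim/nat_ind2: m => [||m IH]; rewrite /= ?rmorph0 ?rmorph1//.
by rewrite !rmorphM rmorph_nat IH.
Qed.

Section mderiv_poisson.
Context (n : nat) (K : comNzRingType).
Notation MP := (mpoly n K).

Lemma mderiv_nat (i : 'I_n) k : mderiv i (k%:R : MP) = 0.
Proof. by rewrite -mpolyC_nat mderivC. Qed.

Lemma mderiv_Xn (i : 'I_n) (p : MP) k :
  mderiv i (p ^+ k) = k%:R * p ^+ k.-1 * mderiv i p.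
Proof. by rewrite mderivX_exp -mul_mpolyC mpolyC_nat mulrA. Qed.

Lemma mderiv_poisson_power (i : 'I_n) (c : K) (y : MP) m :
  mderiv i (poisson_power (mpolyC n c) y m) =
  dpoisson_power (mpolyC n c) y m * mderiv i y.
Proof.
elim/nat_ind2: m => [||m IH].
- by rewrite /= mderiv0 mul0r.
- by rewrite /= -[1]/(1%:R) mderiv_nat mul0r.
rewrite /= mderivD mderiv_Xn !mderivM mderivC mderiv_nat IH; ring.
Qed.

End mderiv_poisson.

Section linear_forms.
Context {R : realType} (n : nat).
Notation C := (complex R).
Notation toC := (@real_complex_def R (Phant R)).
Notation MP := (mpoly n R).
Notation MC := (mpoly n C).
Variables (a : 'I_n -> 'I_n -> C) (p : nat) (W : MP).

Definition lform (k : 'I_n) : MC := \sum_(j < n) mpolyC n (a k j) * mvar C j.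
(** Bilinear, without conjugation: this is E [lambda_k lambda_l] for independent real X_j. It is
    what integration by parts produces, and it may vanish on the diagonal for forms that are not
    real. *)
Definition cov (k l : 'I_n) : C := \sum_(j < n) a k j * a l j.

Hypothesis WE : ofR W = \sum_(k < n) lform k ^+ p.

Lemma mderiv_lform i k : mderiv i (lform k) = mpolyC n (a k i).
Proof.
rewrite /lform raddf_sum/= (bigD1 i)//= big1 ?addr0 => [|j ji].
  by rewrite mderivM mderivC mul0r add0r mderiv_var eqxx mulr1.
by rewrite mderivM mderivC mul0r add0r mderiv_var (negbTE ji) mulr0.
Qed.

Definition pois k : MC := poisson_power (mpolyC n (cov k k)) (lform k) p.
Definition dpois k : MC := dpoisson_power (mpolyC n (cov k k)) (lform k) p.
Definition cfield (j : 'I_n) : MC := \sum_(k < n) mpolyC n (a k j) * pois k.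
Definition cmean : C := \sum_(k < n) gauss_moment (cov k k) p.
Definition ckernel : MC := \sum_(k < n) \sum_(l < n)
  mpolyC n (cov k l) * pois k * (p%:R * lform l ^+ p.-1).

Lemma sum_aC (k l : 'I_n) :
  \sum_(j < n) mpolyC n (a k j) * mpolyC n (a l j) = mpolyC n (cov k l) :> MC.
Proof. by rewrite /cov raddf_sum/=; apply: eq_bigr => j _; rewrite mpolyCM. Qed.

Lemma mderiv_pois i k : mderiv i (pois k) = dpois k * mpolyC n (a k i).
Proof. by rewrite mderiv_poisson_power mderiv_lform. Qed.

(** Summing over j turns the coefficients [a k j] into [lform k] in the first term and into
    [cov k k] in the second, so each k contributes its own one-variable equation. *)
Lemma cfield_divergence :
  \sum_(j < n) (mvar C j * cfield j - mderiv j (cfield j)) =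
  \sum_(k < n) lform k ^+ p - mpolyC n cmean.
Proof.
have E1 : \sum_(j < n) mvar C j * cfield j = \sum_(k < n) lform k * pois k.
  under eq_bigr do rewrite /cfield mulr_sumr.
  rewrite exchange_big; apply: eq_bigr => k _.
  by rewrite /lform mulr_suml; apply: eq_bigr => j _; ring.
have E2 : \sum_(j < n) mderiv j (cfield j) = \sum_(k < n) mpolyC n (cov k k) * dpois k.
  under eq_bigr do rewrite /cfield raddf_sum/=.
  rewrite exchange_big; apply: eq_bigr => k _.
  rewrite -sum_aC mulr_suml; apply: eq_bigr => j _.
  by rewrite mderivM mderivC mul0r add0r mderiv_pois; ring.
rewrite sumrB E1 E2 -sumrB /cmean raddf_sum -sumrB; apply: eq_bigr => k _.
by rewrite poisson_powerE /= (rmorph_gauss_moment (@mpolyC n C)).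
Qed.

Lemma ckernelE : \sum_(j < n) cfield j * mderiv j (ofR W) = ckernel.
Proof.
have dW j : mderiv j (ofR W) = \sum_(l < n) p%:R * lform l ^+ p.-1 * mpolyC n (a l j).
  by rewrite WE raddf_sum/=; apply: eq_bigr => l _; rewrite mderiv_Xn mderiv_lform.
under eq_bigr do rewrite dW /cfield mulr_suml.
rewrite exchange_big; apply: eq_bigr => k _.
under eq_bigr do rewrite mulr_sumr.
rewrite exchange_big; apply: eq_bigr => l _.
rewrite -sum_aC !mulr_suml; apply: eq_bigr => j _; ring.
Qed.

(** A derivative of the kernel falls on either of two indices; exchanging k and l in one half, [cov]
    being symmetric, gathers all coefficients [a k i]. The gradient becomes the image of this vector
    under the matrix a, which a bound on the Gram matrix then removes. *)
Definition ckernel_grad (k : 'I_n) : MC := \sum_(l < n)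
  (mpolyC n (cov k l) * dpois k * (p%:R * lform l ^+ p.-1) +
   mpolyC n (cov k l) * pois l * (p%:R * (p.-1%:R * lform k ^+ p.-2))).

Lemma covC k l : cov k l = cov l k.
Proof. by apply: eq_bigr => j _; rewrite mulrC. Qed.

Lemma mderiv_ckernel i :
  mderiv i ckernel = \sum_(k < n) mpolyC n (a k i) * ckernel_grad k.
Proof.
rewrite /ckernel raddf_sum/=.
have E k : mderiv i (\sum_(l < n) mpolyC n (cov k l) * pois k * (p%:R * lform l ^+ p.-1)) =
   \sum_(l < n) mpolyC n (a k i) * (mpolyC n (cov k l) * dpois k * (p%:R * lform l ^+ p.-1)) +
   \sum_(l < n) mpolyC n (a l i) * (mpolyC n (cov k l) * pois k * (p%:R * (p.-1%:R * lform l ^+ p.-2))).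
  rewrite raddf_sum/= -big_split/=; apply: eq_bigr => l _.
  rewrite !mderivM mderivC mderiv_nat mderiv_pois mderiv_Xn mderiv_lform; ring.
under eq_bigr do rewrite E.
rewrite big_split/= [X in _ + X]exchange_big/= -big_split/=; apply: eq_bigr => k _.
rewrite /ckernel_grad mulr_sumr -big_split/=; apply: eq_bigr => l _.
by rewrite (covC l k) mulrDr.
Qed.

Definition rfield j : MP := reM (cfield j).
Definition rmean : R := reC cmean.
Definition rkernel : MP := \sum_(j < n) rfield j * mderiv j W.

Lemma reM_sum (I : Type) (r : seq I) (Q : pred I) (F : I -> MC) :
  reM (\sum_(i <- r | Q i) F i) = \sum_(i <- r | Q i) reM (F i).
Proof. exact: raddf_sum. Qed.

Lemma rkernelE : rkernel = reM ckernel.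
Proof.
rewrite -ckernelE reM_sum; apply: eq_bigr => j _.
by rewrite mderiv_ofR; apply/esym; exact: reM_mul.
Qed.

Lemma rfield_divergence :
  W - mpolyC n rmean = \sum_(j < n) (mvar R j * rfield j - mderiv j (rfield j)).
Proof.
have reMB q r : reM (q - r) = reM q - reM r :> MP by exact: raddfB.
transitivity (reM (\sum_(k < n) lform k ^+ p - mpolyC n cmean)).
  rewrite reMB -WE reM_ofR; congr (_ - _).
  by apply/mpolyP => m; rewrite mcoeff_map_mpoly/= !mcoeffC/= /rmean;
    case: eqP => _; rewrite ?mulr1 ?mulr0.
rewrite -cfield_divergence reM_sum; apply: eq_bigr => j _.
rewrite reMB mderiv_reM; congr (_ - _).
have E : mvar C j * cfield j = cfield j * ofR (mvar R j) by rewrite ofR_X mulrC.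
have E' : mvar R j * rfield j = rfield j * mvar R j by rewrite mulrC.
by rewrite E E'; exact: reM_mul.
Qed.

End linear_forms.

(** * Schur test and pointwise bounds on the gradient of the kernel *)

Section schur.
Context {R : realType} (n : nat) (w : 'I_n -> 'I_n -> R) (K : R).
Hypothesis w0 : forall k l, 0 <= w k l.
Hypothesis wC : forall k l, w k l = w l k.
Hypothesis wK : forall k, \sum_(l < n) w k l <= K.

(** Schur test: by symmetry of w, row sums control both halves. *)
Lemma schur_sum (f : 'I_n -> R) : (forall k, 0 <= f k) ->
  \sum_(k < n) \sum_(l < n) w k l * (f k + f l) <= 2 * K * \sum_(k < n) f k.
Proof.
move=> f0.
have E1 : \sum_(k < n) \sum_(l < n) w k l * f k <= K * \sum_(k < n) f k.
  rewrite mulr_sumr; apply: ler_sum => k _; rewrite -mulr_suml.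
  by rewrite ler_wpM2r.
have E2 : \sum_(k < n) \sum_(l < n) w k l * f l <= K * \sum_(k < n) f k.
  rewrite exchange_big/=; apply: le_trans E1; apply: ler_sum => k _.
  by apply: ler_sum => l _; rewrite wC.
have -> : \sum_(k < n) \sum_(l < n) w k l * (f k + f l) =
   \sum_(k < n) \sum_(l < n) w k l * f k + \sum_(k < n) \sum_(l < n) w k l * f l.
  rewrite -big_split; apply: eq_bigr => k _; rewrite -big_split.
  by apply: eq_bigr => l _; rewrite mulrDr.
by rewrite -mulrA mulr_natl mulr2n lerD.
Qed.

(** With S the row sum and A the weighted sum of f, the inequality says that the weighted spread of
    f around A / S is nonnegative; a zero row is treated apart. *)
Lemma weighted_cauchy k (f : 'I_n -> R) :
  (\sum_(l < n) w k l * f l) ^+ 2 <= K * \sum_(l < n) w k l * f l ^+ 2.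
Proof.
apply: (@le_trans _ _ ((\sum_(l < n) w k l) * \sum_(l < n) w k l * f l ^+ 2)); last first.
  by rewrite ler_wpM2r// sumr_ge0// => l _; rewrite mulr_ge0 ?sqr_ge0.
set S := \sum_(l < n) w k l; set A := \sum_(l < n) _; set B := \sum_(l < n) _.
have [S0|S0] : S = 0 \/ 0 < S.
  have : 0 <= S by rewrite sumr_ge0.
  by rewrite le_eqVlt => /predU1P[<-|]; [left|right].
  have wl l : w k l = 0.
    have /eqP := S0; rewrite psumr_eq0// => /allP /(_ l).
    by rewrite mem_index_enum => /(_ isT)/eqP.
  by rewrite S0 mul0r /A big1 ?expr0n// => l _; rewrite wl mul0r.
have : 0 <= \sum_(l < n) w k l * (f l - A / S) ^+ 2.
  by rewrite sumr_ge0// => l _; rewrite mulr_ge0 ?sqr_ge0.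
have -> : \sum_(l < n) w k l * (f l - A / S) ^+ 2 =
    B - 2 * (A / S) * A + (A / S) ^+ 2 * S.
  rewrite /B {3}/A {2}/S !mulr_sumr -sumrB -big_split/=.
  by apply: eq_bigr => l _; ring.
have -> : B - 2 * (A / S) * A + (A / S) ^+ 2 * S = (S * B - A ^+ 2) / S.
  by field; rewrite gt_eqF.
by rewrite pmulr_lge0 ?invr_gt0// subr_ge0.
Qed.

End schur.

Section pointwise.
Context {R : realType}.
Notation C := (complex R).
Notation toC := (@real_complex_def R (Phant R)).

Lemma md_natM k (z : C) : md (k%:R * z) = k%:R * md z.
Proof. by rewrite mdM md_nat. Qed.

(** A single b serves throughout the recurrence: in each double step, b^2 D^2 absorbs both the added
    power of y and the factor 4 (m + 1). The bound 4 on c is the row-sum bound on covariances. *)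
Lemma md_poisson_power (c y : C) (b D : R) m : md c <= 4 -> 1 <= D -> md y <= D ->
  4 * m%:R <= b -> 1 <= b ->
  md (poisson_power c y m) <= b ^+ m * D ^+ m /\
  md (dpoisson_power c y m) <= b ^+ m * D ^+ m.
Proof.
move=> c4 D1 yD mb b1; have D0 : 0 <= D by lra.
have b0 : 0 <= b by lra.
elim/nat_ind2: m mb => [||m IH] mb.
- by rewrite /= md0 !expr0 mulr1 ler01.
- rewrite /= md0 !expr1 mulr_ge0//; split => //.
  by rewrite -[1]/(1%:R) md_nat -[leLHS]mulr1 ler_pM.
have m2 : m.+2%:R = m%:R + 2 :> R by rewrite -addn2 natrD.
have m1 : m.+1%:R = m%:R + 1 :> R by rewrite -addn1 natrD.
have m0 : 0 <= m%:R :> R by [].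
have [|IH1 IH2] := IH; first by move: mb; rewrite m2; lra.
rewrite m2 in mb.
have Dm : 1 <= D ^+ m by exact: exprn_ege1.
have bm : 1 <= b ^+ m by exact: exprn_ege1.
have yk k : md (y ^+ k) <= D ^+ k by rewrite mdX lerXn2r ?nnegrE ?md_ge0.
have split2 : b ^+ m.+2 * D ^+ m.+2 = (b * b) * (D * D) * (b ^+ m * D ^+ m).
  by rewrite !exprS; ring.
set X := b ^+ m * D ^+ m in IH1 IH2 split2 *.
have DX : D ^+ m <= X by rewrite /X ler_peMl//; lra.
have X0 : 0 <= X by rewrite mulr_ge0//; lra.
have b8 : 4 * m%:R + 8 <= b by lra.
have bb : 4 * m%:R + 8 <= b * b by nra.
have DD : D <= D * D by nra.
have bD : (4 * m%:R + 8) * D <= b * b * (D * D).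
  apply: (@le_trans _ _ (b * b * D)); first by rewrite ler_wpM2r.
  by rewrite ler_wpM2l// mulr_ge0.
have m10 : 0 <= m%:R + 1 :> R by lra.
split=> /=; rewrite split2.
- apply: le_trans (mdD _ _) _; rewrite mdM md_natM.
  apply: (@le_trans _ _ (D * X + (m%:R + 1) * 4 * X)).
    apply: lerD; first by apply: le_trans (yk _) _; rewrite exprS ler_wpM2l.
    rewrite m1 ler_pM ?mulr_ge0 ?md_ge0//.
    by rewrite ler_wpM2l.
  rewrite -mulrDl ler_wpM2r//; nra.
- apply: le_trans (mdD _ _) _; rewrite md_natM mdM md_natM.
  apply: (@le_trans _ _ ((m%:R + 1) * X + (m%:R + 1) * 4 * X)).
    apply: lerD; first by rewrite m1 ler_wpM2l//; exact: le_trans (yk _) _.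
    rewrite m1 ler_pM ?mulr_ge0 ?md_ge0//.
    by rewrite ler_wpM2l.
  rewrite -mulrDl ler_wpM2r//; nra.
Qed.

(** Expanding the squares gives the Hermitian form of the Gram matrix at s; the Schur test applies
    after |s_k s_l| <= (|s_k|^2 + |s_l|^2) / 2. *)
Lemma gram_bound (n : nat) (a : 'I_n -> 'I_n -> C) (s : 'I_n -> C) (K : R) :
  (forall k, \sum_(l < n) md (\sum_(i < n) a k i * (a l i)^*) <= K) ->
  \sum_(i < n) md (\sum_(k < n) a k i * s k) ^+ 2 <= K * \sum_(k < n) md (s k) ^+ 2.
Proof.
move=> hK; pose h k l := \sum_(i < n) a k i * (a l i)^*.
have mdJ (z : C) : md (z^*) = md z by rewrite /md norm_conjC.
have hC k l : md (h k l) = md (h l k).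
  rewrite -(mdJ (h l k)); congr md; rewrite /h rmorph_sum; apply: eq_bigr => i _.
  by rewrite rmorphM/= conjCK mulrC.
have E : toC (\sum_(i < n) md (\sum_(k < n) a k i * s k) ^+ 2) =
   \sum_(k < n) \sum_(l < n) h k l * (s k * (s l)^*).
  rewrite rmorph_sum/=.
  under eq_bigr do rewrite rmorphXn/= -mdE normCK rmorph_sum mulr_suml.
  rewrite exchange_big; apply: eq_bigr => k _ /=.
  under eq_bigr do rewrite mulr_sumr.
  rewrite exchange_big; apply: eq_bigr => l _ /=.
  by rewrite /h mulr_suml; apply: eq_bigr => i _; rewrite rmorphM/=; ring.
have S0 : 0 <= \sum_(i < n) md (\sum_(k < n) a k i * s k) ^+ 2.
  by rewrite sumr_ge0// => i _; rewrite sqr_ge0.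
rewrite -(ger0_norm S0) -md_real E.
apply: le_trans (md_sum _ _ _) _.
apply: (@le_trans _ _ (\sum_(k < n) \sum_(l < n) md (h k l) * (md (s k) ^+ 2 / 2 + md (s l) ^+ 2 / 2))).
  apply: ler_sum => k _; apply: le_trans (md_sum _ _ _) _; apply: ler_sum => l _.
  rewrite mdM ler_wpM2l ?md_ge0// mdM mdJ.
  have := sqr_ge0 (md (s k) - md (s l)); set u := md _; set v := md _; nra.
have f0 k : 0 <= md (s k) ^+ 2 / 2 by rewrite divr_ge0// sqr_ge0.
apply: le_trans (schur_sum hC hK f0) _.
rewrite -mulr_suml; set S := \sum_(k < n) _; rewrite le_eqVlt; apply/orP; left.
apply/eqP; by field.
Qed.

(** As D k dominates both 1 and |G k|, every power up to p is at most D k^p, and the products over k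
    and l are split by 2 x y <= x^2 + y^2. The factor 64 collects the row-sum bound 4 from weighted
    Cauchy-Schwarz, 2 from (x + y)^2 <= 2 x^2 + 2 y^2, and 2 times 4 from the Schur test. *)
Lemma grad_bound (n : nat) (c : 'I_n -> 'I_n -> C) (G : 'I_n -> C) (D : 'I_n -> R)
    (p : nat) : (0 < p)%N ->
  (forall k l, c k l = c l k) -> (forall k, \sum_(l < n) md (c k l) <= 4) ->
  (forall k, 1 <= D k) -> (forall k, md (G k) <= D k) ->
  \sum_(k < n) md (\sum_(l < n)
    (c k l * dpoisson_power (c k k) (G k) p * (p%:R * G l ^+ p.-1) +
     c k l * poisson_power (c l l) (G l) p * (p%:R * (p.-1%:R * G k ^+ p.-2)))) ^+ 2
  <= 64 * p%:R ^+ 4 * (4 * p%:R) ^+ (2 * p) * \sum_(k < n) D k ^+ (4 * p).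
Proof.
move=> p0 cC c4 D1 GD; set b : R := 4 * p%:R.
have p1 : 1 <= p%:R :> R by rewrite ler1n.
have b1 : 1 <= b by rewrite /b; lra.
have ckk k : md (c k k) <= 4.
  apply: le_trans (c4 k); rewrite (bigD1 k)//= lerDl sumr_ge0// => l _.
  exact: md_ge0.
have D0 k : 0 <= D k by apply: le_trans (D1 k).
have GX k m : (m <= p)%N -> md (G k ^+ m) <= D k ^+ p.
  move=> mp; rewrite mdX; apply: (@le_trans _ _ (D k ^+ m)).
    by rewrite lerXn2r ?nnegrE ?md_ge0.
  exact: ler_weXn2l.
have Dp k : 0 <= D k ^+ p by rewrite exprn_ge0.
have b0 : 0 <= b by lra.
have bp0 : 0 <= b ^+ p by rewrite exprn_ge0.
have pp : p.-1%:R <= p%:R :> R by rewrite ler_nat leq_pred.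
have pp0 : 0 <= p.-1%:R :> R by [].
pose w k l := md (c k l).
have w0 k l : 0 <= w k l by exact: md_ge0.
have wC k l : w k l = w l k by rewrite /w cC.
have key k : md (\sum_(l < n)
    (c k l * dpoisson_power (c k k) (G k) p * (p%:R * G l ^+ p.-1) +
     c k l * poisson_power (c l l) (G l) p * (p%:R * (p.-1%:R * G k ^+ p.-2)))) <=
   p%:R ^+ 2 * b ^+ p * \sum_(l < n) w k l * (D k ^+ (2 * p) + D l ^+ (2 * p)).
  apply: le_trans (md_sum _ _ _) _; rewrite mulr_sumr; apply: ler_sum => l _.
  apply: le_trans (mdD _ _) _; rewrite !mdM !md_nat -/(w k l).
  have [_ dk] := md_poisson_power (ckk k) (D1 k) (GD k) (lexx b) b1.
  have [vl _] := md_poisson_power (ckk l) (D1 l) (GD l) (lexx b) b1.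
  have g1 := GX l p.-1 (leq_pred p).
  have g2 := GX k p.-2 (leq_trans (leq_pred _) (leq_pred _)).
  rewrite !(mulnC 2) !exprM.
  have g10 := md_ge0 (G l ^+ p.-1); have g20 := md_ge0 (G k ^+ p.-2).
  move: (Dp k) (Dp l) dk vl g1 g2 g10 g20.
  have dk0 := md_ge0 (dpoisson_power (c k k) (G k) p).
  have vl0 := md_ge0 (poisson_power (c l l) (G l) p).
  move: (w0 k l) dk0 vl0.
  move: (md (dpoisson_power _ _ _)) (md (poisson_power _ _ _)) (md (G l ^+ _)) (md (G k ^+ _)).
  move: (D k ^+ p) (D l ^+ p) (w k l) => x y wkl dk vl g1 g2 wkl0 dk0 vl0 x0 y0 dkx vly g1y g2x g10 g20.
  apply: (@le_trans _ _ (wkl * (b ^+ p * x) * (p%:R * y) + wkl * (b ^+ p * y) * (p%:R * (p%:R * x)))).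
    apply: lerD.
      by rewrite ler_pM ?mulr_ge0// ?ler_pM// ?ler_wpM2l.
    by rewrite ler_pM ?mulr_ge0// ?ler_pM// ?mulr_ge0// ?ler_wpM2l// ler_pM.
  have -> : wkl * (b ^+ p * x) * (p%:R * y) + wkl * (b ^+ p * y) * (p%:R * (p%:R * x)) =
     b ^+ p * wkl * (x * y * (p%:R + p%:R ^+ 2)) by ring.
  have -> : p%:R ^+ 2 * b ^+ p * (wkl * (x ^+ 2 + y ^+ 2)) =
     b ^+ p * wkl * (p%:R ^+ 2 * (x ^+ 2 + y ^+ 2)) by ring.
  apply: ler_wpM2l; first by rewrite mulr_ge0.
  have pq : p%:R + p%:R ^+ 2 <= 2 * p%:R ^+ 2 :> R by nra.
  apply: (@le_trans _ _ (x * y * (2 * p%:R ^+ 2))); first by rewrite ler_wpM2l// mulr_ge0.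
  have := sqr_ge0 (x - y); have : 0 <= p%:R ^+ 2 :> R by rewrite sqr_ge0.
  by move: (p%:R ^+ 2) => P P0 xy; nra.
apply: (@le_trans _ _ (\sum_(k < n) (p%:R ^+ 2 * b ^+ p) ^+ 2 *
    (4 * \sum_(l < n) w k l * (2 * D k ^+ (4 * p) + 2 * D l ^+ (4 * p))))).
  apply: ler_sum => k _; apply: (@le_trans _ _ ((p%:R ^+ 2 * b ^+ p *
      \sum_(l < n) w k l * (D k ^+ (2 * p) + D l ^+ (2 * p))) ^+ 2)).
    rewrite lerXn2r ?nnegrE ?md_ge0// mulr_ge0 ?mulr_ge0 ?sqr_ge0// sumr_ge0// => l _.
    by rewrite mulr_ge0// addr_ge0// exprn_ge0.
  rewrite exprMn ler_wpM2l ?sqr_ge0//.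
  apply: le_trans (weighted_cauchy w0 c4 _ _) _; rewrite ler_wpM2l//.
  apply: ler_sum => l _; rewrite ler_wpM2l//.
  have -> : (4 * p = 2 * p * 2)%N by rewrite mulnAC.
  rewrite !(exprM _ (2 * p) 2); move: (D k ^+ _) (D l ^+ _) => x y.
  have := sqr_ge0 (x - y); nra.
rewrite -mulr_sumr -mulr_sumr.
have D40 k : 0 <= 2 * D k ^+ (4 * p) by rewrite mulr_ge0// exprn_ge0.
have := schur_sum wC c4 D40; rewrite -mulr_sumr => Hs.
have cc0 : 0 <= (p%:R ^+ 2 * b ^+ p) ^+ 2 * 4 :> R by rewrite mulr_ge0// sqr_ge0.
rewrite mulrA; apply: le_trans (ler_wpM2l cc0 Hs) _.
rewrite (mulnC 2) (exprM b); move: (b ^+ p) (\sum_(k < n) _) => x y.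
by rewrite le_eqVlt; apply/orP; left; apply/eqP; ring.
Qed.

End pointwise.

(** * Moments of real linear forms *)

Section real_forms.
Context {R : realType} (n : nat).
Notation C := (complex R).
Notation toC := (@real_complex_def R (Phant R)).
Notation MP := (mpoly n R).

Definition rform (u : 'I_n -> R) : MP := \sum_(j < n) mpolyC n (u j) * mvar R j.

Lemma pev_rform u x : pev (rform u) x = \sum_(j < n) u j * x j.
Proof. by rewrite pev_sum; apply: eq_bigr => j _; rewrite pevM pevC pevX. Qed.

Lemma mderiv_rform u i : mderiv i (rform u) = mpolyC n (u i).
Proof.
rewrite /rform raddf_sum/= (bigD1 i)//= big1 ?addr0 => [|j ji].
  by rewrite mderivM mderivC mul0r add0r mderiv_var eqxx mulr1.
by rewrite mderivM mderivC mul0r add0r mderiv_var (negbTE ji) mulr0.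
Qed.

Lemma cev_lform (a : 'I_n -> 'I_n -> C) k x :
  cev (lform a k) x = \sum_(j < n) a k j * toC (x j).
Proof. by rewrite cev_sum; apply: eq_bigr => j _; rewrite cevM cevC cevX. Qed.

Lemma cev_lform_re (a : 'I_n -> 'I_n -> C) k x :
  reC (cev (lform a k) x) = pev (rform (fun j => reC (a k j))) x.
Proof.
rewrite cev_lform pev_rform raddf_sum/=; apply: eq_bigr => j _.
by rewrite [a k j * _]mulrC reC_scale mulrC.
Qed.

Lemma cev_lform_im (a : 'I_n -> 'I_n -> C) k x :
  complex.Im (cev (lform a k) x) = pev (rform (fun j => complex.Im (a k j))) x.
Proof.
rewrite cev_lform pev_rform reC_iM mulr_suml raddf_sum/= -sumrN; apply: eq_bigr => j _.
by rewrite reC_iM mulNr mulrAC [_ * toC _]mulrC reC_scale mulrC.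
Qed.

Context d (T : measurableType d) (P : probability T R) (X : nat -> {RV P >-> R}).
Hypothesis gaussX : gaussian_input P X.
Notation Ex := (Ex X).
Notation Ep := (@Ep R n _ _ P X).

Lemma Ep_rform_step u k :
  Ep (rform u ^+ k.+2) = k.+1%:R * (\sum_(j < n) u j ^+ 2) * Ep (rform u ^+ k).
Proof.
rewrite exprS {1}/rform mulr_suml (Ep_sum gaussX) mulr_sumr mulr_suml.
apply: eq_bigr => j _.
rewrite -mulrA mul_mpolyC (EpZ gaussX) (Ep_ibp gaussX) mderivX_exp mderiv_rform.
by rewrite (mulrC (rform u ^+ _)) mul_mpolyC !(EpZ gaussX) /=; ring.
Qed.

Lemma Ep_one : Ep 1 = 1.
Proof. by rewrite -(mpolyC1 n R) EpC. Qed.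

(** The recurrence yields (2 q - 1)!! s^q with s the variance, and each odd factor is at most 2
    q. *)
Lemma Ep_rform_even (u : 'I_n -> R) q (A : R) : 0 <= A -> \sum_(j < n) u j ^+ 2 <= A ->
  0 <= Ep (rform u ^+ (2 * q)) <= ((2 * q)%:R * A) ^+ q.
Proof.
move=> A0 uA; have s0 : 0 <= \sum_(j < n) u j ^+ 2.
  by rewrite sumr_ge0// => j _; rewrite sqr_ge0.
elim: q => [|q /andP[IH0 IH]]; first by rewrite muln0 !expr0 Ep_one ler01 lexx.
rewrite mulnS add2n Ep_rform_step; apply/andP; split.
  by rewrite !mulr_ge0.
rewrite exprS; apply: ler_pM => //.
- by rewrite mulr_ge0.
- by apply: ler_pM => //; rewrite ler_nat.
- apply: le_trans IH _; rewrite lerXn2r ?nnegrE ?mulr_ge0// ler_wpM2r//.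
  by rewrite ler_nat; exact: leqW (leqnSn _).
Qed.

Lemma Ep_rform_sqr u : Ep (rform u ^+ 2) = \sum_(j < n) u j ^+ 2.
Proof. by rewrite Ep_rform_step expr0 Ep_one mulr1 mul1r. Qed.

End real_forms.

(** * Moment bound for the gradient of the kernel *)

Section kernel_bound.
Context {R : realType} (n : nat).
Notation C := (complex R).
Notation toC := (@real_complex_def R (Phant R)).
Notation MP := (mpoly n R).
Context d (T : measurableType d) (P : probability T R) (X : nat -> {RV P >-> R}).
Hypothesis gaussX : gaussian_input P X.
Notation Ex := (Ex X).
Notation Ep := (@Ep R n _ _ P X).

Variables (a : 'I_n -> 'I_n -> C) (p : nat) (W : MP).
Hypothesis p0 : (0 < p)%N.
Hypothesis WE : ofR W = \sum_(k < n) lform a k ^+ p.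
Hypothesis cov4 : forall k, \sum_(l < n) md (cov a k l) <= 4.
Hypothesis gram4 : forall k, \sum_(l < n) md (\sum_(i < n) a k i * (a l i)^*) <= 4.

Lemma cev_ckernel_grad k x : cev (ckernel_grad a p k) x =
  \sum_(l < n)
    (cov a k l * dpoisson_power (cov a k k) (cev (lform a k) x) p *
       (p%:R * cev (lform a l) x ^+ p.-1) +
     cov a k l * poisson_power (cov a l l) (cev (lform a l) x) p *
       (p%:R * (p.-1%:R * cev (lform a k) x ^+ p.-2))).
Proof.
have cn m : cev (m%:R : mpoly n C) x = m%:R by exact: rmorph_nat.
have cp c y m : cev (poisson_power (mpolyC n c) y m) x = poisson_power c (cev y x) m.
  by rewrite [LHS](rmorph_poisson_power (meval (fun i : 'I_n => toC (x i)))) /= mevalC.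
have cd c y m : cev (dpoisson_power (mpolyC n c) y m) x = dpoisson_power c (cev y x) m.
  by rewrite [LHS](rmorph_dpoisson_power (meval (fun i : 'I_n => toC (x i)))) /= mevalC.
rewrite /ckernel_grad cev_sum; apply: eq_bigr => l _.
by rewrite cevD !cevM !cevC !cevXn !cn cp cd.
Qed.

(** 1 + |lambda_k|^2 dominates both 1 and |lambda_k| and, unlike |lambda_k|, is a polynomial in two
    real forms, so that its moments are within reach. *)
Definition envelope k (x : nat -> R) : R := 1 +
  (pev (rform (fun j => reC (a k j))) x ^+ 2 +
   pev (rform (fun j => complex.Im (a k j))) x ^+ 2).

Lemma envelopeE k x : envelope k x = 1 + md (cev (lform a k) x) ^+ 2.
Proof. by rewrite md_sqr cev_lform_re cev_lform_im. Qed.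

Lemma grad_rkernel_le x :
  \sum_(i < n) pev (mderiv i (rkernel a p W)) x ^+ 2 <=
  256 * p%:R ^+ 4 * (4 * p%:R) ^+ (2 * p) * \sum_(k < n) envelope k x ^+ (4 * p).
Proof.
apply: (@le_trans _ _ (\sum_(i < n) md (\sum_(k < n) a k i * cev (ckernel_grad a p k) x) ^+ 2)).
  apply: ler_sum => i _; rewrite (rkernelE WE) mderiv_reM pev_reM mderiv_ckernel cev_sum.
  under eq_bigr do rewrite cevM cevC.
  rewrite -real_normK ?num_real// lerXn2r ?nnegrE ?md_ge0//.
  exact: normr_reC_md.
apply: le_trans (gram_bound _ gram4) _.
have [S SE] : exists S, S = \sum_(k < n) envelope k x ^+ (4 * p) by eexists.
rewrite -SE.
(* The passage from 64 to 256 is the factor 4 of the Gram matrix bound. *)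
have -> : 256 * p%:R ^+ 4 * (4 * p%:R) ^+ (2 * p) * S =
   4 * (64 * p%:R ^+ 4 * (4 * p%:R) ^+ (2 * p) * S) by ring.
rewrite ler_wpM2l// SE.
under eq_bigr do rewrite cev_ckernel_grad.
apply: grad_bound => //.
- by move=> k l; exact: covC.
- by move=> k; rewrite envelopeE lerDl sqr_ge0.
- move=> k; rewrite envelopeE; have := sqr_ge0 (md (cev (lform a k) x) - 2^-1).
  move: (md _) => z; nra.
Qed.

Lemma sum_sqr_coef_le k :
  \sum_(j < n) reC (a k j) ^+ 2 <= 4 /\ \sum_(j < n) complex.Im (a k j) ^+ 2 <= 4.
Proof.
have E : \sum_(j < n) (reC (a k j) ^+ 2 + complex.Im (a k j) ^+ 2) <= 4.
  apply: le_trans (gram4 k); rewrite [leRHS](bigD1 k)//= -[leLHS]addr0 lerD//; last first.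
    by rewrite sumr_ge0// => l _; exact: md_ge0.
  have -> : \sum_(i < n) a k i * (a k i)^* =
      toC (\sum_(j < n) (reC (a k j) ^+ 2 + complex.Im (a k j) ^+ 2)).
    rewrite rmorph_sum; apply: eq_bigr => i _.
    by rewrite -normCK mdE -rmorphXn md_sqr.
  by rewrite md_real ler_norm.
by split; apply: le_trans E; apply: ler_sum => j _; rewrite ?lerDl ?lerDr sqr_ge0.
Qed.

(** Two facts combine: (1 + s + t)^m <= 3^m (1 + s^m + t^m), and the real and imaginary parts are
    real forms of variance at most 4, whose moments of order 2 m are at most (8 m)^m. *)
Lemma Ex_envelope k m : Ex (fun x => envelope k x ^+ m) <=
  3 ^+ m * (3 * ((2 * m)%:R * 4) ^+ m).
Proof.
set al := rform (fun j => reC (a k j)); set be := rform (fun j => complex.Im (a k j)).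
pose q : MP := 3 ^+ m *: (1 + al ^+ (2 * m) + be ^+ (2 * m)).
apply: (@le_trans _ _ (Ep q)).
  apply: (le_Ex gaussX); last 2 first.
  - exact: tame_pev.
  - move=> x; rewrite /envelope -/al -/be pevZ !pevD.
    have pX (r : MP) j : pev (r ^+ j) x = pev r x ^+ j by exact: rmorphXn.
    rewrite !pX -(mpolyC1 n R) pevC !exprM.
    have := sqr_ge0 (pev al x); have := sqr_ge0 (pev be x).
    move: (_ ^+ 2) (_ ^+ 2) => s t s0 t0.
    have [z [z0 h1 hs ht hz]] : exists z, [/\ 0 <= z, 1 <= z, t <= z, s <= z &
        z ^+ m <= 1 + t ^+ m + s ^+ m].
      pose z := Num.max 1 (Num.max t s).
      have h1 : 1 <= z by rewrite le_max lexx.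
      have ht : t <= z by rewrite !le_max lexx orbT.
      have hs : s <= z by rewrite !le_max lexx !orbT.
      exists z; split => //; first exact: le_trans h1.
      have tm : 0 <= t ^+ m by rewrite exprn_ge0.
      have sm : 0 <= s ^+ m by rewrite exprn_ge0.
      have : z = 1 \/ z = t \/ z = s.
        by rewrite /z; case: (leP t s) => _; case: leP => _; [right; right|left|right; left|left].
      move: (z) tm sm => z' tm sm [|[|]] ->; rewrite ?expr1n.
      - by rewrite -addrA lerDl addr_ge0.
      - by rewrite addrAC lerDr addr_ge0.
      - by rewrite lerDr addr_ge0.
    apply: (@le_trans _ _ ((3 * z) ^+ m)).
      rewrite lerXn2r ?nnegrE ?addr_ge0 ?mulr_ge0//; lra.
    by rewrite exprMn ler_wpM2l ?exprn_ge0// addrAC.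
  - apply: tameX; apply: tameD; first exact: tame_cst.
    by apply: tameD; apply: tameX; exact: tame_pev.
rewrite (EpZ gaussX) ler_wpM2l ?exprn_ge0// !(EpD gaussX) Ep_one.
have [h1 h2] := sum_sqr_coef_le k.
have /andP[_ e1] := Ep_rform_even gaussX m (ler0n R 4) h1.
have /andP[_ e2] := Ep_rform_even gaussX m (ler0n R 4) h2.
have B1 : 1 <= ((2 * m)%:R * 4) ^+ m :> R.
  case: m {q e1 e2} => [|m]; first by rewrite expr0.
  apply: exprn_ege1; have : 1 <= (2 * m.+1)%:R :> R by rewrite ler1n.
  by move: (_%:R) => z; lra.
rewrite -/al -/be in e1 e2 *; move: (Ep _) (Ep _) e1 e2 B1 => x y.
move: (_ ^+ m) => z; lra.
Qed.

Definition kernel_const : R :=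
  256 * p%:R ^+ 4 * (4 * p%:R) ^+ (2 * p) *
  (3 ^+ (4 * p) * (3 * ((2 * (4 * p))%:R * 4) ^+ (4 * p))).

Lemma sum_grad_rkernel_le :
  \sum_(i < n) Ep (mderiv i (rkernel a p W) ^+ 2) <= n%:R * kernel_const.
Proof.
have tq (q : MP) : tame (fun x => pev q x ^+ 2) by apply: tameX; exact: tame_pev.
have te k m : tame (fun x => envelope k x ^+ m).
  apply: tameX; apply: tameD; first exact: tame_cst.
  by apply: tameD; apply: tameX; exact: tame_pev.
rewrite (eq_bigr (fun i => Ex (fun x => pev (mderiv i (rkernel a p W)) x ^+ 2))); last first.
  by move=> i _; apply: eq_Ex => x; exact: rmorphXn.
rewrite -(Ex_sum gaussX)//.
pose B : R := 256 * p%:R ^+ 4 * (4 * p%:R) ^+ (2 * p).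
have B0 : 0 <= B by do 2?apply: mulr_ge0; rewrite ?exprn_ge0 ?mulr_ge0 ?ler0n.
apply: (@le_trans _ _ (Ex (fun x => B * \sum_(k < n) envelope k x ^+ (4 * p)))).
  apply: (le_Ex gaussX).
  - by apply: tame_sum => i; exact: tq.
  - by apply: tameM; [exact: tame_cst|apply: tame_sum => k; exact: te].
  - by move=> x; exact: grad_rkernel_le.
rewrite (ExZ gaussX); last by apply: tame_sum => k; exact: te.
rewrite /kernel_const -/B mulrCA ler_wpM2l// (Ex_sum gaussX); last by move=> k; exact: te.
apply: le_trans (ler_sum _ (fun k _ => Ex_envelope k (4 * p))) _.
by rewrite sumr_const card_ord -[leLHS]mulr_natl.
Qed.

Lemma kernel_total_variation (Y : {RV P >-> R}) (s e L : R) :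
  0 < s -> (forall w, Y w = s * pev W (Xs X w)) ->
  0 < L -> L <= Ep (rkernel a p W) -> 0 < e ->
  (total_variation_distance (distribution P (standardized P Y)) (normal_prob 0 1) <=
   (e + n%:R * kernel_const / (e * L ^+ 2))%:E)%E.
Proof.
move=> s0 YE L0 LE e0; have K0 := lt_le_trans L0 LE.
apply: le_trans (stein_total_variation gaussX (rfield_divergence WE) s0 YE K0 e0) _.
rewrite lee_fin lerD2l; apply: ler_pM.
- by apply: sumr_ge0 => i _; exact: (Ep_sqr_ge0 gaussX).
- by rewrite invr_ge0 mulr_ge0 ?sqr_ge0// ltW.
- exact: sum_grad_rkernel_le.
rewrite lef_pV2 ?posrE ?mulr_gt0 ?exprn_gt0// ler_wpM2l ?(ltW e0)//.
by rewrite lerXn2r ?nnegrE ?(ltW L0) ?(ltW K0).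
Qed.

End kernel_bound.

(** * Traces of powers of circulant matrices *)

(** Subtraction is taken modulo n + 1. Circulant and symmetric circulant matrices both have this
    form, with y the input composed with an index map. *)
Definition translation_mx (V : Type) n (y : 'I_n.+1 -> V) : 'M[V]_n.+1 :=
  \matrix_(i, j) y (j - i).

Section roots_of_unity.
Context {R : realType}.
Notation C := (complex R).

(** Over an algebraically closed field of characteristic 0, X^N - 1 splits with distinct roots, and
    N distinct N-th roots of unity include a primitive one. *)
Lemma ex_primitive_root N : (0 < N)%N -> exists w : C, N.-primitive_root w.
Proof.
move=> N0; pose p : {poly C} := 'X^N - 1; have [r Dp] := closed_field_poly_normal p.
rewrite (monicP _) ?monicXnsubC// scale1r in Dp.
have rn1 : all N.-unity_root r by apply/allP => z; rewrite -root_prod_XsubC -Dp.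
have sz_r : (N < (size r).+1)%N by rewrite -(size_prod_XsubC r id) -Dp size_XnsubC.
have [|z _ zP] := hasP (has_prim_root N0 rn1 _ sz_r); last by exists z.
by rewrite -separable_prod_XsubC -Dp separable_Xn_sub_1// pnatr_eq0 -lt0n.
Qed.

Variables (n : nat) (w : C).
Hypothesis wP : n.+1.-primitive_root w.
Notation I := 'I_n.+1.

Definition chi (r k : I) : C := w ^+ (r * k).

Lemma chiC r k : chi r k = chi k r. Proof. by rewrite /chi mulnC. Qed.

Lemma chiDl r s k : chi (r + s) k = chi r k * chi s k.
Proof. by rewrite /chi !exprM /= (prim_expr_mod wP) exprD exprMn. Qed.

Lemma chiDr r k l : chi r (k + l) = chi r k * chi r l.
Proof. by rewrite !(chiC r) chiDl. Qed.

Lemma chi0l k : chi 0 k = 1. Proof. by rewrite /chi mul0n expr0. Qed.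

Lemma norm_chi r k : `|chi r k| = 1.
Proof.
have w1 : `|w| == 1.
  by rewrite -(@pexpr_eq1 _ _ n.+1)// -normrX (prim_expr_order wP) normr1.
by rewrite /chi normrX (eqP w1) expr1n.
Qed.

Lemma chiNl r k : chi (- r) k = (chi r k)^*.
Proof.
have z1 : chi r k != 0 by rewrite -normr_eq0 norm_chi oner_eq0.
apply: (mulfI z1); rewrite -chiDl subrr chi0l.
by rewrite -normCK norm_chi expr1n.
Qed.

Lemma chiNr r k : chi r (- k) = (chi r k)^*.
Proof. by rewrite chiC chiNl chiC. Qed.

Lemma sum_chi k : \sum_(r < n.+1) chi r k = n.+1%:R * (k == 0)%:R.
Proof.
have [->|k0] := eqVneq k 0.
  under eq_bigr do rewrite chiC chi0l.
  by rewrite sumr_const card_ord mulr1.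
rewrite mulr0; have z1 : w ^+ k - 1 != 0.
  rewrite subr_eq0 -(prim_order_dvd wP) gtnNdvd//.
  by rewrite lt0n; apply: contraNneq k0 => k0; apply/eqP/val_inj.
apply: (mulfI z1); rewrite mulr0.
under eq_bigr do rewrite /chi mulnC exprM.
by rewrite -subrX1 -exprM mulnC exprM (prim_expr_order wP) expr1n subrr.
Qed.

Section circulant_trace.
Variables (A : comNzRingType) (f : {rmorphism C -> A}) (y : I -> A).

Definition fourier k : A := \sum_r f (chi r k) * y r.

Lemma diag_mxX (v : 'rV[A]_n.+1) k : diag_mx v ^+ k = diag_mx (\row_i v 0 i ^+ k).
Proof.
elim: k => [|k IH].
  by apply/matrixP => i j; rewrite !mxE expr0.
rewrite exprS IH; change (diag_mx v *m diag_mx (\row_i v 0 i ^+ k) = diag_mx (\row_i v 0 i ^+ k.+1)).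
rewrite mulmx_diag; congr diag_mx; apply/rowP => i.
by rewrite !mxE exprS.
Qed.

(** The characters diagonalise every translation matrix, F being the Fourier matrix and G its
    inverse. Entries live in a ring A receiving the complex numbers, so that the identity holds for
    matrices of polynomials, with linear forms as eigenvalues. *)
Lemma trace_translation_mx p : \tr (translation_mx y ^+ p) = \sum_k fourier k ^+ p.
Proof.
pose F : 'M[A]_n.+1 := \matrix_(j, k) f (chi j k).
pose G : 'M[A]_n.+1 := \matrix_(k, j) f (n.+1%:R^-1 * chi (- j) k).
pose D : 'M[A]_n.+1 := diag_mx (\row_k fourier k).
have FG : F *m G = 1%:M.
  apply/matrixP => i j; rewrite !mxE.
  under eq_bigr do rewrite !mxE -rmorphM mulrCA -chiDl chiC.
  rewrite -rmorph_sum -mulr_sumr sum_chi mulKf ?pnatr_eq0//.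
  by rewrite subr_eq0 rmorph_nat.
have MF : translation_mx y *m F = F *m D.
  apply/matrixP => i k; rewrite mul_mx_diag !mxE mulr_sumr.
  rewrite (reindex_inj (addIr i)); apply: eq_bigr => r _.
  by rewrite !mxE addrK chiDl rmorphM; ring.
have MFX q : translation_mx y ^+ q *m F = F *m D ^+ q.
  elim: q => [|q IH]; first by rewrite !expr0 mul1mx mulmx1.
  by rewrite exprSr exprS -[_ * _ in LHS]/(_ *m _) -[_ * _ in RHS]/(_ *m _)
     -mulmxA MF mulmxA IH -!mulmxA; congr (_ *m _); rewrite -[LHS]/(D ^+ q * D) -exprSr exprS.
rewrite -[X in \tr X]mulmx1 -FG mulmxA MFX mxtrace_mulC mulmxA (mulmx1C FG) mul1mx.
by rewrite diag_mxX mxtrace_diag; apply: eq_bigr => k _; rewrite !mxE.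
Qed.

End circulant_trace.

End roots_of_unity.

Section circulant_forms.
Context {R : realType} (n : nat) (w : complex R).
Notation C := (complex R).
Notation toC := (@real_complex_def R (Phant R)).
Notation N := n.+1.
Notation I := 'I_N.
Notation MP := (mpoly N R).
Notation MC := (mpoly N C).
Hypothesis wP : N.-primitive_root w.
Notation chi := (chi w).
Notation t := ((Num.sqrt (N%:R : R))^-1).

Variables (m : I -> I) (p : nat).

Lemma sqrt_size_gt0 : 0 < Num.sqrt (N%:R : R).
Proof. by rewrite sqrtr_gt0 ltr0n. Qed.

Lemma sqr_inv_sqrt_size : toC t ^+ 2 = N%:R^-1.
Proof. by rewrite -rmorphXn/= exprVn sqr_sqrtr ?ler0n// -[toC]/(real_complex R) fmorphV rmorph_nat. Qed.

(* [\sum_j coef k j * X_j] is the k-th eigenvalue divided by [sqrt N]; [m] sends the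
   offset [j - i] of an entry to the index of its input variable. *)
Definition coef (k j : I) : C := toC t * \sum_(r < N | m r == j) chi r k.

Definition trace_poly : MP :=
  t ^+ p *: \tr (translation_mx (fun r => mvar R (m r)) ^+ p).

Lemma ofR_scale (c : R) (q : MP) : ofR (c *: q) = toC c *: ofR q.
Proof. by rewrite -!mul_mpolyC ofRM ofR_C. Qed.

Lemma lform_coef k : lform coef k =
  toC t *: fourier w (@mpolyC N C) (fun r => mvar C (m r)) k.
Proof.
rewrite /fourier scaler_sumr (partition_big m xpredT)//=; apply: eq_bigr => j _.
rewrite mul_mpolyC -scalerA -[in LHS]mul_mpolyC; under [in RHS]eq_bigr => r /eqP mr do
  rewrite mr mul_mpolyC.
rewrite mul_mpolyC -scaler_sumr -scaler_suml//.
Qed.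

Lemma ofR_trace_poly : ofR trace_poly = \sum_k lform coef k ^+ p.
Proof.
rewrite /trace_poly ofR_scale -[ofR (\tr _)]trace_map_mx.
have -> : map_mx (@ofR R N) (translation_mx (fun r => mvar R (m r)) ^+ p) =
    translation_mx (fun r => mvar C (m r)) ^+ p.
  rewrite rmorphXn/=; congr (_ ^+ p); apply/matrixP => i j.
  by rewrite !mxE ofR_X.
rewrite (trace_translation_mx wP (@mpolyC N C)) scaler_sumr; apply: eq_bigr => k _.
by rewrite lform_coef exprZn -rmorphXn.
Qed.

Lemma covE k l : cov coef k l =
  N%:R^-1 * \sum_(r < N) chi r k * \sum_(s < N | m s == m r) chi s l.
Proof.
rewrite -sqr_inv_sqrt_size /cov mulr_sumr [RHS](partition_big m xpredT)//=.
apply: eq_bigr => j _; rewrite /coef mulrACA -expr2 -mulr_sumr; congr (_ * _).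
by rewrite mulr_suml; apply: eq_bigr => r /eqP ->.
Qed.

Lemma coef_conj k j : (coef k j)^* = coef (- k) j.
Proof.
rewrite /coef rmorphM/= rmorph_sum/=; congr (_ * _).
  by rewrite conj_Creal// realE lecE /= eqxx/= invr_ge0 ltW ?sqrt_size_gt0.
by apply: eq_bigr => r _; rewrite chiNr.
Qed.

Lemma gramE k l : \sum_(i < N) coef k i * (coef l i)^* = cov coef k (- l).
Proof. by apply: eq_bigr => i _; rewrite coef_conj. Qed.

Lemma cev_lform_conj k (x : nat -> R) :
  cev (lform coef (- k)) x = (cev (lform coef k) x)^*.
Proof.
rewrite !cev_lform rmorph_sum/=; apply: eq_bigr => j _.
rewrite rmorphM/= coef_conj; congr (_ * _).
by rewrite conj_Creal// realE lecE /= eqxx/= lecE /= eqxx /= -realE num_real.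
Qed.

(** Conjugating the coefficients replaces l by -l, so a row of the Gram matrix is a permuted row of
    covariances. *)
Lemma gram_of_cov : (forall k, \sum_(l < N) md (cov coef k l) <= 4) ->
  forall k, \sum_(l < N) md (\sum_(i < N) coef k i * (coef l i)^*) <= 4.
Proof.
move=> H k; under eq_bigr do rewrite gramE.
by rewrite (reindex_inj oppr_inj)/=; under eq_bigr do rewrite opprK.
Qed.

Context d (T : measurableType d) (P : probability T R) (X : nat -> {RV P >-> R}).

Lemma trace_power_translation v :
  trace_power P (translation_mx (fun r => X (m r))) p v =
  Num.sqrt N%:R ^+ p * pev trace_poly (Xs X v).
Proof.
rewrite pevZ mulrA -exprMn mulfV ?gt_eqF ?sqrt_size_gt0// expr1n mul1r.
rewrite /trace_power -[pev _ _]trace_map_mx; congr (\tr _).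
rewrite rmorphXn/=; congr (_ ^+ p); apply/matrixP => i j.
by rewrite !mxE; apply/esym; exact: pevX.
Qed.

End circulant_forms.

(** * The index map of symmetric circulants *)

Section fold_index.
Variable n : nat.
Notation N := n.+1.
Notation I := 'I_N.

Definition fold_index (r : I) : I := inord (minn r (N - r)).

Lemma val_oppI (r : I) : (- r : I) = (if (r : nat) == 0 then 0 else N - r)%N :> nat.
Proof.
rewrite /=; case: eqP => [->|r0]; first by rewrite subn0 modnn.
by rewrite modn_small//; lia.
Qed.

Lemma val_fold_index r : fold_index r = minn r (N - r) :> nat.
Proof. by rewrite /fold_index inordK//; have := ltn_ord r; lia. Qed.

Lemma fold_indexE s r : (fold_index s == fold_index r) = (s == r) || (s == - r).
Proof.
rewrite -!(inj_eq (@ord_inj _)) !val_fold_index val_oppI.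
by have := ltn_ord r; have := ltn_ord s; case: ifP => /= r0; lia.
Qed.

Lemma fold_index_eq0 r : (fold_index r == 0) = (r == 0).
Proof. by rewrite -!(inj_eq (@ord_inj _)) val_fold_index/=; have := ltn_ord r; lia. Qed.

(** The equation 2 r = 0 modulo N has the solution 0 and, for even N, also N / 2. *)
Lemma card_self_opp : (#|[pred r : I | r == - r]| <= 2)%N.
Proof.
apply: (@leq_trans (size [:: 0; inord N./2 : I])) => //.
apply: leq_trans (card_size _); apply/subset_leq_card/fintype.subsetP => r.
rewrite !inE => /eqP/(congr1 (@nat_of_ord _)); rewrite val_oppI => rN.
rewrite -!(inj_eq (@ord_inj _))/=; have := ltn_ord r; move: rN; case: ifP => //= r0 rN rlt.
by rewrite inordK//; lia.
Qed.

End fold_index.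

Arguments fold_index {n} r.

Lemma circulant_translation (V : Type) n (x : nat -> V) :
  circulant x n.+1 = translation_mx (fun r : 'I_n.+1 => x r).
Proof.
apply/matrixP => i j; rewrite !mxE /= modnDmr; congr (x (_ %% _)%N).
by rewrite addnC addnBA// ltnW.
Qed.

Lemma sym_circulant_translation (V : Type) n (x : nat -> V) :
  sym_circulant x n.+1 = translation_mx (fun r : 'I_n.+1 => x (fold_index r)).
Proof.
apply/matrixP => i j; rewrite !mxE val_fold_index; congr (x _).
have -> : (j - i : 'I_n.+1) = (if (i <= j)%N then j - i else n.+1 + j - i)%N :> nat.
  rewrite /= modnDmr addnBA; last exact: ltnW.
  case: leqP => ij; have := ltn_ord j; have := ltn_ord i => hi hj; last first.
    by rewrite modn_small; lia.
  by rewrite addnC -addnBA// modnDl modn_small; lia.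
have := ltn_ord j; have := ltn_ord i; case: (leqP i j) => ij hi hj.
  by rewrite IntDist.distnEr.
by rewrite IntDist.distnEl ?(ltnW ij)// minnC; congr minn; lia.
Qed.

(** * Covariances of the eigenvalues *)

Section covariances.
Context {R : realType} (n : nat) (w : complex R).
Notation C := (complex R).
Notation N := n.+1.
Notation I := 'I_N.
Hypothesis wP : N.-primitive_root w.
Notation chi := (chi w).

(** Orthogonality of characters. Off the self-opposite indices [cov k k] vanishes: the eigenvalue is
    then a circular complex Gaussian variable. *)
Lemma cov_circulant (k l : I) : cov (coef w id) k l = (l == - k)%:R.
Proof.
rewrite covE//; under eq_bigr do rewrite big_pred1_eq -chiDr//.
rewrite sum_chi// mulKf ?pnatr_eq0//.
by rewrite addrC addr_eq0.
Qed.

(** The fibre of [fold_index] through r is {r, -r}: its two points produce the two delta terms, and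
    the last sum removes the double count when r = -r. *)
Lemma cov_sym_circulant (k l : I) : cov (coef w fold_index) k l =
  (l == - k)%:R + (l == k)%:R - N%:R^-1 * \sum_(r | r == - r) chi r (k + l).
Proof.
rewrite covE//.
have E (r : I) : \sum_(s < N | fold_index s == fold_index r) chi s l =
    chi r l + (chi (- r) l - (r == - r)%:R * chi r l).
  rewrite (bigD1 r)//=; congr (_ + _).
  have [rr|rr] := eqVneq r (- r).
    rewrite -rr mul1r subrr big_pred0// => s; rewrite fold_indexE -rr orbb.
    by case: eqVneq.
  rewrite mul0r subr0 (big_pred1 (- r))// => s; rewrite fold_indexE.
  by case: (eqVneq s r) => [->|]; rewrite ?andbF ?andbT//= ?(negbTE rr).
under eq_bigr do rewrite E mulrDr mulrBr mulrCA -!chiDr// chiNl// -chiNr// -chiDr//.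
rewrite big_split/= sumrB !sum_chi// mulrDr mulrBr !mulKf ?pnatr_eq0//.
rewrite addr_eq0 -eqr_oppLR [- k == _]eq_sym subr_eq0 [k == _]eq_sym -addrA; congr (_ + (_ - _ * _)).
by rewrite [RHS]big_mkcond; apply: eq_bigr => r _; case: ifP; rewrite ?mul1r ?mul0r.
Qed.

Lemma sum_md_delta (c : I) : \sum_(l < N) md ((l == c)%:R : C) = 1.
Proof.
rewrite (bigD1 c)//= eqxx md_nat big1 ?addr0// => l lc.
by rewrite (negbTE lc) md0.
Qed.

Lemma sum_cov_circulant (k : I) : \sum_(l < N) md (cov (coef w id) k l) <= 4.
Proof. by under eq_bigr do rewrite cov_circulant; rewrite sum_md_delta; lra. Qed.

Lemma md_self_opp_sum (k : I) : md (N%:R^-1 * \sum_(r | r == - r) chi r k) <= 2 / N%:R.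
Proof.
rewrite mdM mulrC ler_pM ?md_ge0//.
  apply: le_trans (md_sum _ _ _) _.
  have c1 r : md (chi r k) = 1 by rewrite /md norm_chi.
  under eq_bigr do rewrite c1.
  by rewrite sumr_const ler_nat; exact: card_self_opp.
by rewrite /md normfV normr_nat -[N%:R](rmorph_nat (real_complex R)) -fmorphV.
Qed.

(** The origin of the constant 4: each delta contributes 1, and the N corrections at most 2 / N
    each. *)
Lemma sum_cov_sym_circulant (k : I) : \sum_(l < N) md (cov (coef w fold_index) k l) <= 4.
Proof.
apply: (@le_trans _ _ (\sum_(l < N) (md ((l == - k)%:R : C) + md ((l == k)%:R : C) + 2 / N%:R))).
  apply: ler_sum => l _; rewrite cov_sym_circulant.
  apply: le_trans (mdD _ _) _; apply: lerD; first exact: mdD.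
  by rewrite /md normrN; exact: md_self_opp_sum.
rewrite !big_split/= !sum_md_delta sumr_const card_ord -[(_ / _) *+ _]mulr_natr.
by rewrite divfK ?pnatr_eq0//; lra.
Qed.

Lemma reC_cov_sym_diag (k : I) : 1 - 2 / N%:R <= reC (cov (coef w fold_index) k k).
Proof.
rewrite cov_sym_circulant eqxx.
have := normr_reC_md (N%:R^-1 * \sum_(r | r == - r) chi r (k + k)).
move=> /le_trans/(_ (md_self_opp_sum _)); rewrite ler_norml => /andP[_].
move: (_ * _) => z h.
have -> : reC ((k == - k)%:R + true%:R - z) = (k == - k)%:R + 1 - reC z.
  by rewrite !reCD [reC (- z)]raddfN; congr (_ + _ - _); case: eqP.
by apply: lerB h; rewrite lerDr; case: eqP.
Qed.

Lemma coef_sym_conj (k j : I) : (coef w fold_index k j)^* = coef w fold_index k j.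
Proof.
rewrite coef_conj// /coef; congr (_ * _); rewrite (reindex_inj oppr_inj)/=.
apply: eq_big => [r|r _]; last by rewrite chiNl// chiNr// conjCK.
suff -> : fold_index (- r) = fold_index r by [].
by apply/eqP; rewrite fold_indexE eqxx orbT.
Qed.

Lemma coef_sym0 (k : I) : coef w fold_index k 0 = real_complex R (Num.sqrt N%:R)^-1.
Proof.
rewrite /coef (big_pred1 0) ?chi0l ?mulr1// => r.
exact: fold_index_eq0.
Qed.

End covariances.

(** * Variance lower bounds *)

Section circulant_lower_bound.
Context {R : realType} (n : nat) (w : complex R).
Notation C := (complex R).
Notation toC := (@real_complex_def R (Phant R)).
Notation N := n.+1.
Notation I := 'I_N.
Notation MP := (mpoly N R).
Notation MC := (mpoly N C).
Notation a := (coef w (@id I)).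
Hypothesis wP : N.-primitive_root w.
Hypothesis n3 : (3 <= n)%N.
Context d (T : measurableType d) (P : probability T R) (X : nat -> {RV P >-> R}).
Hypothesis gaussX : gaussian_input P X.
Notation Ex := (Ex X).
Notation Ep := (@Ep R N _ _ P X).
Variable p : nat.
Hypothesis p0 : (0 < p)%N.

Lemma bernoulli_ge (y : R) q : 0 <= y -> 1 + q%:R * (y - 1) <= y ^+ q.
Proof.
move=> y0; elim: q => [|q IH]; first by rewrite mul0r addr0 expr0.
rewrite exprS; apply: le_trans (ler_wpM2l y0 IH).
rewrite -natr1; have : 0 <= q%:R * (y - 1) ^+ 2 by rewrite mulr_ge0 ?sqr_ge0.
move: (q%:R) => r; nra.
Qed.

(** For q > 0 the terms of [poisson_power 1 g q] have nonnegative coefficients and degrees of the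
    parity of q - 1, so the product contains only even powers of g. *)
Lemma poisson_power_ge0 (g : R) q : 0 <= poisson_power 1 g q * g ^+ q.-1.
Proof.
elim/nat_ind2: q => [||q IH]; rewrite /= ?mul0r// ?mul1r ?ler01//.
rewrite mulr1 mulrDl addr_ge0 -?expr2 ?sqr_ge0// -mulrA mulr_ge0//.
case: q IH => [|q] IH; first by rewrite /= mul0r.
have -> : poisson_power 1 g q.+1 * g ^+ q.+2 =
  poisson_power 1 g q.+1 * g ^+ q.+1.-1 * g ^+ 2 by rewrite -mulrA -exprD addn2.
by rewrite mulr_ge0 ?sqr_ge0.
Qed.

Lemma poisson_power0 (A : comNzRingType) (y : A) q : poisson_power 0 y q.+1 = y ^+ q.
Proof. by case: q => [|q]; rewrite /= ?expr0// mulr0 mul0r addr0. Qed.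

Lemma real_of_conj (z : C) : z^* = z -> z = toC (reC z).
Proof. by case: z => x y [/esym/eqP]; rewrite -addr_eq0 -mulr2n mulrn_eq0/= => /eqP ->. Qed.

(** For k != -k, [cov k k] is 0 and so v(lambda_k) = lambda_k^(p - 1); pairing with l = -k, the only
    correlated index, gives p |lambda_k|^(2 (p - 1)), which Bernoulli's inequality bounds below by a
    quadratic polynomial of mean 1. For k = -k the form is real and its contribution nonnegative. *)
Lemma circulant_kernel_ge x :
  \sum_(k < N | k != - k) (1 + p.-1%:R * (md (cev (lform a k) x) ^+ 2 - 1)) <=
  pev (rkernel a p (trace_poly (@id I) p)) x.
Proof.
rewrite (rkernelE (ofR_trace_poly wP (@id I) p)) pev_reM /ckernel cev_sum raddf_sum/=.
rewrite -[X in _ <= X]/(\sum_k reC _) [leRHS](bigID (fun k : I => k != - k))/= -[leLHS]addr0.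
have E k : reC (cev (\sum_(l < N) mpolyC N (cov a k l) * pois a p k *
      (p%:R * lform a l ^+ p.-1)) x) =
   p%:R * reC (poisson_power (k == - k)%:R (cev (lform a k) x) p *
     (cev (lform a k) x)^* ^+ p.-1).
  rewrite (bigD1 (- k))//= big1 ?addr0; last first.
    by move=> l lk; rewrite cov_circulant// (negbTE lk) mpolyC0 !mul0r.
  rewrite !cov_circulant// eqxx.
  have cc (m : nat) : cev (m%:R : MC) x = m%:R by exact: rmorph_nat.
  rewrite !cevM cc cevXn cevC mul1r (cev_lform_conj wP) mulrCA.
  have -> : cev (pois a p k) x =
      poisson_power (k == - k)%:R (cev (lform a k) x) p.
    rewrite [LHS](rmorph_poisson_power (meval (fun i : 'I_N => toC (x i)))) /= mevalC.
    by rewrite cov_circulant.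
  by rewrite -[p%:R](rmorph_nat (real_complex R)) reC_scale.
apply: lerD.
  apply: ler_sum => k /negbTE kk; rewrite E kk -(prednK p0) poisson_power0 /=.
  move: (cev _ _) => z.
  rewrite -exprMn -normCK mdE -!rmorphXn reCK.
  have y0 := sqr_ge0 (md z); move: (_ ^+ 2) y0 => y y0.
  have y1 : 0 <= y ^+ p.-1 by rewrite exprn_ge0.
  by apply: le_trans (bernoulli_ge _ y0) _; rewrite ler_peMl// ler1n.
apply: sumr_ge0 => k; rewrite negbK => kk; rewrite E kk mulr_ge0//.
have zr : (cev (lform a k) x)^* = cev (lform a k) x.
  by rewrite -(cev_lform_conj wP) -(eqP kk).
rewrite zr (real_of_conj zr) -[true%:R](rmorph1 (real_complex R)).
rewrite -[poisson_power _ _ _](rmorph_poisson_power (real_complex R)) -rmorphXn -rmorphM.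
exact: poisson_power_ge0.
Qed.
Lemma coef_norm k : \sum_(j < N) (reC (a k j) ^+ 2 + complex.Im (a k j) ^+ 2) = 1.
Proof.
have E : toC (\sum_(j < N) (reC (a k j) ^+ 2 + complex.Im (a k j) ^+ 2)) = 1.
  rewrite [LHS](rmorph_sum (real_complex R)) /= -[RHS](_ : \sum_(j < N) a k j * (a k j)^* = 1).
    by apply: eq_bigr => j _; rewrite -normCK mdE -rmorphXn md_sqr.
  by rewrite (gramE wP) cov_circulant// eqxx.
by have := congr1 (@reC R) E; rewrite reCK.
Qed.

(** As E |lambda_k|^2 = 1, each summand of the pointwise bound has mean 1; at most 2 indices are
    self-opposite, and N - 2 >= N / 2 since N >= 4. *)
Lemma circulant_Ep_kernel_ge :
  N%:R / 2 <= Ep (rkernel a p (trace_poly (@id I) p)).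
Proof.
pose al k := rform (fun j => reC (a k j)); pose be k := rform (fun j => complex.Im (a k j)).
pose q : MP := \sum_(k < N | k != - k)
  (mpolyC N (1 - p.-1%:R) + p.-1%:R *: (al k ^+ 2 + be k ^+ 2)).
apply: (@le_trans _ _ (Ep q)); last first.
  apply: (le_Ex gaussX); [exact: tame_pev|exact: tame_pev|move=> x].
  apply: le_trans (circulant_kernel_ge x).
  rewrite le_eqVlt pev_sum; apply/orP; left; apply/eqP; apply: eq_bigr => k _.
  rewrite pevD pevC pevZ pevD md_sqr cev_lform_re cev_lform_im.
  by rewrite !expr2 !pevM; ring.
rewrite (Ep_sum gaussX).
have E k : Ep (mpolyC N (1 - p.-1%:R) + p.-1%:R *: (al k ^+ 2 + be k ^+ 2)) = 1.
  rewrite (EpD gaussX) EpC (EpZ gaussX) (EpD gaussX) !(Ep_rform_sqr gaussX).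
  by rewrite -big_split/= coef_norm mulr1 subrK.
under eq_bigr do rewrite E.
rewrite sumr_const.
have : (N <= #|[pred r : I | r != - r]| + 2)%N.
  have c2 := card_self_opp n; rewrite -[X in (X <= _)%N](card_ord N).
  by rewrite -(cardC [pred r : I | r == - r]) addnC leq_add.
rewrite -[#|_| in X in _ -> X]/(#|[pred r : I | r != - r]|).
move: #|_| => c cN; rewrite ler_pdivrMr// -natrM ler_nat; lia.
Qed.

End circulant_lower_bound.

(** * Test polynomials for the variance *)

Section gaussian_polynomials.
Context {R : realType} (n : nat).
Notation MP := (mpoly n R).
Context d (T : measurableType d) (P : probability T R) (X : nat -> {RV P >-> R}).
Hypothesis gaussX : gaussian_input P X.
Notation Ep := (@Ep R n _ _ P X).

(** Positivity of E (f - c g)^2 at the projection coefficient c. *)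
Lemma Ep_cauchy_schwarz (f g : MP) : 0 < Ep (g ^+ 2) ->
  Ep (f * g) ^+ 2 / Ep (g ^+ 2) <= Ep (f ^+ 2).
Proof.
move=> g0; set c := Ep (f * g) / Ep (g ^+ 2).
have := Ep_sqr_ge0 gaussX (f - c *: g).
have -> : (f - c *: g) ^+ 2 = f ^+ 2 - (2 * c) *: (f * g) + (c ^+ 2) *: g ^+ 2.
  by rewrite -!mul_mpolyC !expr2 !rmorphM/= rmorph_nat; ring.
rewrite (EpD gaussX) (EpB gaussX) !(EpZ gaussX) /c; move: (Ep _) (Ep _) (Ep _) g0 => y x z g0.
have -> : x - 2 * (y / z) * y + (y / z) ^+ 2 * z = x - y ^+ 2 / z by field; rewrite gt_eqF.
by rewrite subr_ge0.
Qed.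

Lemma Ep_rform_even_ge (u : 'I_n -> R) q :
  (\sum_(j < n) u j ^+ 2) ^+ q <= Ep (rform u ^+ (2 * q)).
Proof.
have s0 : 0 <= \sum_(j < n) u j ^+ 2 by rewrite sumr_ge0// => j _; rewrite sqr_ge0.
elim: q => [|q IH]; first by rewrite muln0 !expr0 Ep_one.
rewrite mulnS add2n (Ep_rform_step gaussX) exprS; apply: ler_pM => //.
  by rewrite exprn_ge0.
by rewrite ler_peMl// ler1n.
Qed.

(** The sum of the second Hermite polynomials of the coordinates; testing a polynomial against it
    yields the mean of its Laplacian. *)
Definition hermite2 : MP := \sum_(j < n) (mvar R j ^+ 2 - 1).

Lemma Ep_hermite2 f : Ep (f * hermite2) = \sum_(j < n) Ep (mderiv j (mderiv j f)).
Proof.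
rewrite mulr_sumr (Ep_sum gaussX); apply: eq_bigr => j _.
rewrite mulrBr mulr1 (EpB gaussX).
have -> : f * mvar R j ^+ 2 = mvar R j * (mvar R j * f) by ring.
rewrite (Ep_ibp gaussX) mderivM mderiv_var eqxx mul1r (EpD gaussX) (Ep_ibp gaussX).
by rewrite addrAC subrr add0r.
Qed.

Lemma Ep_hermite2_sqr : Ep (hermite2 ^+ 2) = 2 * n%:R.
Proof.
rewrite expr2 Ep_hermite2.
rewrite (eq_bigr (fun=> 2)) ?sumr_const ?card_ord ?mulr_natr// => j _.
have -> : mderiv j hermite2 = 2 *: mvar R j.
  rewrite /hermite2 raddf_sum/= (bigD1 j)//= big1 ?addr0 => [|i ij].
    by rewrite mderivB mderivX_exp mderiv_var eqxx mulr1 -(mpolyC1 n R) mderivC subr0.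
  by rewrite mderivB mderivX_exp mderiv_var (negbTE ij) mulr0 scaler0 -(mpolyC1 n R) mderivC subr0.
by rewrite mderivZ mderiv_var eqxx (EpZ gaussX) Ep_one mulr1.
Qed.

Lemma Ep_hermite2_rform u q : Ep (rform u ^+ q.+2 * hermite2) =
  q.+2%:R * q.+1%:R * (\sum_(j < n) u j ^+ 2) * Ep (rform u ^+ q).
Proof.
rewrite Ep_hermite2 mulr_sumr mulr_suml; apply: eq_bigr => j _.
rewrite mderivX_exp mderiv_rform mderivZ mulrC mul_mpolyC mderivZ mderivX_exp mderiv_rform.
by rewrite [_ * mpolyC _ _]mulrC mul_mpolyC !(EpZ gaussX) /=; ring.
Qed.

End gaussian_polynomials.

Section sym_circulant_lower_bound.
Context {R : realType} (n : nat) (w : complex R).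
Notation C := (complex R).
Notation toC := (@real_complex_def R (Phant R)).
Notation N := n.+1.
Notation I := 'I_N.
Notation MP := (mpoly N R).
Notation MC := (mpoly N C).
Notation a := (coef w (@fold_index n)).
Hypothesis wP : N.-primitive_root w.
Hypothesis n3 : (3 <= n)%N.
Context d (T : measurableType d) (P : probability T R) (X : nat -> {RV P >-> R}).
Hypothesis gaussX : gaussian_input P X.
Notation Ep := (@Ep R N _ _ P X).
Variable p : nat.
Hypothesis p0 : (0 < p)%N.
Notation W := (trace_poly (@fold_index n) p : MP).
Notation u := (fun k j => reC (a k j)).

Lemma coef_real k j : a k j = toC (u k j).
Proof. by apply: real_of_conj; exact: (coef_sym_conj wP). Qed.

Lemma trace_poly_sym : W = \sum_(k < N) rform (u k) ^+ p.
Proof.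
have lE k : lform a k = ofR (rform (u k)).
  rewrite /lform /rform [RHS](raddf_sum (@ofR R N)); apply: eq_bigr => j _.
  by rewrite {1}coef_real -ofR_C -ofR_X; apply/esym; exact: ofRM.
rewrite -[LHS]reM_ofR (ofR_trace_poly wP) -[RHS]reM_ofR; congr reM.
rewrite [RHS](raddf_sum (@ofR R N)); apply: eq_bigr => k _.
by rewrite lE; apply/esym; exact: (rmorphXn (@ofR R N)).
Qed.

(** The variance of the k-th form is at least 1 - 2 / N, and N >= 4. *)
Lemma sum_sqr_coef k : 2^-1 <= \sum_(j < N) u k j ^+ 2.
Proof.
have -> : \sum_(j < N) u k j ^+ 2 = reC (cov a k k).
  rewrite /cov [RHS](raddf_sum (@reC R)); apply: eq_bigr => j _.
  by rewrite [X in _ = reC (X * _)]coef_real reC_scale expr2.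
apply: le_trans (reC_cov_sym_diag wP k).
have : 2 / N%:R <= 2^-1 :> R; last by move: (_ / _) => z; lra.
by rewrite ler_pdivrMr ?ltr0n// mulrC ler_pdivlMr ?ltr0n// -natrM ler_nat; lia.
Qed.

Lemma Ep_rform_coef_ge k q : 2^-1 ^+ q <= Ep (rform (u k) ^+ (2 * q)).
Proof.
apply: le_trans (Ep_rform_even_ge gaussX _ _).
by rewrite lerXn2r ?nnegrE ?sum_sqr_coef ?invr_ge0// (le_trans _ (sum_sqr_coef k)).
Qed.

(* Cauchy-Schwarz against [\sum_j (X_j ^ 2 - 1)]; for odd [p] this covariance vanishes
   and [X_0] is used instead. *)
Lemma sym_variance_even (c : R) : ~~ odd p ->
  N%:R / (2 * 4 ^+ p) <= Ep ((W - mpolyC N c) ^+ 2).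
Proof.
move=> po; have [q pE] : exists q, p = (2 * q).+2.
  exists (p./2).-1; have := odd_double_half p; rewrite (negbTE po) -mul2n.
  by case: p./2 p0 => [|h]; lia.
have g2 : 0 < Ep ((@hermite2 R N) ^+ 2).
  by rewrite (Ep_hermite2_sqr _ gaussX) mulr_gt0// ltr0n.
apply: le_trans (Ep_cauchy_schwarz gaussX _ g2).
rewrite (Ep_hermite2_sqr _ gaussX).
(* Every k contributes p (p - 1) times the variance of its form times a moment of order 2 q, hence
   at least 2^-(q + 1) >= 2^-p; all contributions being positive, nothing cancels. *)
have E : N%:R * 2^-1 ^+ p <= Ep ((W - mpolyC N c) * (@hermite2 R N)).
  rewrite mulrBl (EpB gaussX) mul_mpolyC (EpZ gaussX).
  have -> : Ep (@hermite2 R N) = 0.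
    rewrite -[@hermite2 _ _]mul1r (Ep_hermite2 gaussX) big1// => j _.
    have -> : mderiv j (1 : MP) = 0 by rewrite -(mpolyC1 N R) mderivC.
    by rewrite mderiv0 -(mpolyC0 N R) EpC.
  rewrite mulr0 subr0 trace_poly_sym mulr_suml (Ep_sum gaussX).
  have -> : N%:R * 2^-1 ^+ p = \sum_(k < N) (2^-1 : R) ^+ p.
    by rewrite sumr_const card_ord mulr_natl.
  apply: ler_sum => k _; rewrite pE (Ep_hermite2_rform gaussX).
  apply: (@le_trans _ _ (2^-1 * 2^-1 ^+ q)); last first.
    apply: ler_pM; rewrite ?exprn_ge0 ?invr_ge0// ?Ep_rform_coef_ge//.
    apply: le_trans (sum_sqr_coef k) _; rewrite ler_peMl//.
      exact: le_trans (sum_sqr_coef k).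
    by rewrite -natrM ler1n.
  by rewrite -exprS ler_wiXn2l ?invr_ge0 ?invf_le1 ?ler1n//; lia.
move: (Ep _) E => D E.
have D2 : (N%:R * 2^-1 ^+ p) ^+ 2 <= D ^+ 2.
  by rewrite lerXn2r ?nnegrE ?mulr_ge0 ?exprn_ge0 ?invr_ge0// (le_trans _ E)// mulr_ge0 ?exprn_ge0 ?invr_ge0.
rewrite ler_pdivlMr ?mulr_gt0 ?ltr0n//; apply: le_trans D2.
rewrite le_eqVlt; apply/orP; left; apply/eqP.
have e4 : 2^-1 ^+ 2 = 4^-1 :> R by field.
rewrite exprMn -exprM mulnC exprM e4 exprVn.
have : 0 < 4 ^+ p :> R by rewrite exprn_gt0.
by move: (4 ^+ p) (N%:R : R) => y z y0; field; rewrite gt_eqF.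
Qed.

(** X_0 occurs in every form L_k with the same positive coefficient N^(-1/2), so the contributions p
    N^(-1/2) E [L_k^(p - 1)] add up without cancellation, p - 1 being even. *)
Lemma sym_variance_odd (c : R) : odd p ->
  N%:R / (2 * 4 ^+ p) <= Ep ((W - mpolyC N c) ^+ 2).
Proof.
move=> po; have [q pE] : exists q, p = (2 * q).+1.
  by exists p./2; have := odd_double_half p; rewrite po -mul2n; lia.
have g2 : Ep (mvar R ord0 ^+ 2) = 1.
  by rewrite expr2 (Ep_ibp gaussX) mderiv_var eqxx Ep_one.
have := @Ep_cauchy_schwarz _ _ _ _ _ _ gaussX (W - mpolyC N c) (mvar R ord0).
rewrite g2 divr1 => /(_ ltr01); apply: le_trans.
have E : Num.sqrt N%:R * 2^-1 ^+ q <= Ep ((W - mpolyC N c) * mvar R ord0).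
  rewrite [_ * mvar _ _]mulrC (Ep_ibp gaussX) mderivB mderivC subr0 trace_poly_sym raddf_sum/= (Ep_sum gaussX).
  have -> : Num.sqrt N%:R * 2^-1 ^+ q = \sum_(k < N) (Num.sqrt N%:R)^-1 * (2^-1 : R) ^+ q.
    rewrite sumr_const card_ord -[RHS]mulr_natl mulrA; congr (_ * _).
    apply: (canRL (mulfK _)); first by rewrite gt_eqF// sqrt_size_gt0.
    by rewrite -expr2 sqr_sqrtr ?ler0n.
  apply: ler_sum => k _.
  rewrite mderivX_exp mderiv_rform (EpZ gaussX).
  rewrite [_ * mpolyC _ _]mulrC mul_mpolyC (EpZ gaussX) (coef_sym0 w) reCK.
  rewrite mulrCA ler_wpM2l ?invr_ge0 ?(ltW (sqrt_size_gt0 _ _))//.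
  rewrite pE/=; apply: le_trans (Ep_rform_coef_ge k q) _.
  by rewrite ler_peMl ?ler1n// (le_trans _ (Ep_rform_coef_ge k q))// exprn_ge0 ?invr_ge0.
move: (Ep _) E => D E.
have D2 : (Num.sqrt N%:R * 2^-1 ^+ q) ^+ 2 <= D ^+ 2.
  by rewrite lerXn2r ?nnegrE ?mulr_ge0 ?exprn_ge0 ?invr_ge0 ?sqrtr_ge0// (le_trans _ E)// mulr_ge0 ?exprn_ge0 ?invr_ge0 ?sqrtr_ge0.
apply: le_trans D2; rewrite exprMn sqr_sqrtr ?ler0n// ler_wpM2l// -exprM exprVn.
rewrite lef_pV2 ?posrE ?mulr_gt0 ?exprn_gt0//.
have -> : 4 = 2 ^+ 2 :> R by ring.
by rewrite -exprM -exprS ler_weXn2l ?ler1n//; lia.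
Qed.

Lemma sym_Ep_kernel_ge : N%:R / (2 * 4 ^+ p) <= Ep (rkernel a p W).
Proof.
rewrite -(Ep_variance_kernel gaussX (rfield_divergence (ofR_trace_poly wP (@fold_index n) p))).
by case: (boolP (odd p)) => o; [exact: sym_variance_odd|exact: sym_variance_even].
Qed.

End sym_circulant_lower_bound.

(** * Asymptotics *)

Section rate.
Context {R : realType}.

(** The lower bound N / 2 of the circulant case is weakened to the N / (2 * 4^p) of the symmetric
    case, so that one estimate covers both; the square of this bound produces the factor 4 *
    16^p. *)
Lemma circulant_total_variation n d (T : measurableType d)
    (P : probability T R) (X : nat -> {RV P >-> R}) (A : 'M[{RV P >-> R}]_n) p (e : R) :
  gaussian_input P X -> A = circulant X n \/ A = sym_circulant X n ->
  (3 < n)%N -> (0 < p)%N -> 0 < e ->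
  (total_variation_distance (distribution P (standardized P (trace_power P A p)))
    (normal_prob 0 1) <= (e + 4 * 16 ^+ p * kernel_const p / (e * n%:R))%:E)%E.
Proof.
case: n A => // n A gaussX AE n3 p0 e0.
have [w wP] := @ex_primitive_root R _ (ltn0Sn n).
have L0 : 0 < n.+1%:R / (2 * 4 ^+ p) :> R by rewrite divr_gt0 ?mulr_gt0 ?exprn_gt0 ?ltr0n.
have s0 : 0 < Num.sqrt n.+1%:R ^+ p :> R by rewrite exprn_gt0// sqrt_size_gt0.
have -> : 4 * 16 ^+ p * kernel_const p / (e * n.+1%:R) =
    n.+1%:R * kernel_const p / (e * (n.+1%:R / (2 * 4 ^+ p)) ^+ 2).
  have -> : 16 ^+ p = (4 ^+ p) ^+ 2 :> R by rewrite exprAC; congr (_ ^+ p); ring.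
  have : 0 < 4 ^+ p :> R by rewrite exprn_gt0.
  move: (4 ^+ p) (kernel_const _) => y K y0.
  by field; rewrite ?gt_eqF// ltr0n.
have main (m : 'I_n.+1 -> 'I_n.+1) : A = translation_mx (fun r => X (m r)) ->
    (forall k, \sum_(l < n.+1) md (cov (coef w m) k l) <= 4) ->
    n.+1%:R / (2 * 4 ^+ p) <= Ep X (rkernel (coef w m) p (trace_poly m p : mpoly n.+1 R)) ->
    (total_variation_distance (distribution P (standardized P (trace_power P A p)))
      (normal_prob 0 1) <=
     (e + n.+1%:R * kernel_const p / (e * (n.+1%:R / (2 * 4 ^+ p)) ^+ 2))%:E)%E.
  move=> -> cov4 LE.
  exact: (kernel_total_variation gaussX p0 (ofR_trace_poly wP m p) cov4
    (gram_of_cov wP cov4) s0 (trace_power_translation m p X) L0 LE e0).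
case: AE => AE.
- apply: (main id); first by rewrite AE circulant_translation.
    exact: sum_cov_circulant.
  apply: le_trans (circulant_Ep_kernel_ge wP n3 gaussX p0).
  rewrite ler_wpM2l ?ler0n// lef_pV2 ?posrE ?mulr_gt0 ?exprn_gt0//.
  by rewrite ler_peMr// exprn_ege1// ler1n.
- apply: (main fold_index); first by rewrite AE sym_circulant_translation.
    exact: sum_cov_sym_circulant.
  exact: sym_Ep_kernel_ge.
Qed.

Lemma total_variation_ge0 d (T : measurableType d) (mu nu : set T -> \bar R) :
  (0 <= total_variation_distance mu nu)%E.
Proof.
apply: (@le_trans _ _ `|mu set0 - nu set0|%E) => //.
by apply: ereal_sup_ubound; exists set0.
Qed.

(** The moment factor is exactly (32 p)^(4 p). The rest, once its prefactor 3072 p^4 is raised to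
    the power p, is the p-th power of a constant times p^6, and that constant is below 32^6; hence 6
    p more in the exponent. *)
Lemma kernel_const_le p : (0 < p)%N ->
  4 * 16 ^+ p * kernel_const p <= (32 * p%:R) ^+ (10 * p) :> R.
Proof.
move=> p0; rewrite /kernel_const !natrM; have : 1 <= p%:R :> R by rewrite ler1n.
move: (p%:R : R) => y y1; have y0 : 0 <= y by lra.
have -> : 2 * (4 * y) * 4 = 32 * y by ring.
have -> : (10 * p = 4 * p + 6 * p)%N by lia.
rewrite exprD.
have -> : 4 * 16 ^+ p * (256 * y ^+ 4 * (4 * y) ^+ (2 * p) *
    (3 ^+ (4 * p) * (3 * (32 * y) ^+ (4 * p)))) =
  (32 * y) ^+ (4 * p) * (4 * 256 * 3 * y ^+ 4 * (16 ^+ p * (4 * y) ^+ (2 * p) * 3 ^+ (4 * p))).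
  by ring.
rewrite ler_wpM2l ?exprn_ge0 ?mulr_ge0// !exprM -!exprMn.
apply: (@le_trans _ _ ((4 * 256 * 3 * y ^+ 4) ^+ p * (16 * (4 * y) ^+ 2 * 3 ^+ 4) ^+ p)).
  rewrite ler_wpM2r ?exprn_ge0 ?mulr_ge0 ?exprn_ge0 ?mulr_ge0// ler_eXnr//.
  have : 1 <= y ^+ 4 by rewrite exprn_ege1.
  move: (y ^+ 4) => z; lra.
rewrite -exprMn lerXn2r ?nnegrE ?mulr_ge0 ?exprn_ge0 ?mulr_ge0//.
have -> : (4 * 256 * 3 * y ^+ 4 * (16 * (4 * y) ^+ 2 * 3 ^+ 4)) =
   (4 * 256 * 3 * 16 * 16 * 81) * y ^+ 6 by ring.
rewrite exprMn ler_wpM2r ?exprn_ge0//.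
have -> : 32 ^+ 6 = (32 * 32 * 32 * 32 * 32 * 32) :> R by ring.
lra.
Qed.

(** Here l stands for ln n. From y <= l / (40 ln l) one gets 32 y <= l, then 10 y ln l <= l / 4; the
    constant 40 is 4 times the 10 of the exponent. *)
Lemma pow_le_expR (y l : R) k : 1 <= ln l -> 0 <= y -> y <= 40^-1 * `|l / ln l| -> k%:R = y ->
  (32 * y) ^+ (10 * k) <= expR (l / 4).
Proof.
move=> ll1 y0 yl ky.
have l0 : 0 < l by rewrite ltNge; apply/negP => l0; move: ll1; rewrite ln0// ler10.
rewrite ger0_norm in yl; last by rewrite divr_ge0 ?ltW// (lt_le_trans ltr01).
have yl' : y * ln l <= l / 40.
  have -> : l / 40 = 40^-1 * (l / ln l) * ln l by field; rewrite gt_eqF// (lt_le_trans ltr01).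
  by rewrite ler_wpM2r// (le_trans ler01).
have h : 32 * y <= expR (ln l) by rewrite lnK ?posrE//; nra.
apply: (@le_trans _ _ (expR (ln l) ^+ (10 * k))).
  by rewrite lerXn2r ?nnegrE ?mulr_ge0 ?expR_ge0.
by rewrite -expRM_natl ler_expR natrM ky; lra.
Qed.

Lemma near_le_ln (A : R) : \forall n \near \oo, A <= ln n%:R.
Proof.
near=> n; have h : expR A <= n%:R by near: n; exact: nbhs_infty_ger.
by rewrite -ler_expR lnK// posrE (lt_le_trans (expR_gt0 A)).
Unshelve. all: by end_near. Qed.

Lemma kernel_rate (p : nat -> nat) : (forall n, (0 < p n)%N) ->
  (fun n => (p n)%:R : R) =o_\oo (fun n => ln n%:R / ln (ln n%:R) : R) ->
  \forall n \near \oo, 4 * 16 ^+ p n * (kernel_const (p n) : R) <= expR (ln n%:R / 4).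
Proof.
move=> p0 /eqoP/(_ 40^-1) po.
have {}po : \forall n \near \oo, `|(p n)%:R : R| <= 40^-1 * `|ln n%:R / ln (ln n%:R) : R|.
  by apply: po; rewrite invr_gt0.
near=> n; apply: le_trans (kernel_const_le (p0 n)) _.
apply: pow_le_expR => //.
- near: n; near=> n; have h : expR 1 <= ln (n%:R : R) by near: n; exact: near_le_ln.
  by rewrite -ler_expR lnK// posrE (lt_le_trans (expR_gt0 1)).
- by rewrite -[leLHS](@ger0_norm R)//; near: n.
Unshelve. all: by end_near. Qed.

End rate.

Theorem theorem2 (R : realType) (d : measure_display) (T : measurableType d)
    (P : probability T R) (X : nat -> {RV P >-> R})
    (A : forall n : nat, 'M[{RV P >-> R}]_n) (p : nat -> nat) :
  gaussian_input P X ->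
  (forall n, A n = circulant X n) \/ (forall n, A n = sym_circulant X n) ->
  (forall n, (0 < p n)%N) ->
  (fun n => (p n)%:R : R) =o_\oo (fun n => ln n%:R / ln (ln n%:R) : R) ->
  total_variation_distance (distribution P (standardized P (trace_power P (A n) (p n))))
    (normal_prob 0 1) @[n --> \oo] --> 0%E.
Proof.
move=> gaussX AE p0 po.
apply: (@squeeze_cvge _ _ _ _ (fun=> 0%E) _ (fun n => (2 * expR (- (ln n%:R / 4) : R))%:E)).
- near=> n; rewrite total_variation_ge0/=.
  have AEn : A n = circulant X n \/ A n = sym_circulant X n by case: AE => ->; [left|right].
  have n3 : (3 < n)%N by near: n; exact: nbhs_infty_gt.
  (* The choice e = n^(-1/4): with the kernel constants at most n^(1/4), the second term is at most
     n^(-1/2). *)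
  apply: le_trans (circulant_total_variation gaussX AEn n3 (p0 n) (expR_gt0 (- (ln n%:R / 4)))) _.
  have Kn : 4 * 16 ^+ p n * (kernel_const (p n) : R) <= expR (ln n%:R / 4).
    by near: n; exact: kernel_rate.
  rewrite lee_fin [leRHS]mulr_natl mulr2n lerD2l ler_pdivrMr ?mulr_gt0 ?expR_gt0 ?ltr0n//; last lia.
  apply: le_trans Kn _.
  have n0 : 0 < n%:R :> R by rewrite ltr0n; lia.
  rewrite -[X in _ * (_ * X)](lnK n0) -!expRD ler_expR.
  have : 0 <= ln n%:R :> R by rewrite ln_ge0// ler1n; lia.
  move: (ln _) => l; lra.
- exact: cvg_cst.
apply: cvg_EFin; first by near=> n.
apply/cvgr0Pnorm_le => e e0; near=> n => /=.
have h : - 4 * ln (e / 2) <= ln n%:R by near: n; exact: near_le_ln.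
rewrite ger0_norm ?mulr_ge0 ?expR_ge0//.
have e2 : e / 2 \in Num.pos by rewrite posrE divr_gt0.
have -> : e = 2 * expR (ln (e / 2)) by rewrite lnK//; field.
rewrite ler_wpM2l// ler_expR; move: (ln _) (ln _) h => a b; lra.
Unshelve. all: by end_near. Qed.
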